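(* Suppose that $\sum_{s=1}^{N}c_s\,\mathbb{S}_{\mu^{s,1}}(\mathcal{X}_m,\mathcal{Y}_n)\cdots\mathbb{S}_{\mu^{s,l_s}}(\mathcal{X}_m,\mathcal{Y}_n)=0$ with $c_s\in\mathbb{C}$, where for every $s$ the partitions $\mu^{s,1},\ldots,\mu^{s,l_s}$ satisfy $|\mu^{s,1}|+\cdots+|\mu^{s,l_s}|=m+n$. Then $$\sum_{s=1}^Nc_s\sum_{(I_1,\ldots,I_{l_s})}\mathrm{Imm}_{\chi^{\mu^{s,1}}}(X_{I_1})\cdots\mathrm{Imm}_{\chi^{\mu^{s,l_s}}}(X_{I_{l_s}})=0,$$ where for each $s$ the inner sum runs over all sequences $(I_1,\ldots,I_{l_s})$ of pairwise disjoint subsets of $[m+n]$ (each listed in increasing order) with $|I_j|=|\mu^{s,j}|$ (so their union is $[m+n]$).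
   Context: $\mathbb{C}^{m|n}$ has homogeneous basis $e_1,\ldots,e_{m+n}$, parity $\bar i=0$ for $i\le m$, $\bar i=1$ for $i>m$; $e_{ij}$ are the matrix units, of parity $\bar i+\bar j$. $\mathcal{A}=A(\mathrm{Mat}_{m|n})$ is the free supercommutative $\mathbb{C}$-algebra on generators $x_{ij}$ ($1\le i,j\le m+n$) of parity $\bar i+\bar j$. For $k\ge1$ and $1\le a\le k$, $X_a=\sum_{i,j}x_{ij}\otimes1^{\otimes(a-1)}\otimes e_{ij}\otimes1^{\otimes(k-a)}\in\mathcal{A}\otimes\mathrm{End}(\mathbb{C}^{m|n})^{\otimes k}$ (graded tensor products with sign rule $(a\otimes b)(c\otimes d)=(-1)^{|b||c|}ac\otimes bd$). $\mathfrak{S}_k$ acts on $(\mathbb{C}^{m|n})^{\otimes k}$ by $\sigma\cdot(e_{i_1}\otimes\cdots\otimes e_{i_k})=(-1)^{\bar I_\sigma}e_{i_{\sigma^{-1}(1)}}\otimes\cdots\otimes e_{i_{\sigma^{-1}(k)}}$, $\bar I_\sigma=\sum_{p<q,\sigma(p)>\sigma(q)}\bar i_p\bar i_q$, extended linearly to $\mathbb{C}[\mathfrak{S}_k]$ (even elements $1\otimes(\cdot)$). For an even $T=\sum_{I,J}T^I_J\otimes e_{i_1j_1}\otimes\cdots\otimes e_{i_kj_k}$, $\langle I\mid T\mid J\rangle=(-1)^{\gamma(I,J)}T^I_J$ with $\gamma(I,J)=\sum_a\bar i_a(\bar j_a+1)+\sum_{a<b}\bar j_b(\bar i_a+\bar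 j_a)$. For a $k$-tuple $I=(i_1,\ldots,i_k)$ and $\mu\vdash k$, the super-immanant is $\mathrm{Imm}_{\chi^{\mu}}(X_I)=(-1)^{\sum_p\bar i_p}\langle I\mid\chi^{\mu}X_1\cdots X_k\mid I\rangle$, where the irreducible character $\chi^\mu$ of $\mathfrak{S}_k$ is identified with $\sum_\sigma\chi^\mu(\sigma)\sigma$. Schur supersymmetric polynomials: with $\mathcal{X}_m=(x_1,\ldots,x_m)$, $\mathcal{Y}_n=(y_1,\ldots,y_n)$ commuting indeterminates, define $\mathbb{S}_k$ by $\prod_{i=1}^m(1-x_it)^{-1}\prod_{j=1}^n(1+y_jt)=\sum_{k\ge0}\mathbb{S}_k(\mathcal{X}_m,\mathcal{Y}_n)t^k$ ($\mathbb{S}_k=0$ for $k<0$), and for a partition $\lambda$ of length $l$, $\mathbb{S}_\lambda=\det(\mathbb{S}_{\lambda_i-i+j})_{1\le i,j\le l}$. *)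

(* Defs.v *)
From HB Require Import structures.
From mathcomp Require Import all_boot all_order all_algebra all_fingroup.
From mathcomp Require Import mpoly.

Set Implicit Arguments.
Unset Strict Implicit.
Unset Printing Implicit Defensive.

Import GRing.Theory.
Local Open Scope ring_scope.

(* Indices of C^{m|n} are the ordinals 'I_(m+n) (0-based): index i is even   *)
(* iff i < m, odd iff m <= i.  Generators x_ij of A(Mat_{m|n}) are pairs     *)
(* (i,j) of such indices, of parity par i + par j.                            *)

Section Parity.
Variables m n : nat.
Definition par (i : 'I_(m + n)) : nat := (m <= i)%N.
Definition pe (i j : 'I_(m + n)) : nat := (par i + par j)%N.
Definition gen := ('I_(m + n) * 'I_(m + n))%type.
Definition gpar (g : gen) : bool := odd (pe g.1 g.2).
Definition grank (g : gen) : nat := enum_rank g.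
End Parity.

(* The free supercommutative algebra A = A(Mat_{m|n}) over C.                 *)
(* We represent an element of A by a formal C-linear combination of words in *)
(* the generators (an element of the free associative algebra C<x_ij>), and  *)
(* we read it in the supercommutative quotient through its coefficients on   *)
(* the standard basis of A: the normally ordered monomials (generators sorted *)
(* by grank, odd generators occurring at most once).  A word u maps to       *)
(* (-1)^(number of inversions among its odd letters) * sort(u), or to 0 if   *)
(* an odd generator occurs twice (x^2 = 0 for odd x).                         *)

Section FreeSuperAlgebra.
Variables (C : numClosedFieldType) (m n : nat).
Local Notation gen := (gen m n).
Local Notation gpar := (@gpar m n).
Local Notation grank := (@grank m n).

Definition Aelt := seq (C * seq gen).
Definition Aone : Aelt := [:: (1, [::])].
Definition Agen (g : gen) : Aelt := [:: (1, [:: g])].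
Definition Ascale (c : C) (a : Aelt) : Aelt := [seq (c * t.1, t.2) | t <- a].
Definition Amul (a b : Aelt) : Aelt :=
  [seq (s.1 * t.1, s.2 ++ t.2) | s <- a, t <- b].
(* sums are concatenation: \big[cat/[::]] *)

Definition gle (g h : gen) : bool := (grank g <= grank h)%N.

Fixpoint inv_odd (u : seq gen) : nat :=
  if u is g :: u' then
    (gpar g * count (fun h => gpar h && (grank h < grank g)%N) u' + inv_odd u')%N
  else 0%N.

Definition word_coeff (u w : seq gen) : C :=
  if (sort gle u == w) && uniq [seq g <- u | gpar g]
  then (-1) ^+ inv_odd u else 0.

Definition Acoeff (a : Aelt) (w : seq gen) : C :=
  \sum_(t <- a) t.1 * word_coeff t.2 w.

Definition Azero (a : Aelt) : Prop := forall w : seq gen, Acoeff a w = 0.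
End FreeSuperAlgebra.

(* Irreducible characters chi^mu of S_k, as characters of the Specht module   *)
(* C[S_k] c_mu, where c_mu = (sum_{p in R} p)(sum_{q in Q} sgn(q) q) is the   *)
(* Young symmetrizer of the row-reading tableau of shape mu (entries 0..k-1),*)
(* R its row group and Q its column group.  The character value at s is the  *)
(* trace of left multiplication by s on the left ideal C[S_k] c_mu, i.e. on   *)
(* the row space of the matrix whose rows are the t * c_mu (t in S_k).        *)

Section Specht.
Variables (C : numClosedFieldType) (k : nat) (mu : seq nat).

Definition rowof (t : 'I_k) : nat :=
  count (fun r => (sumn (take r.+1 mu) <= t)%N) (iota 0 (size mu)).
Definition colof (t : 'I_k) : nat := (t - sumn (take (rowof t) mu))%N.

Definition row_grp : {set 'S_k} := [set p : 'S_k | [forall t, rowof (p t) == rowof t]].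
Definition col_grp : {set 'S_k} := [set q : 'S_k | [forall t, colof (q t) == colof t]].

Definition young_sym (g : 'S_k) : C :=
  \sum_(p in row_grp) \sum_(q in col_grp | (p * q)%g == g) (-1) ^+ odd_perm q.

Definition specht_mx : 'M[C]_(#|{perm 'I_k}|) :=
  \matrix_(i, j) young_sym ((enum_val i)^-1 * enum_val j)%g.

Definition lmul_mx (s : 'S_k) : 'M[C]_(#|{perm 'I_k}|) :=
  \matrix_(i, j) (((s * enum_val i)%g == enum_val j)%:R : C).

Definition irr_char (s : 'S_k) : C :=
  \tr (row_base specht_mx *m lmul_mx s *m pinvmx (row_base specht_mx)).
End Specht.

(* Even elements of A (x) End(C^{m|n})^{(x)k}, written sum T^I_J (x) e_{I,J}, *)
(* are represented by their coefficient functions T : I -> J -> A.            *)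

Section Tensors.
Variables (C : numClosedFieldType) (m n k : nat).
Local Notation tup := (k.-tuple 'I_(m + n)).
Local Notation Aelt := (Aelt C m n).
Local Notation par := (@par m n).
Local Notation pe := (@pe m n).

Definition tens := tup -> tup -> Aelt.

Definition tpar (I J : tup) : nat := (\sum_(p < k) pe (tnth I p) (tnth J p))%N.

(* product of even elements: (x (x) e_{I,K})(y (x) e_{K,L}) =
   (-1)^(|e_{I,K}| |y|) xy (x) e_{I,K} e_{K,L}, and in the graded tensor
   product of matrix algebras e_{I,K} e_{K,L} =
   (-1)^(sum_{p>q} |e_{i_p k_p}| |e_{k_q l_q}|) e_{I,L}. *)
Definition tmul (T U : tens) : tens := fun I L =>
  \big[cat/[::]]_(K : tup)
    Ascale ((-1) ^+ (tpar I K * tpar K L +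
                     \sum_(p < k) \sum_(q < k | (q < p)%N)
                        pe (tnth I p) (tnth K p) * pe (tnth K q) (tnth L q))%N)
           (Amul (T I K) (U K L)).

Definition tone : tens := fun I J => if I == J then Aone C m n else [::].

(* X_a = sum_{i,j} x_ij (x) 1^{(a-1)} (x) e_ij (x) 1^{(k-a)} *)
Definition Xa (a : 'I_k) : tens := fun I J =>
  if [forall b : 'I_k, (b != a) ==> (tnth I b == tnth J b)]
  then Agen C (tnth I a, tnth J a) else [::].

Definition Xprod : tens := foldl (fun T a => tmul T (Xa a)) tone (enum 'I_k).

(* sigma . (e_{j_1} (x) ... (x) e_{j_k}) = (-1)^{Jbar_sigma} e_{j_{s^-1 1}} ... *)
Definition perm_tup (s : 'S_k) (J : tup) : tup := [tuple tnth J ((s^-1)%g p) | p < k].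
Definition perm_sign (s : 'S_k) (J : tup) : nat :=
  (\sum_(p < k) \sum_(q < k | (p < q)%N && (s q < s p)%N)
     par (tnth J p) * par (tnth J q))%N.

(* Identification End(C^{m|n})^{(x)k} = End((C^{m|n})^{(x)k}) by the Koszul
   rule (a_1 (x)...(x) a_k)(v_1 (x)...(x) v_k) =
   (-1)^(sum_{p<q} |a_q||v_p|) a_1 v_1 (x)...(x) a_k v_k; so e_{I,J} maps e_J
   to (-1)^(koszul I J) e_I. *)
Definition koszul (I J : tup) : nat :=
  (\sum_(q < k) \sum_(p < k | (p < q)%N) pe (tnth I q) (tnth J q) * par (tnth J p))%N.

Definition perm_tens (s : 'S_k) : tens := fun I J =>
  if I == perm_tup s J then [:: ((-1) ^+ (perm_sign s J + koszul I J), [::])]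
  else [::].

Definition chiT (chi : 'S_k -> C) (T : tens) : tens := fun I J =>
  \big[cat/[::]]_(s : 'S_k) Ascale (chi s) (tmul (perm_tens s) T I J).

Definition gamma (I J : tup) : nat :=
  (\sum_(a < k) par (tnth I a) * (par (tnth J a)).+1 +
   \sum_(a < k) \sum_(b < k | (a < b)%N)
      par (tnth J b) * (par (tnth I a) + par (tnth J a)))%N.

Definition bra (I : tup) (T : tens) (J : tup) : Aelt :=
  Ascale ((-1) ^+ gamma I J) (T I J).

Definition immk (chi : 'S_k -> C) (I : tup) : Aelt :=
  Ascale ((-1) ^+ (\sum_(p < k) par (tnth I p))%N) (bra I (chiT chi Xprod) I).
End Tensors.

Definition Imm (C : numClosedFieldType) (m n : nat) (mu : seq nat)
    (I : seq 'I_(m + n)) : Aelt C m n :=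
  @immk C m n (size I) (@irr_char C (size I) mu) (in_tuple I).

(* Schur supersymmetric polynomials in {mpoly C[m+n]}: variable lshift n i is *)
(* x_(i+1) (i < m), variable rshift m j is y_(j+1) (j < n).  The coefficient  *)
(* of t^k in prod_i (1 - x_i t)^-1 prod_j (1 + y_j t) equals that of the      *)
(* product with each geometric series truncated at degree k.                  *)

Section Schur.
Variables (C : numClosedFieldType) (m n : nat).

Definition schur_genfun (k : nat) : {poly {mpoly C[m + n]}} :=
  (\prod_(i < m) \sum_(a < k.+1) ('X_(lshift n i))%:P ^+ a * 'X^a) *
  \prod_(j < n) (1 + ('X_(rshift m j))%:P * 'X).

Definition superS (k : nat) : {mpoly C[m + n]} := (schur_genfun k)`_k.

Definition superSz (z : int) : {mpoly C[m + n]} :=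
  match z with Posz k => superS k | Negz _ => 0 end.

Definition superSchur (la : seq nat) : {mpoly C[m + n]} :=
  \det (\matrix_(i < size la, j < size la)
          superSz ((nth 0%N la i)%:Z - (i : nat)%:Z + (j : nat)%:Z)).
End Schur.

Definition is_partition (la : seq nat) : bool :=
  sorted geq la && all (fun x => 0 < x)%N la.

Definition admissible (m n : nat) (mus : seq (seq nat))
    (Is : {ffun 'I_(size mus) -> {set 'I_(m + n)}}) : bool :=
  [forall j, #|Is j| == sumn (nth [::] mus j)] &&
  [forall i, forall j, (i != j) ==> [disjoint Is i & Is j]].

(* Main.v *)
(* Let d = m + n.  Only words whose letters are x_(u i, i) for a permutation u of the
   d indices occur in the sum, and every product of super-immanants over a set
   partition contributes the same sign to such a word.  Hence the sum equals
   Sum_u F(u) theta(u), where F = Sum_s c_s Ind (chi^(mu^(s,1)) x ... x chi^(mu^(s,l_s)))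
   is a class function on S_d.  By Frobenius' formula the characteristic of F in the super
   power sums p_1, ..., p_d is Sum_s c_s Prod_j S_(mu^(s,j)) = 0.  The Jacobian of
   p_1, ..., p_d in the d variables is a Vandermonde determinant up to a nonzero factor,
   so these power sums are algebraically independent and F = 0.

   Frobenius' formula identifies the trace on the Specht module with the alternating
   sum of Young permutation characters given by the Jacobi-Trudi determinant.  Both
   families of class functions are unitriangular with respect to sums over Young
   subgroups (the pigeonhole principle on one side, the bialternant formula on the
   other), and distinct Specht characters are orthogonal. *)
Require Import Defs.
From HB Require Import structures.
From mathcomp Require Import all_boot all_order all_algebra all_fingroup.
From mathcomp Require Import mpoly zify.

Set Implicit Arguments.
Unset Strict Implicit.
Unset Printing Implicit Defensive.

Import Order.TTheory GRing.Theory.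
Local Open Scope ring_scope.

(** The degree condition is what makes power sums sufficient: a cycle type of [S_d] is a monomial in
    p_1, ..., p_d, and d is also the number of variables. [psum] carries arbitrary nonzero scalars
    because the same independence result is used twice: with signs for the theorem itself, and with
    all scalars 1 inside Frobenius' formula, where the monomial coefficients of a characteristic
    come from sums over Young subgroups, so that these sums determine a class function. Set
    partitions with labelled blocks are encoded as colourings [t], and their Young subgroups as
    [stab t]; an induced character is then a sum over the colourings fixed by [u]. The obstacle on
    the algebra side is that the sign of a product of super-immanants depends on the order in which
    the blocks are concatenated. So does the sign from sorting the odd letters; only the combination
    of both is independent of the order, which lets the contributions of different set partitions to
    the same [u] be added. *)

Section SubPerm.
Variables (T : finType) (e : seq T).
Hypothesis ue : uniq e.
Implicit Types (s : 'S_(size e)) (u : {perm T}).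

Local Notation iota := (tnth (in_tuple e)).

Lemma tnth_seq_inj : injective iota.
Proof. by apply/tuple_uniqP. Qed.

(** The action of [u] on the positions of [e], where [irr_char] lives. The default 1 is returned
    when [u] does not map [e] to itself, so that the expression makes sense in sums over all [u]. *)
Definition sub_perm u : 'S_(size e) :=
  odflt 1%g [pick s : 'S_(size e) | [forall p, iota (s p) == u (iota p)]].

Definition ext_fun s (x : T) : T :=
  if insub (index x e) is Some p then iota (s p) else x.

Lemma index_tnth_seq p : index (iota p) e = p.
Proof. by rewrite (tnth_nth (iota p)) index_uniq. Qed.

Lemma ext_funE s p : ext_fun s (iota p) = iota (s p).
Proof.
rewrite /ext_fun; case: insubP => [q _ /esym|].
  by rewrite index_tnth_seq => /val_inj ->.
by rewrite index_tnth_seq ltn_ord.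
Qed.

Lemma ext_fun_notin s x : x \notin e -> ext_fun s x = x.
Proof. by move=> xe; rewrite /ext_fun insubF // index_mem (negPf xe). Qed.

Lemma ext_funK s : cancel (ext_fun s) (ext_fun s^-1%g).
Proof.
move=> x; have [/tnthP [p ->]|xe] := boolP (x \in in_tuple e).
  by rewrite !ext_funE permK.
by rewrite !ext_fun_notin.
Qed.

Definition ext_perm s : {perm T} := perm (can_inj (ext_funK s)).

Lemma ext_permE s p : ext_perm s (iota p) = iota (s p).
Proof. by rewrite permE ext_funE. Qed.

Lemma ext_perm_on s : perm_on [set x in e] (ext_perm s).
Proof.
apply/subsetP => x; rewrite !inE; apply: contraR => xe.
by rewrite permE ext_fun_notin.
Qed.

Lemma sub_perm_eq s u : (forall p, iota (s p) = u (iota p)) -> sub_perm u = s.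
Proof.
move=> su; rewrite /sub_perm; case: pickP => [s' /forallP hs /=|/(_ s) /forallP[]].
  by apply/permP => p; apply: tnth_seq_inj; rewrite su (eqP (hs p)).
by move=> p; apply/eqP.
Qed.

Lemma sub_permE u : (forall x, x \in e -> u x \in e) ->
  forall p, iota (sub_perm u p) = u (iota p).
Proof.
move=> ust.
pose f p : 'I_(size e) := insubd p (index (u (iota p)) e).
have fE p : iota (f p) = u (iota p).
  rewrite (tnth_nth (iota p)) /f val_insubd index_mem ust ?mem_tnth //.
  by rewrite nth_index // ust // mem_tnth.
have fI : injective f.
  by move=> p q /(congr1 iota); rewrite !fE => /perm_inj /tnth_seq_inj.
have -> : sub_perm u = perm fI by apply: sub_perm_eq => p; rewrite permE fE.
by move=> p; rewrite permE.
Qed.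

Lemma perm_on_stable u : perm_on [set x in e] u -> forall x, x \in e -> u x \in e.
Proof. by move=> uon x; have := perm_closed x uon; rewrite !inE => ->. Qed.

Lemma ext_permK s : sub_perm (ext_perm s) = s.
Proof. by apply: sub_perm_eq => p; rewrite ext_permE. Qed.

Lemma sub_permK u : perm_on [set x in e] u -> ext_perm (sub_perm u) = u.
Proof.
move=> uon; apply/permP => x; have [/tnthP [p ->]|xe] := boolP (x \in in_tuple e).
  by rewrite ext_permE sub_permE //; apply: perm_on_stable.
by rewrite permE ext_fun_notin // (out_perm uon) // inE.
Qed.

Lemma reindex_sub_perm (R : nmodType) (F : 'S_(size e) -> R) :
  \sum_s F s = \sum_(u | perm_on [set x in e] u) F (sub_perm u).
Proof.
rewrite (reindex_onto sub_perm ext_perm) => [|s _]; last exact: ext_permK.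
apply: eq_bigl => u /=; apply/eqP/idP => [<-|]; [exact: ext_perm_on | exact: sub_permK].
Qed.

End SubPerm.

Lemma eq_sub_perm (T : finType) (e : seq T) (u v : {perm T}) :
  {in e, u =1 v} -> sub_perm e u = sub_perm e v.
Proof.
move=> uv; rewrite /sub_perm; congr odflt; apply: eq_pick => s /=.
by apply: eq_forallb => p; rewrite uv // mem_tnth.
Qed.

(** * Colourings and Young subgroups *)

Section Colorings.
Variables (V T : finType).
Implicit Types (t : {ffun T -> V}) (u : {perm T}).

(** The Young subgroup of [t]: a colouring stands for a set partition with blocks labelled by [V],
    empty blocks allowed. *)
Definition stab t u := [forall x, t (u x) == t x].
Definition fiber t v : seq T := enum [set x | t x == v].

Lemma fiber_uniq t v : uniq (fiber t v). Proof. exact: enum_uniq. Qed.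

Lemma mem_fiber t v x : (x \in fiber t v) = (t x == v).
Proof. by rewrite mem_enum inE. Qed.

Lemma size_fiber t v : size (fiber t v) = #|[set x | t x == v]|.
Proof. by rewrite cardE. Qed.

Lemma stabP t u : reflect (forall x, t (u x) = t x) (stab t u).
Proof. by apply: (iffP forallP) => h x; apply/eqP. Qed.

Lemma stab_fiber t u v : stab t u -> forall x, x \in fiber t v -> u x \in fiber t v.
Proof. by move=> /stabP tu x; rewrite !mem_fiber tu. Qed.

Lemma perm_on_fiber t v u x : perm_on [set x in fiber t v] u ->
  (t (u x) == v) = (t x == v).
Proof. by move=> uon; have := perm_closed x uon; rewrite !inE !mem_fiber. Qed.

(** A Young subgroup is the product of the symmetric groups of its blocks. The hypothesis on [F]
    says that the component at [v] is read only on its own block, where it agrees with the glued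
    permutation. *)
Lemma reindex_stab (R : nmodType) t (F : (V -> {perm T}) -> R) :
  (forall f g : V -> {perm T},
     (forall v, {in fiber t v, f v =1 g v}) -> F f = F g) ->
  \sum_(f in family (fun v => [pred u | perm_on [set x in fiber t v] u])) F f =
  \sum_(u | stab t u) F (fun=> u).
Proof.
move=> Fext.
pose glue (f : {ffun V -> {perm T}}) : {perm T} :=
  odflt 1%g [pick u : {perm T} | [forall x, u x == f (t x) x]].
pose split u : {ffun V -> {perm T}} := [ffun v => restr_perm [set x in fiber t v] u].
have restrE u v x : stab t u -> x \in fiber t v ->
    restr_perm [set x in fiber t v] u x = u x.
  move=> su xv.
  have nS : u \in 'N([set x in fiber t v] | 'P)%g.
    by apply/astabsP => y; rewrite !in_set /= !mem_fiber /aperm (stabP _ _ su).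
  by rewrite (restr_permE nS) // inE.
have famP f : f \in family (fun v => [pred u | perm_on [set x in fiber t v] u]) ->
    forall v, perm_on [set x in fiber t v] (f v).
  by move=> /familyP h v; have := h v; rewrite inE.
have glueE f : f \in family (fun v => [pred u | perm_on [set x in fiber t v] u]) ->
    forall x, glue f x = f (t x) x.
  move=> /famP ff x; rewrite /glue; case: pickP => [u /forallP /(_ x) /eqP //|].
  have gI : injective (fun x => f (t x) x).
    move=> y z /= yz; have tyz : t y = t z.
      apply/eqP; rewrite -(perm_on_fiber y (ff (t z))).
      have : t (f (t y) y) == t y by rewrite (perm_on_fiber y (ff (t y))).
      rewrite yz => /eqP h.
      have /eqP h2 : t (f (t z) z) == t z by rewrite (perm_on_fiber z (ff (t z))).
      by rewrite h2 in h; rewrite h (perm_on_fiber y (ff _)).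
    by move: yz; rewrite tyz => /perm_inj.
  by move=> /(_ (perm gI)) /forallP[] y; rewrite permE.
rewrite [RHS](reindex_onto glue split) /=; last first.
  move=> u su; apply/permP => x; rewrite glueE.
    by rewrite ffunE restrE // mem_fiber.
  apply/familyP => v; rewrite inE ffunE; exact: restr_perm_on.
apply: eq_big => [f|f ff]; last first.
  by apply: Fext => v x; rewrite glueE // mem_fiber => /eqP ->.
apply/idP/andP => [ff|[sf /eqP <-]]; last first.
  by apply/familyP => v; rewrite inE ffunE; exact: restr_perm_on.
have sg : stab t (glue f).
  apply/stabP => x; rewrite glueE //; apply/eqP.
  by rewrite (perm_on_fiber x (famP _ ff (t x))).
split => //; apply/eqP/ffunP => v; rewrite ffunE; apply/permP => x.
have [xv|xv] := boolP (x \in fiber t v).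
  by rewrite restrE // glueE //; move: xv; rewrite mem_fiber => /eqP ->.
rewrite (out_perm (restr_perm_on _ _)) ?inE // (out_perm (famP _ ff v)) //.
by rewrite inE.
Qed.

Lemma sum_stab_prod (R : comNzRingType) t (Phi : V -> forall k, 'S_k -> R) :
  \sum_(u | stab t u) \prod_v Phi v _ (sub_perm (fiber t v) u) =
  \prod_v \sum_(s : 'S_(size (fiber t v))) Phi v _ s.
Proof.
under [RHS]eq_bigr => v _ do rewrite (reindex_sub_perm (fiber_uniq t v)).
rewrite bigA_distr_big_dep /= (reindex_stab (F := fun f =>
   \prod_v Phi v _ (sub_perm (fiber t v) (f v)))) //.
move=> f g fg; apply: eq_bigr => v _; congr Phi; exact: eq_sub_perm.
Qed.

Lemma card_stab t : #|[set u | stab t u]| = (\prod_v (size (fiber t v))`!)%N.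
Proof.
have E : \sum_(u | stab t u) (1 : int) = \prod_v ((size (fiber t v))`!)%:R.
  transitivity (\prod_v \sum_(s : 'S_(size (fiber t v))) (1 : int)).
    rewrite -(sum_stab_prod t (fun _ k (_ : 'S_k) => 1 : int)).
    by apply: eq_bigr => u _; rewrite big1_eq.
  by apply: eq_bigr => v _; rewrite sumr_const card_Sn.
apply/eqP; rewrite -(Num.Theory.eqr_nat int) natr_prod -E sumr_const cardsE.
by apply/eqP; congr (_ *+ _); apply: eq_card => u; rewrite !inE.
Qed.

(** The i-th element of each block of [t'] is sent to the i-th element of the block of [t] with the
    same label. *)
Lemma perm_of_content t t' : (forall v, size (fiber t v) = size (fiber t' v)) ->
  exists u : {perm T}, forall x, t (u x) = t' x.
Proof.
move=> tt'.
pose f x := nth x (fiber t (t' x)) (index x (fiber t' (t' x))).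
have lt_ix x : (index x (fiber t' (t' x)) < size (fiber t (t' x)))%N.
  by rewrite tt' index_mem mem_fiber.
have tf x : t (f x) = t' x by apply/eqP; rewrite -mem_fiber mem_nth.
have fI : injective f.
  move=> x y fxy; have txy : t' x = t' y by rewrite -!tf fxy.
  move: fxy; rewrite /f -txy (set_nth_default y) // => /eqP.
  rewrite nth_uniq ?fiber_uniq //; last by rewrite txy.
  by move=> /eqP; apply: index_inj; rewrite ?mem_fiber ?txy.
by exists (perm fI) => x; rewrite permE.
Qed.

Lemma sum_fibers t : (\sum_v size (fiber t v) = #|T|)%N.
Proof.
rewrite -sum1_card (partition_big t xpredT) //=; apply: eq_bigr => v _.
by rewrite -cardE cardsE sum1_card.
Qed.

Lemma size_fiber_comp t u v : size (fiber [ffun x => t (u x)] v) = size (fiber t v).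
Proof.
rewrite !size_fiber -(card_imset _ (@perm_inj _ u)); apply: eq_card => x.
rewrite in_set; apply/imsetP/idP => [[y]|h].
  by rewrite in_set ffunE => + ->.
by exists (u^-1 x)%g; rewrite ?permKV // in_set ffunE permKV.
Qed.

Lemma stab_comp t u (g : {perm T}) : stab [ffun x => t (g x)] u = stab t (u ^ g)%g.
Proof.
apply/stabP/stabP => h x; last by have := h (g x); rewrite !ffunE permJ.
by have := h (g^-1 x)%g; rewrite !ffunE -permJ permKV.
Qed.

Definition has_content (al : V -> nat) t := [forall v, size (fiber t v) == al v].

(** Orbit-stabilizer: composing a fixed [t0] with permutations reaches every colouring of this
    content, and the permutations that give one colouring form a coset of the stabilizer of [t0]. *)
Lemma card_content (al : V -> nat) : (\sum_v al v = #|T|)%N ->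
  (#|[set t | has_content al t]| * \prod_v (al v)`! = #|T|`!)%N.
Proof.
move=> sal.
have [t0 /forallP t0al] : exists t0, has_content al t0.
  pose s0 := flatten [seq nseq (al v) v | v <- enum V].
  have ss0 : size s0 == #|T|.
    rewrite size_flatten /shape -map_comp -sal sumnE big_map big_enum /=.
    by apply/eqP/eq_bigr => v _; rewrite size_nseq.
  pose s1 := Tuple ss0.
  exists [ffun x => tnth s1 (enum_rank x)]; apply/forallP => v; apply/eqP.
  have cs v' : count_mem v' s0 = al v'.
    rewrite /s0 count_flatten -map_comp sumnE big_map big_enum /=.
    rewrite (bigD1 v') //= big1 => [|w wv]; first by rewrite count_nseq /= eqxx mul1n addn0.
    by rewrite count_nseq /= (negPf wv).
  rewrite -cs -[s0]/(tval s1) -(map_tnth_enum s1) count_map -size_filter.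
  have -> : [seq i <- enum 'I_#|T| | preim (tnth s1) (pred1 v) i] =
            enum [set i | tnth s1 i == v].
    rewrite enumT; apply: eq_filter => i.
    by rewrite -[RHS]/(i \in [set j | tnth s1 j == v]) in_set; reflexivity.
  rewrite size_fiber -cardE -(card_imset _ (@enum_rank_inj T)); apply: eq_card => i.
  rewrite in_set; apply/imsetP/idP => [[x]|h].
    by rewrite in_set ffunE => + ->.
  by exists (enum_val i); rewrite ?enum_valK // in_set ffunE enum_valK.
have -> : (\prod_v (al v)`!)%N = #|[set u | stab t0 u]|.
  by rewrite card_stab; apply: eq_bigr => v _; rewrite (eqP (t0al v)).
have -> : (#|T|`! = #|{: {perm T}}|)%N.
  rewrite -[#|T|]cardsT -card_perm; apply: eq_card => u; rewrite [RHS]inE unfold_in.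
  by apply/subsetP => x; rewrite inE.
rewrite -[RHS]sum1_card (partition_big (fun u : {perm T} => [ffun x => t0 (u x)])
   (has_content al)) /=; last first.
  by move=> u _; apply/forallP => v; rewrite size_fiber_comp.
rewrite -sum1_card big_distrl /=; apply: eq_big => [t|t]; first by rewrite inE.
rewrite inE => /forallP tal; rewrite mul1n sum1_card.
have [v|w tw] := @perm_of_content t0 t; first by rewrite (eqP (tal v)) (eqP (t0al v)).
rewrite -[LHS](card_imset _ (mulgI w)); apply: eq_card => u.
rewrite -[RHS]/([ffun x => t0 (u x)] == t).
apply/imsetP/eqP => [[p]|tu].
  rewrite inE => /stabP pst ->; apply/ffunP => x.
  by rewrite ffunE permM pst tw.
exists (w^-1 * u)%g; last by rewrite mulKVg.
rewrite inE; apply/stabP => x; rewrite permM.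
have /(congr1 (fun f : {ffun _} => f (w^-1 x)%g)) := tu.
by rewrite ffunE => ->; rewrite -tw permKV.
Qed.

End Colorings.

(** * Cycle types *)

(** The product of power sums indexed by the cycle type of [u], when [p] gives the power sums. *)
Definition cyc_wt (R : comNzRingType) (p : nat -> R) (T : finType) (u : {perm T}) : R :=
  \prod_(c in porbits u) p #|c|.

Section CycleWeights.
Variable R : comNzRingType.
Implicit Types (p : nat -> R) (T : finType).

Lemma porbit_fiber (V T : finType) (t : {ffun T -> V}) (u : {perm T}) x y :
  stab t u -> y \in porbit u x -> t y = t x.
Proof.
move=> /stabP su /porbitP [i ->]; elim: i => [|i IH]; first by rewrite perm1.
by rewrite expgSr permM su.
Qed.

Lemma porbit_intertwine (T T' : finType) (g : T -> T') (u : {perm T}) (v : {perm T'}) x :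
  (forall y, g (u y) = v (g y)) -> porbit v (g x) = g @: porbit u x.
Proof.
move=> gu; have gui i y : g ((u ^+ i)%g y) = (v ^+ i)%g (g y).
  elim: i => [|i IH]; first by rewrite !perm1.
  by rewrite !expgSr !permM gu IH.
apply/setP => z; apply/porbitP/imsetP => [[i ->]|[y /porbitP [i ->] ->]].
  by exists ((u ^+ i)%g x); rewrite ?gui // mem_porbit.
by exists i; rewrite gui.
Qed.

Lemma cyc_wt_intertwine p (T T' : finType) (g : T -> T') (u : {perm T}) (v : {perm T'}) :
  injective g -> (forall y, g (u y) = v (g y)) ->
  cyc_wt p u = \prod_(c in [set porbit v (g x) | x : T]) p #|c|.
Proof.
move=> gI gu; rewrite /cyc_wt.
have -> : [set porbit v (g x) | x : T] = [set g @: c | c : {set T} in porbits u].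
  apply/setP => c; apply/imsetP/imsetP => [[x _ ->]|[_ /imsetP [x _ ->] ->]].
    by exists (porbit u x); [apply: imset_f | apply: porbit_intertwine].
  by exists x => //; rewrite (porbit_intertwine _ gu).
rewrite [RHS]big_imset /=; last first.
  by move=> c c' _ _ cc'; apply/setP => x; rewrite -!(mem_imset _ _ gI) cc'.
by apply: eq_bigr => c _; rewrite card_imset.
Qed.

Lemma cyc_wt_stab p (V T : finType) (t : {ffun T -> V}) (u : {perm T}) : stab t u ->
  cyc_wt p u = \prod_v cyc_wt p (sub_perm (fiber t v) u).
Proof.
move=> su; rewrite {1}/cyc_wt.
pose col (c : {set T}) : option V := omap t [pick x in c].
have colE x : col (porbit u x) = Some (t x).
  rewrite /col; case: pickP => [y /= yc|/(_ x)]; last by rewrite porbit_id.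
  by rewrite (porbit_fiber su yc).
rewrite (partition_big col (fun o => o \in [set Some v | v : V])) /=; last first.
  by move=> _ /imsetP [x _ ->]; rewrite colE; apply: imset_f.
rewrite big_imset /=; last by move=> v w _ _ [].
apply: eq_bigr => v _.
pose io := tnth (in_tuple (fiber t v)).
rewrite (cyc_wt_intertwine p (g := io) (v := u)); last first.
- by move=> x; rewrite /io sub_permE ?fiber_uniq //; apply: stab_fiber.
- by apply: tnth_seq_inj; apply: fiber_uniq.
apply: eq_bigl => c; apply/andP/imsetP => [[/imsetP [x _ ->]]|[q _ ->]].
  rewrite colE => /eqP [xv].
  have /tnthP [q qx] : x \in in_tuple (fiber t v) by rewrite mem_fiber xv.
  by exists q; rewrite // /io -qx.
rewrite imset_f // colE; split=> //; apply/eqP; congr Some; apply/eqP.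
by rewrite -mem_fiber mem_tnth.
Qed.

(* Colorings constant on cycles are functions on the set of cycles. *)
Lemma prod_sum_colorings (V T : finType) (w : V -> nat -> R) (u : {perm T}) :
  \prod_(c in porbits u) \sum_v w v #|c| =
  \sum_(t : {ffun T -> V} | stab t u) \prod_v cyc_wt (w v) (sub_perm (fiber t v) u).
Proof.
(* The distributive law below needs a default colour [v0]. Without colours both sides are 0 if [T]
   has a point, and 1 if [T] is empty. *)
have [v0 _|V0] := pickP (fun _ : V => true); last first.
  have [x0 _|T0] := pickP (fun _ : T => true).
    rewrite (bigD1 (porbit u x0)) ?imset_f //= big1 ?mul0r => [|v _]; last first.
      by have := V0 v.
    by rewrite big1 // => t _; have := V0 (t x0).
  rewrite big_pred0 => [|c]; last by apply/imsetP => [[x]]; have := T0 x.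
  rewrite (bigD1 [ffun x => False_rect V (elimF idP (T0 x) isT)]) /=; last first.
    by apply/stabP => x; have := T0 x.
  rewrite [X in _ = _ + X]big_pred0 ?addr0 => [|t].
    by rewrite big1 // => v; have := V0 v.
  apply/negbTE; rewrite negb_and; apply/orP; right; rewrite negbK; apply/eqP/ffunP => x.
  by have := T0 x.
rewrite (big_distr_big_dep v0 _ (fun _ => xpredT)) /=.
pose to_t (f : {ffun {set T} -> V}) : {ffun T -> V} := [ffun x => f (porbit u x)].
(* Sets that are not cycles get the default [v0], so that the function on sets is determined by the
   colouring. *)
pose to_f (t : {ffun T -> V}) : {ffun {set T} -> V} :=
  [ffun c : {set T} => if c \in porbits u then odflt v0 (omap t [pick x in c]) else v0].
have to_fE t x : stab t u -> to_f t (porbit u x) = t x.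
  move=> su; rewrite ffunE imset_f //; case: pickP => [y /= yc|/(_ x)].
    by rewrite (porbit_fiber su yc).
  by rewrite porbit_id.
rewrite [RHS](reindex_onto to_t to_f) /=; last first.
  by move=> t st; apply/ffunP => x; rewrite ffunE to_fE.
have st f : stab (to_t f) u.
  apply/stabP => x; rewrite !ffunE; congr (f _); apply/eqP.
  by rewrite eq_porbit_mem -[u x](congr1 (fun g : {perm T} => g x) (expg1 u)) mem_porbit.
apply: eq_big => [f|f /pfamilyP [/subsetP fs _]].
  rewrite st /=; apply/pfamilyP/eqP => [[/subsetP fs _]|<-].
    apply/ffunP => c; have [/imsetP [x _ ->]|cu] := boolP (c \in porbits u).
      by rewrite to_fE // ffunE.
    rewrite ffunE (negPf cu); apply/esym/eqP; apply: contraR cu => fc.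
    by apply: fs.
  split=> //; apply/subsetP => c; rewrite unfold_in ffunE.
  by case: ifP; rewrite ?eqxx.
rewrite (partition_big f xpredT) //=; apply: eq_bigr => v _.
rewrite (cyc_wt_intertwine _ (g := tnth (in_tuple (fiber (to_t f) v))) (v := u)); last first.
- by move=> x; rewrite sub_permE ?fiber_uniq //; apply: stab_fiber.
- by apply: tnth_seq_inj; apply: fiber_uniq.
apply: eq_big => [c|c /andP [_ /eqP ->] //].
apply/andP/imsetP => [[/imsetP [x _ ->]]|[q _ ->]].
  move=> /eqP xv.
  have /tnthP [q qx] : x \in in_tuple (fiber (to_t f) v) by rewrite mem_fiber ffunE xv.
  by exists q; rewrite // -qx.
split; first exact: imset_f.
have := mem_tnth q (in_tuple (fiber (to_t f) v)).
by rewrite mem_fiber ffunE.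
Qed.

End CycleWeights.

Section CycleType.
Variable T : finType.
Implicit Types u v : {perm T}.

Definition cyc_count u (r : nat) := #|[set c in porbits u | #|c| == r]|.

Lemma eq_perm_iter u i j x :
  ((u ^+ i)%g x == (u ^+ j)%g x) = (i == j %[mod #|porbit u x|]).
Proof.
set n := #|_|; have n0 : (0 < n)%N by rewrite lt0n card_porbit_neq0.
have red k : (u ^+ k)%g x = iter (k %% n) u x.
  rewrite permX {1}(divn_eq k n) addnC iterD; congr iter.
  elim: (k %/ n)%N => // q IH; rewrite mulSn iterD IH; exact: iter_porbit.
rewrite !red -!(nth_traject u (n := n)) ?ltn_pmod //.
by rewrite nth_uniq ?size_traject ?ltn_pmod // uniq_traject_porbit.
Qed.

(** Cycles of equal length are matched by a permutation [b] of the subsets of [T]; in each cycle the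
    i-th iterate of a base point goes to the i-th iterate of the base point of the matched cycle. *)
Lemma conj_of_cyc_count u v : (forall r, cyc_count u r = cyc_count v r) ->
  exists g : {perm T}, forall x, g (u x) = v (g x).
Proof.
move=> uv.
(* A cycle is coloured by its size, any other set by 0. Cycles are nonempty, so the colour 0 is
   free; its frequency agrees because all others do. *)
pose t w : {ffun {set T} -> 'I_#|T|.+1} :=
  [ffun c : {set T} => if c \in porbits w then inord #|c| else ord0].
have tE w c : c \in porbits w -> t w c = #|c| :> nat.
  by move=> cw; rewrite ffunE cw inordK // ltnS max_card.
have t_gt0 w c : (0 < t w c)%N = (c \in porbits w).
  case: (boolP (c \in _)) => cw; last by rewrite ffunE (negPf cw).
  by rewrite tE //; case/imsetP: cw => x _ ->; rewrite lt0n card_porbit_neq0.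
have cnt w (r : 'I_#|T|.+1) : r != ord0 -> size (fiber (t w) r) = cyc_count w r.
  move=> r0; rewrite size_fiber; apply: eq_card => c; rewrite !inE.
  case: (boolP (c \in porbits w)) => cw /=; first by rewrite -val_eqE /= tE.
  by rewrite ffunE (negPf cw) eq_sym (negPf r0).
have [r|b bE] := @perm_of_content _ _ (t v) (t u).
  have [->|r0] := eqVneq r ord0; last by rewrite !cnt.
  have := sum_fibers (t v); rewrite -(sum_fibers (t u)).
  rewrite (bigD1 ord0) //= [in RHS](bigD1 ord0) //=.
  rewrite (eq_bigr (fun i => size (fiber (t u) i))) => [/addIn //|i i0].
  by rewrite !cnt.
have b_in c : c \in porbits u -> b c \in porbits v.
  by rewrite -!t_gt0 bE.
have b_card c : c \in porbits u -> #|b c| = #|c|.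
  by move=> cu; rewrite -(tE v) ?b_in // bE tE.
pose rho (x : T) (c : {set T}) := odflt x [pick y in c].
have rhoP w x c : c \in porbits w -> porbit w (rho x c) = c.
  case/imsetP => y _ ->; rewrite /rho; case: pickP => [z /= zy|/(_ y)].
    by apply/eqP; rewrite eq_porbit_mem.
  by rewrite porbit_id.
pose cu x := porbit u x.
have cuP x : cu x \in porbits u by apply: imset_f.
have idx x : exists i, x == (u ^+ i)%g (rho x (cu x)).
  have /porbitP [i xE] : x \in porbit u (rho x (cu x)) by rewrite rhoP ?porbit_id.
  by exists i; apply/eqP.
have rho_def w x y c : c \in porbits w -> rho x c = rho y c.
  by case/imsetP => z _ ->; rewrite /rho; case: pickP => // /(_ z); rewrite porbit_id.
pose ix x := xchoose (idx x).
have ixE x : (u ^+ ix x)%g (rho x (cu x)) = x by rewrite -(eqP (xchooseP (idx x))).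
pose f x := (v ^+ ix x)%g (rho x (b (cu x))).
have same x i j : ((v ^+ i)%g (rho x (b (cu x))) == (v ^+ j)%g (rho x (b (cu x)))) =
   ((u ^+ i)%g (rho x (cu x)) == (u ^+ j)%g (rho x (cu x))).
  by rewrite !eq_perm_iter !rhoP ?b_in ?cuP // b_card.
have cu_u x : cu (u x) = cu x.
  by apply/eqP; rewrite eq_porbit_mem -{1}[u]expg1 mem_porbit.
have fu x : f (u x) = v (f x).
  rewrite /f cu_u (rho_def v (u x) x) ?b_in ?cuP // -permM -expgSr; apply/eqP.
  rewrite same expgSr permM ixE; apply/eqP.
  by have := ixE (u x); rewrite cu_u (rho_def u (u x) x) ?cuP.
have fI : injective f.
  move=> x y fxy.
  have cxy : cu x = cu y.
    apply: (@perm_inj _ b).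
    rewrite -(rhoP v x (b (cu x))) ?b_in ?cuP // -(rhoP v y (b (cu y))) ?b_in ?cuP //.
    by rewrite -(porbit_perm v (ix x)) -[in RHS](porbit_perm v (ix y)) -/(f x) fxy.
  move: fxy; rewrite /f -cxy (rho_def v y x) ?b_in ?cuP // => /eqP.
  by rewrite same ixE (rho_def u x y) ?cuP // cxy ixE => /eqP.
by exists (perm fI) => x; rewrite !permE.
Qed.

Lemma cyc_countV u r : cyc_count u^-1 r = cyc_count u r.
Proof. by rewrite /cyc_count porbitsV. Qed.
End CycleType.

(** * Frobenius characteristics *)

Lemma prod_porbits_const (R : comNzRingType) (T : finType) (u : {perm T}) (x : R) :
  \prod_(c in porbits u) x ^+ #|c| = x ^+ #|T|.
Proof.
rewrite -[RHS]prodr_const (partition_big_imset (porbit u)) /=.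
apply: eq_bigr => _ /imsetP [y _ ->]; rewrite -prodr_const; apply: eq_bigl => z.
by rewrite eq_porbit_mem.
Qed.

Lemma sum_sign_perm (R : comNzRingType) k : (1 < k)%N ->
  \sum_(u : 'S_k) (-1) ^+ u = 0 :> R.
Proof.
case: k => [|[|k]] // _.
have t01 : tperm (ord0 : 'I_k.+2) (lift ord0 ord0) = true :> bool by rewrite odd_tperm.
rewrite (bigID (fun u : 'S_k.+2 => odd_perm u)) /=.
rewrite (eq_bigr (fun=> -1)) => [|u ->]; last by rewrite expr1.
rewrite [X in _ + X](eq_bigr (fun=> 1)) => [|u /negbTE ->]; last by rewrite expr0.
rewrite (reindex_inj (mulgI (tperm (ord0 : 'I_k.+2) (lift ord0 ord0)))) /=.
rewrite [X in X + _](eq_bigl (fun u : 'S_k.+2 => ~~ odd_perm u)) => [|u].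
  by rewrite -big_split big1 //= => u _; rewrite addNr.
by rewrite odd_permM t01.
Qed.

Lemma coef_prod (R : comNzRingType) (V : finType) (Z : V -> {poly R}) K k :
  (forall v, size (Z v) <= K)%N ->
  (\prod_v Z v)`_k =
  \sum_(al : {ffun V -> 'I_K} | (\sum_v al v == k)%N) \prod_v (Z v)`_(al v).
Proof.
move=> sZ.
rewrite (eq_bigr (fun v => \sum_(a < K) (Z v)`_a *: 'X^a)); last first.
  move=> v _; rewrite -poly_def; apply/polyP => i; rewrite coef_poly; case: ltnP => //.
  by move=> /(leq_trans (sZ v)) /(nth_default _).
rewrite bigA_distr_bigA /= coef_sum [RHS]big_mkcond; apply: eq_bigr => al _.
rewrite scaler_prod coefZ -(big_morph _ (exprD _) (expr0 _)) coefXn eq_sym.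
by case: ifP; rewrite ?mulr1 ?mulr0.
Qed.

Section Characteristic.
Variables (C : numFieldType) (N : nat).
Local Notation R := {mpoly C[N]}.
Implicit Types p : nat -> R.

(* k! times the Frobenius characteristic of f, with p in place of the power sums. *)
Definition chs p k (f : 'S_k -> C) : R := \sum_(u : 'S_k) f u *: cyc_wt p u.
(** The cycle index of ['S_k], that is, the complete homogeneous function h_k expressed in power
    sums. *)
Definition hS p k : R := (k`!%:R^-1 : C) *: chs p (fun _ : 'S_k => 1).

Lemma fact_neq0 k : (k`!%:R : C) != 0.
Proof. by rewrite Num.Theory.pnatr_eq0 -lt0n fact_gt0. Qed.

Lemma sum_cyc_wt p k : \sum_(u : 'S_k) cyc_wt p u = (k`!%:R : C) *: hS p k.
Proof.
rewrite scalerA mulfV ?fact_neq0 // scale1r; apply: eq_bigr => u _.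
by rewrite scale1r.
Qed.

(** Induction from a Young subgroup becomes multiplication of characteristics. The inner sum is the
    induced function: colourings of content [al] stand for the cosets, and those stable under [u]
    are the fixed ones. *)
Lemma chs_ind p (V : finType) k (f : V -> forall k, 'S_k -> C) (al : V -> nat) :
  (\sum_v al v = k)%N ->
  \sum_(u : 'S_k) (\sum_(t : {ffun 'I_k -> V} | has_content al t && stab t u)
     \prod_v f v _ (sub_perm (fiber t v) u)) *: cyc_wt p u =
  (k`!%:R : C) *: \prod_v (((al v)`!%:R^-1 : C) *: chs p (f v (al v))).
Proof.
move=> sal.
under [LHS]eq_bigr => u _ do rewrite scaler_suml.
rewrite (exchange_big_dep (fun t : {ffun 'I_k -> V} => has_content al t)) /=; last first.
  by move=> u t _ /andP[].
rewrite (eq_bigr (fun=> \prod_v chs p (f v (al v)))) => [|t tal]; last first.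
  rewrite (eq_bigl (stab t)) => [|u]; last by rewrite tal.
  transitivity (\prod_v chs p (f v (size (fiber t v)))); last first.
    by apply: eq_bigr => v _; rewrite (eqP (forallP tal v)).
  rewrite -(sum_stab_prod t (fun v k s => f v k s *: cyc_wt p s)).
  by apply: eq_bigr => u su; rewrite scaler_prod -cyc_wt_stab.
rewrite sumr_const scaler_prod scalerA -scaler_nat; congr (_ *: _).
have := card_content (T := 'I_k) (al := al); rewrite card_ord => /(_ sal) <-.
rewrite natrM natr_prod -mulrA -big_split /= big1 => [|v _]; last first.
  by rewrite mulfV ?fact_neq0.
by rewrite mulr1 cardsE.
Qed.

(** When power sums add, the generating series of the h's multiply. [Z v] has to agree with the
    series of [q v] only up to degree [k], which admits truncated geometric series. *)
Lemma hS_sum (V : finType) (q : V -> nat -> R) p (Z : V -> {poly R}) k :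
  (forall r, p r = \sum_v q v r) ->
  (forall v a, (a <= k)%N -> (Z v)`_a = hS (q v) a) ->
  hS p k = (\prod_v Z v)`_k.
Proof.
move=> pq Zq; pose K := (k.+1 + \max_v size (Z v))%N.
have leK v : (size (Z v) <= K)%N.
  by rewrite (leq_trans _ (leq_addl _ _)) // (leq_bigmax_cond (F := fun v => size (Z v))).
rewrite (coef_prod _ leK).
apply: (@scalerI _ _ (k`!%:R : C)); first exact: fact_neq0.
rewrite -sum_cyc_wt scaler_sumr.
rewrite (eq_bigr (fun u : 'S_k => \sum_(t : {ffun 'I_k -> V} | stab t u)
    \prod_v cyc_wt (q v) (sub_perm (fiber t v) u))); last first.
  by move=> u _; rewrite -prod_sum_colorings; apply: eq_bigr => c _.
rewrite (exchange_big_dep xpredT) //=.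
under eq_bigr => t _.
  rewrite (sum_stab_prod t (fun v k s => cyc_wt (q v) s)).
  under eq_bigr => v _ do rewrite sum_cyc_wt.
  rewrite scaler_prod; over.
pose cont (t : {ffun 'I_k -> V}) : {ffun V -> 'I_K} := [ffun v => inord (size (fiber t v))].
have le_fib (t : {ffun 'I_k -> V}) v : (size (fiber t v) <= k)%N.
  by rewrite size_fiber -[X in (_ <= X)%N](card_ord k) max_card.
have contE t v : cont t v = size (fiber t v) :> nat.
  by rewrite ffunE inordK // ltnS (leq_trans (le_fib t v)) // leq_addr.
rewrite (partition_big cont (fun al => (\sum_v al v == k)%N)) /=; last first.
  move=> t _; apply/eqP; rewrite -[RHS]card_ord -(sum_fibers t).
  by apply: eq_bigr => v _; rewrite contE.
apply: eq_bigr => al /eqP sal.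
rewrite (eq_bigr (fun=> (\prod_v (al v)`!%:R) *: \prod_v (Z v)`_(al v))); last first.
  move=> t /eqP <-; congr (_ *: _); apply: eq_bigr => v _; rewrite contE //.
  by rewrite Zq.
rewrite sumr_const -scaler_nat scalerA -natr_prod -natrM; congr (_%:R *: _).
have := card_content (T := 'I_k) (al := fun v => al v : nat); rewrite card_ord => /(_ sal) <-.
congr (_ * _)%N; rewrite cardsE; apply: eq_card => t.
rewrite -[LHS]/(cont t == al) -[RHS]/(has_content (fun v => al v : nat) t).
apply/eqP/forallP => [<- v|h]; first by rewrite contE.
by apply/ffunP => v; apply: ord_inj; rewrite contE (eqP (h v)).
Qed.

Lemma hS_pow (x : R) k : hS (fun r => x ^+ r) k = x ^+ k.
Proof.
apply: (@scalerI _ _ (k`!%:R : C)); first exact: fact_neq0.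
rewrite -sum_cyc_wt (eq_bigr (fun=> x ^+ k)) => [|u _].
  by rewrite sumr_const card_Sn scaler_nat.
by rewrite /cyc_wt prod_porbits_const card_ord.
Qed.

(** These are the power sums of one odd variable. The weight of [u] is its sign times y^k, and the
    signs of ['S_k] sum to 0 once k > 1, so only 1 + y t is left. *)
Lemma hS_signed_pow (y : R) k :
  hS (fun r => - (- y) ^+ r) k = (1 + y%:P * 'X)`_k.
Proof.
apply: (@scalerI _ _ (k`!%:R : C)); first exact: fact_neq0.
rewrite -sum_cyc_wt (eq_bigr (fun u : 'S_k => (-1) ^+ u * y ^+ k)) => [|u _]; last first.
  rewrite /cyc_wt; under eq_bigr => c _ do rewrite -mulN1r.
  rewrite big_split /= prodr_const prod_porbits_const card_ord (exprNn y) mulrA.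
  by rewrite /odd_perm card_ord -exprD -[in LHS]signr_odd oddD addbC.
rewrite -mulr_suml coefD coef1 coefCM coefX.
case: k => [|[|k]] /=.
- by rewrite mulr0 addr0 fact0 scale1r (big_pred1 1%g) ?odd_perm1 ?mulr1 // => u;
  apply/esym/eqP/permP; case.
- rewrite add0r scale1r (big_pred1 1%g) ?odd_perm1 ?mulr1 ?mul1r // => u.
  by apply/esym/eqP/permP => i; rewrite !ord1.
by rewrite sum_sign_perm // mulr0 mul0r addr0 scaler0.
Qed.

End Characteristic.

(** * Algebraic independence of the signed power sums *)

Section Independence.
Variables (C : numFieldType) (N : nat).
Local Notation R := {mpoly C[N]}.

Lemma mderiv_comp M (lq : M.-tuple R) (P : {mpoly C[M]}) i :
  (P \mPo lq)^`M(i) = \sum_(j < M) (P^`M(j) \mPo lq) * (tnth lq j)^`M(i).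
Proof.
pose D (P : {mpoly C[M]}) :=
  (P \mPo lq)^`M(i) = \sum_(j < M) (P^`M(j) \mPo lq) * (tnth lq j)^`M(i).
have D1 : D 1.
  rewrite /D comp_mpoly1 -mpolyC1 mderivC big1 // => j _.
  by rewrite mderivC comp_mpoly0 mul0r.
have DM P1 P2 : D P1 -> D P2 -> D (P1 * P2).
  rewrite /D => h1 h2; rewrite rmorphM /= mderivM h1 h2 mulr_suml mulr_sumr -big_split /=.
  apply: eq_bigr => j _; rewrite mderivM comp_mpolyD !rmorphM /=.
  by rewrite mulrDl -!mulrA; congr (_ + _); congr (_ * _); rewrite mulrC.
have DX j : D 'X_j.
  rewrite /D comp_mpolyXU (bigD1 j) //= big1 => [|j' jj'].
    rewrite mderivX mnm1E eqxx.
    have -> : (U_(j) - U_(j) = 0)%MM by apply/mnmP => i'; rewrite mnmBE subnn mnm0E.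
    by rewrite mpolyX0 scale1r comp_mpoly1 mul1r addr0 (tnth_nth 0).
  by rewrite mderivX mnm1E eq_sym (negPf jj') scale0r comp_mpoly0 mul0r.
rewrite -/(D P); elim/mpolyind: P => [|c m P _ _ DP].
  rewrite /D comp_mpoly0 mderiv0 big1 // => j _.
  by rewrite mderiv0 comp_mpoly0 mul0r.
have Dm : D 'X_[m].
  rewrite mpolyXE_id; apply: big_ind => // j _.
  by elim: (m j) => [|e IH]; rewrite ?expr0 // exprS; apply: DM.
rewrite /D comp_mpolyD comp_mpolyZ mderivD mderivZ Dm DP scaler_sumr -big_split /=.
apply: eq_bigr => j _.
by rewrite mderivD mderivZ comp_mpolyD comp_mpolyZ mulrDl scalerAl.
Qed.

Variables (s a : 'I_N -> C).
Hypothesis (s0 : forall v, s v != 0) (a0 : forall v, a v != 0).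

(* The p_r of the paper's super setting is the case s = a = -1 on odd variables: the
   sum of all x_i ^ r minus the sum of all (- y_j) ^ r. *)
Definition psum (r : nat) : R := \sum_v s v *: (a v *: 'X_v) ^+ r.

Lemma mderiv_psum r v :
  (psum r.+1)^`M(v) = (s v * a v) *: ((r.+1)%:R *: (a v *: 'X_v) ^+ r).
Proof.
rewrite /psum raddf_sum /= (bigD1 v) //= big1 => [|w wv]; last first.
  rewrite mderivZ exprZn mderivZ mpolyXn mderivX.
  rewrite mulmnE mnm1E (negPf wv) mul0n scale0r !scaler0 //.
rewrite addr0 mderivZ !exprZn mderivZ !mpolyXn mderivX mulmnE mnm1E eqxx mul1n.
have -> : (U_(v) *+ r.+1 - U_(v) = U_(v) *+ r)%MM.
  by apply/mnmP => w; rewrite mnmBE !mulmnE; case: (U_(v)%MM w) => [|[|e]];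
    rewrite ?muln0 ?muln1 ?subn1 // mulnS addKn.
rewrite !scalerA; congr (_ *: _); rewrite exprSr.
by rewrite -!mulrA; congr (_ * _); rewrite mulrCA; congr (_ * _); rewrite mulrC.
Qed.

(* The Jacobian of p_1, ..., p_N is, up to a nonzero scalar, a Vandermonde
   determinant; its kernel is read off the roots of a polynomial of degree < N. *)
Lemma psum_jacobian (D : 'I_N -> R) :
  (forall v, \sum_(j < N) D j * (psum j.+1)^`M(v) = 0) -> forall j, D j = 0.
Proof.
move=> Dp.
(* The factor j + 1 comes from the derivative. Up to the scalar [s v * a v], the equation for [v]
   says that [a v *: 'X_v] is a root of [Q]. *)
pose Q : {poly R} := \poly_(j < N) (if insub j is Some j' then (j.+1%:R : C) *: D j' else 0).
have Q0 : Q = 0.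
  apply: (@roots_geq_poly_eq0 _ _ [seq a v *: 'X_v | v <- enum 'I_N]).
  - apply/allP => _ /mapP [v _ ->]; rewrite /root horner_poly.
    have := Dp v; rewrite (eq_bigr (fun j : 'I_N => (s v * a v) *:
      ((j.+1%:R *: D j) * (a v *: 'X_v) ^+ j))) => [|j _]; last first.
      rewrite mderiv_psum -!scalerAr; congr (_ *: _).
      by rewrite scalerAl.
    rewrite -scaler_sumr => /eqP; rewrite scaler_eq0 mulf_eq0 (negPf (s0 v)) (negPf (a0 v)) /=.
    congr (_ == 0); apply: eq_bigr => j _; rewrite valK //.
  - rewrite map_inj_uniq ?enum_uniq // => v w /(congr1 (mcoeff U_(v))).
    rewrite !mcoeffZ !mcoeffX eqxx mulr1 => /eqP; apply: contraTeq => vw.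
    have -> : (U_(w) == U_(v) :> 'X_{1..N})%MM = false.
      apply/negbTE; apply: contra vw => /eqP /mnmP /(_ v); rewrite !mnm1E eqxx.
      by case: eqP => // ->.
    by rewrite mulr0.
  - by rewrite size_map size_enum_ord size_poly.
move=> j; have := congr1 (fun q : {poly R} => q`_j) Q0; rewrite coef0 coef_poly ltn_ord valK.
move/eqP; rewrite scaler_eq0 Num.Theory.pnatr_eq0 /= => /eqP //.
Qed.

(** Induction on the degree. By the chain rule the partial derivatives of [P] at the power sums lie
    in the kernel of the Jacobian, so they are relations of smaller degree and vanish. In
    characteristic 0 this makes [P] constant. *)
Lemma psum_indep (P : {mpoly C[N]}) : P \mPo [tuple psum i.+1 | i < N] = 0 -> P = 0.
Proof.
elim: {P}(msize P) {-2}P (leqnn (msize P)) => [|k IH] P.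
  by rewrite leqn0 msize_poly_eq0 => /eqP.
move=> sP P0.
have dP j : P^`M(j) = 0.
  apply: IH.
    rewrite msizeE; apply/bigmax_leqP_seq => m; rewrite mcoeff_msupp mcoeff_deriv => h _.
    have : (m + U_(j))%MM \in msupp P.
      by rewrite mcoeff_msupp; apply: contraNneq h => ->; rewrite mul0rn.
    move/msize_mdeg_lt; rewrite mdegD mdeg1 addn1 => h2.
    by rewrite -ltnS (leq_trans h2).
  move: j; apply: psum_jacobian => v.
  have := mderiv_comp [tuple psum i.+1 | i < N] P v.
  rewrite P0 mderiv0 => /esym; under eq_bigr => j _ do rewrite tnth_mktuple.
  by [].
have PC : P = (P@_0)%:MP.
  apply/mpolyP => m; rewrite mcoeffC; have [<-|m0] := eqVneq 0%MM m; first by rewrite mulr1.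
  rewrite mulr0; have [j mj] : exists j, m j != 0%N.
    apply/existsP; rewrite -negb_forall; apply: contra m0 => /forallP h.
    by apply/eqP/mnmP => j; rewrite mnm0E (eqP (h j)).
  have := congr1 (mcoeff (m - U_(j))) (dP j); rewrite mcoeff_deriv mcoeff0 submK.
    by move/eqP; rewrite Num.Theory.mulrn_eq0 /= => /eqP.
  by apply/mnm_lepP => i; rewrite mnm1E; case: eqP => // <-; rewrite lt0n.
by move: P0; rewrite PC comp_mpolyC.
Qed.

Lemma cyc_wt_type (u : 'S_N) :
  'X_[[multinom cyc_count u i.+1 | i < N]] \mPo [tuple psum i.+1 | i < N] = cyc_wt psum u.
Proof.
rewrite comp_mpolyX /cyc_wt.
rewrite (eq_bigr (fun c : {set 'I_N} => \prod_(i < N | i.+1 == #|c|) psum i.+1)); last first.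
  move=> c cu; have c0 : (0 < #|c|)%N.
    by case/imsetP: cu => x _ ->; rewrite lt0n card_porbit_neq0.
  have cN : (#|c|.-1 < N)%N by rewrite prednK // -[X in (_ <= X)%N](card_ord N) max_card.
  rewrite (big_pred1 (Ordinal cN)) /= ?prednK // => i.
  by rewrite -[RHS]/(i == Ordinal cN) -val_eqE /= -[X in _ == X](prednK c0) eqSS.
rewrite (exchange_big_dep xpredT) //=; apply: eq_bigr => i _.
rewrite tnth_mktuple mnmE /cyc_count -prodr_const; apply: eq_bigl => c.
by rewrite !inE eq_sym.
Qed.

(** Monomials in p_1, ..., p_N record cycle types, so by independence coefficients can be compared:
    at the type of [u0] the coefficient is [f u0] times the number of permutations of that type. *)
Lemma class_fun_eq0 (f : 'S_N -> C) :
  (forall u v, (forall r, cyc_count u r = cyc_count v r) -> f u = f v) ->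
  chs psum f = 0 -> forall u, f u = 0.
Proof.
move=> fcl f0 u0.
pose ty (u : 'S_N) : 'X_{1..N} := [multinom cyc_count u i.+1 | i < N].
have /psum_indep P0 : (\sum_u f u *: 'X_[ty u]) \mPo [tuple psum i.+1 | i < N] = 0.
  rewrite raddf_sum -[RHS]f0; apply: eq_bigr => u _ /=.
  by rewrite comp_mpolyZ cyc_wt_type.
have := congr1 (mcoeff (ty u0)) P0; rewrite mcoeff0 raddf_sum /=.
rewrite (bigID (fun u => ty u == ty u0)) /= [X in _ + X]big1 => [|u /negbTE tu]; last first.
  by rewrite mcoeffZ mcoeffX tu mulr0.
rewrite (eq_bigr (fun=> f u0)) => [|u /eqP tu]; last first.
  rewrite mcoeffZ mcoeffX tu eqxx mulr1; apply: fcl => r.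
  (* The exponents record only the lengths 1 to [N], and no cycle has another length. *)
  have big (w : 'S_N) r' : (r' == 0)%N || (N < r')%N -> cyc_count w r' = 0%N.
    move=> hr; apply/eqP; rewrite cards_eq0; apply/eqP/setP => c; rewrite !inE.
    apply/negbTE; apply: contraL hr => /andP [/imsetP [x _ ->] /eqP <-].
    by rewrite negb_or card_porbit_neq0 -leqNgt -[X in (_ <= X)%N](card_ord N) max_card.
  case: r => [|r]; first by rewrite !big.
  have [rN|rN] := ltnP r N; last by rewrite !big //= ltnS.
  by have /mnmP /(_ (Ordinal rN)) := tu; rewrite !mnmE.
rewrite addr0 sumr_const => /eqP; rewrite Num.Theory.mulrn_eq0 => /orP [|/eqP //].
by move=> /eqP /card0_eq /(_ u0); rewrite -[LHS]/(ty u0 == ty u0) eqxx.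
Qed.

End Independence.

(** * Jacobi-Trudi class functions *)

Definition class_fun (C : Type) k (f : 'S_k -> C) := forall u g, f (u ^ g)%g = f u.

Lemma class_fun_cyc_count (C : Type) k (f : 'S_k -> C) : class_fun f ->
  forall u v, (forall r, cyc_count u r = cyc_count v r) -> f u = f v.
Proof.
move=> fcl u v /conj_of_cyc_count [g gE].
suff -> : v = (u ^ g)%g by rewrite fcl.
by apply/permP => x; rewrite -[x](permKV g) permJ gE.
Qed.

Lemma class_funV (C : Type) k (f : 'S_k -> C) u : class_fun f -> f (u^-1)%g = f u.
Proof. by move=> fcl; apply: class_fun_cyc_count => // r; rewrite cyc_countV. Qed.

Lemma sum_stab_content (C : nmodType) k (V : finType) (f : 'S_k -> C)
    (t t' : {ffun 'I_k -> V}) : class_fun f ->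
  (forall v, size (fiber t v) = size (fiber t' v)) ->
  \sum_(u | stab t u) f u = \sum_(u | stab t' u) f u.
Proof.
move=> fcl /perm_of_content [g gE].
have -> : t' = [ffun x => t (g x)] by apply/ffunP => x; rewrite ffunE gE.
rewrite (reindex_inj (conjg_inj g)) /=.
by apply: eq_big => [u|u _]; rewrite ?stab_comp ?fcl.
Qed.

(** All values below the first moved point are taken, so it moves up. This position decides the
    lexicographic comparisons below. *)
Lemma perm_first_moved N (w : 'S_N) : w != 1%g ->
  exists2 i : 'I_N, (forall j : 'I_N, (j < i)%N -> w j = j) & (i < w i)%N.
Proof.
move=> w1; have [i0 wi0] : exists i, w i != i.
  apply/existsP; rewrite -negb_forall; apply: contra w1 => /forallP h.
  by apply/eqP/permP => i; rewrite perm1 (eqP (h i)).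
case: (@arg_minnP _ i0 (fun i => w i != i) (fun i => i : nat) wi0) => i wi imin.
have fixd (j : 'I_N) : (j < i)%N -> w j = j.
  by move=> ji; apply/eqP; apply: contraLR ji => /imin; rewrite -leqNgt.
exists i => //; rewrite ltn_neqAle eq_sym wi /= leqNgt; apply/negP => wii.
by have /perm_inj E := fixd _ wii; rewrite E eqxx in wi.
Qed.

Section JacobiTrudi.
Variable R : comNzRingType.
Implicit Types (H : nat -> R) (mu : nat -> nat).

Definition Hz H (z : int) : R := if z is Posz k then H k else 0.

Definition jt_det H mu N : R :=
  \det (\matrix_(i < N, j < N) Hz H ((mu i)%:Z - (i : nat)%:Z + (j : nat)%:Z)).

(** With a part 0 in row [N] the last row is (0, ..., 0, 1). Padding lets a partition of k be
    treated as having exactly k parts. *)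
Lemma jt_det_pad H mu N : H 0%N = 1 -> mu N = 0%N -> jt_det H mu N.+1 = jt_det H mu N.
Proof.
move=> H0 muN; rewrite /jt_det (expand_det_row _ ord_max) (bigD1 ord_max) //=.
rewrite big1 => [|j jN]; last first.
  have jlt : (j < N)%N.
    by rewrite ltn_neqAle -ltnS ltn_ord andbT -val_eqE in jN *.
  rewrite mxE muN sub0r addrC -opprB subzn ?(ltnW jlt) //.
  by have : (0 < N - j)%N by [rewrite subn_gt0]; case: (N - j)%N => // d _; rewrite -NegzE mul0r.
rewrite addr0 mxE muN sub0r addNr /= H0 mul1r /cofactor /= -signr_odd oddD addbb expr0 mul1r.
congr (\det _); apply/matrixP => i j; rewrite !mxE.
by rewrite (lift_max i) (lift_max j).
Qed.

Lemma jt_det_pads H mu N M : H 0%N = 1 -> (forall i, (N <= i)%N -> mu i = 0%N) ->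
  (N <= M)%N -> jt_det H mu M = jt_det H mu N.
Proof.
move=> H0 mu0 NM; rewrite -(subnKC NM); elim: (M - N)%N => [|d IH]; first by rewrite addn0.
by rewrite addnS jt_det_pad // mu0 // leq_addr.
Qed.

Lemma jt_det_expand H mu N :
  jt_det H mu N = \sum_(w : 'S_N) (-1) ^+ w *
    (if [forall i : 'I_N, (i <= mu i + w i)%N] then \prod_(i < N) H (mu i + w i - i)%N else 0).
Proof.
apply: eq_bigr => w _; congr (_ * _); case: ifP => [/forallP h|/negbT].
  apply: eq_bigr => i _; rewrite mxE addrAC -PoszD subzn //; exact: h.
rewrite negb_forall => /existsP [i]; rewrite -ltnNge => h.
rewrite (bigD1 i) //= mxE addrAC -PoszD -opprB subzn ?(ltnW h) //.
have : (0 < i - (mu i + w i))%N by rewrite subn_gt0.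
by case: (i - _)%N => // d _; rewrite -NegzE mul0r.
Qed.
End JacobiTrudi.

Section JacobiTrudiFun.
Variables (C : numFieldType) (N : nat) (mu : nat -> nat).

(* The coefficient, in the Jacobi-Trudi expansion of mu, of the permutation character on
   colorings of content al. *)
Definition jt_sign (al : 'I_N -> nat) : C :=
  \sum_(w : 'S_N) (-1) ^+ w * [forall i : 'I_N, (al i + i == mu i + w i)%N]%:R.

Definition jt_fun k (u : 'S_k) : C :=
  \sum_(t : {ffun 'I_k -> 'I_N} | stab t u) jt_sign (fun i => size (fiber t i)).

Lemma eq_jt_sign al al' : al =1 al' -> jt_sign al = jt_sign al'.
Proof.
move=> aa; apply: eq_bigr => w _; congr (_ * _); congr (nat_of_bool _)%:R.
by apply: eq_forallb => i; rewrite aa.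
Qed.

Lemma jt_fun_class k : class_fun (@jt_fun k).
Proof.
move=> u g; rewrite /jt_fun.
pose h (t : {ffun 'I_k -> 'I_N}) : {ffun 'I_k -> 'I_N} := [ffun x => t (g x)].
have hI : injective h.
  move=> t t' /ffunP tt; apply/ffunP => x; have := tt (g^-1 x)%g.
  by rewrite !ffunE permKV.
rewrite [RHS](reindex_inj hI) /=; apply: eq_big => [t|t _]; first by rewrite stab_comp.
by apply: eq_jt_sign => i; rewrite size_fiber_comp.
Qed.

(** The term of [w] in the expanded determinant is a product of h's, the characteristic of the
    permutation character on colourings of content mu_i + w(i) - i; [jt_sign] collects the [w] that
    yield a given content. *)
Lemma chs_jt_fun M (p : nat -> {mpoly C[M]}) k : (\sum_(i < N) mu i = k)%N ->
  chs p (@jt_fun k) = (k`!%:R : C) *: jt_det (hS p) mu N.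
Proof.
move=> smu; rewrite jt_det_expand scaler_sumr /chs /jt_fun.
under eq_bigr => u _ do rewrite exchange_big /= scaler_suml.
rewrite exchange_big /=; apply: eq_bigr => w _.
pose al i := (mu (i : 'I_N) + w i - i)%N.
case: ifP => [/forallP h|/negbT]; last first.
  rewrite negb_forall => /existsP [i]; rewrite -ltnNge => h.
  rewrite mulr0 scaler0 big1 // => u _; rewrite big1 ?scale0r // => t _.
  case: forallP => [/(_ i) /eqP E|]; last by rewrite mulr0.
  by move: h; rewrite -E ltnNge leq_addl.
have sal : (\sum_i al i = k)%N.
  apply: (@addIn (\sum_(i < N) i)%N); rewrite -big_split /=.
  rewrite (eq_bigr (fun i : 'I_N => mu i + w i)%N) => [|i _]; last by rewrite subnK.
  rewrite big_split /= smu; congr addn.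
  by rewrite [RHS](reindex_inj (@perm_inj _ w)).
have := chs_ind p (fun _ _ _ => 1 : C) sal.
move=> E; rewrite [RHS]scalerAr -[X in _ * X]E mulr_sumr.
apply: eq_bigr => u _.
rewrite (bigID (has_content al)) /= [X in _ + X]big1 ?addr0 => [|t /andP [_ tal]]; last first.
  rewrite (_ : [forall _, _] = false) ?mulr0 //; apply: contraNF tal => /forallP tw.
  by apply/forallP => i; rewrite -(eqn_add2r i) (eqP (tw i)) subnK.
rewrite -scalerAr; rewrite -[(-1) ^+ w * cyc_wt p u]/(_ * _).
have -> : (-1) ^+ w * cyc_wt p u = ((-1) ^+ w : C) *: cyc_wt p u.
  by case: (odd_perm w); rewrite ?expr0 ?expr1 ?mul1r ?scale1r ?mulN1r ?scaleN1r.
rewrite scalerA; congr (_ *: _); rewrite mulr_suml.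
apply: eq_big => [t|t /andP [_ /forallP tal]]; first by rewrite andbC.
rewrite big1 // mul1r (_ : [forall _, _] = true) ?mulr1 //.
by apply/forallP => i; rewrite (eqP (tal i)) subnK.
Qed.

End JacobiTrudiFun.

(** * Bialternant formula and triangularity of the Jacobi-Trudi functions *)

Section OrdinaryPowerSums.
Variables (C : numFieldType) (N : nat).
Local Notation R := {mpoly C[N]}.
Local Notation p1 := (psum (fun _ : 'I_N => 1 : C) (fun _ => 1)).

Definition content_mnm k (t : {ffun 'I_k -> 'I_N}) : 'X_{1..N} :=
  [multinom size (fiber t v) | v < N].

(** A colouring stable under [u] is a choice of variable for each cycle. This turns statements on
    Young subgroup sums into statements on monomial coefficients, and back. *)
Lemma chs_psum1 k (f : 'S_k -> C) :
  chs p1 f = \sum_(t : {ffun 'I_k -> 'I_N}) (\sum_(u | stab t u) f u) *: 'X_[content_mnm t].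
Proof.
rewrite /chs; under [RHS]eq_bigr => t _ do rewrite scaler_suml.
rewrite [RHS](exchange_big_dep xpredT) //=; apply: eq_bigr => u _.
rewrite -scaler_sumr; congr (_ *: _).
rewrite /cyc_wt (eq_bigr (fun c : {set 'I_k} => \sum_v (fun v r => ('X_v : R) ^+ r) v #|c|));
  last first.
  by move=> c _; apply: eq_bigr => v _; rewrite !scale1r.
rewrite (prod_sum_colorings (fun v r => ('X_v : R) ^+ r)); apply: eq_bigr => t st.
rewrite mpolyXE_id; apply: eq_bigr => v _.
by rewrite mnmE /cyc_wt prod_porbits_const card_ord.
Qed.

Lemma hS0 (p : nat -> R) : hS p 0 = 1.
Proof.
rewrite /hS /chs fact0 invr1 scale1r (big_pred1 1%g) => [|u]; last first.
  by apply/esym/eqP/permP; case.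
by rewrite scale1r /cyc_wt big_pred0 // => c; apply/imsetP => [[]] [].
Qed.

Definition alt_mx (al : 'I_N -> nat) : 'M[R]_N := \matrix_(i, v) 'X_v ^+ al i.

(** Entries are signed elementary symmetric polynomials in the variables other than ['X_v].
    Multiplying the series of the h's by this product leaves only the factor 1 / (1 - X_v t). *)
Definition del_mx : 'M[R]_N := \matrix_(j, v)
  (\prod_(u | u != v) (1 - ('X_u)%:P * 'X) : {poly R})`_(N.-1 - j).

Lemma jt_mx_alt (mu : nat -> nat) :
  (\matrix_(i < N, j < N) Hz (hS p1) ((mu i)%:Z - (i : nat)%:Z + (j : nat)%:Z))
    *m del_mx = alt_mx (fun i => mu i + (N.-1 - i))%N.
Proof.
apply/matrixP => i v; rewrite !mxE.
set a := (mu i + _)%N.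
(* Geometric series truncated at [a], the degree that is read in the end; the error terms of
   truncation start at degree a + 1. *)
pose Z (u : 'I_N) : {poly R} := \sum_(b < a.+1) ('X_u)%:P ^+ b * 'X^b.
have Zb u b : (b <= a)%N -> (Z u)`_b = 'X_u ^+ b.
  move=> ba; rewrite /Z coef_sum (bigD1 (Ordinal (n := a.+1) (m := b) ba)) //= big1 => [|c cb].
    by rewrite -rmorphXn coefCM coefXn eqxx mulr1 addr0.
  rewrite -rmorphXn coefCM coefXn (_ : (b == c) = false) ?mulr0 //.
  by apply/negbTE; rewrite eq_sym -val_eqE in cb *.
have hW b : (b <= a)%N -> hS p1 b = (\prod_u Z u)`_b.
  move=> ba; apply: (hS_sum (q := fun u r => 'X_u ^+ r)).
    by move=> r; apply: eq_bigr => u _; rewrite !scale1r.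
  by move=> u c cb; rewrite hS_pow Zb // (leq_trans cb).
set Q : {poly R} := \prod_(u | u != v) (1 - ('X_u)%:P * 'X).
have tele u : Z u * (1 - ('X_u)%:P * 'X) = 1 - ('X_u)%:P ^+ a.+1 * 'X^(a.+1).
  rewrite mulrC -exprMn -[1 in RHS](expr1n _ a.+1) subrXX; congr (_ * _).
  by apply: eq_bigr => b _; rewrite expr1n mul1r exprMn.
have WQ : (\prod_u Z u * Q)`_a = 'X_v ^+ a.
  rewrite (bigD1 v) //= -mulrA -big_split /= (eq_bigr _ (fun u _ => tele u)).
  have [q ->] : exists q : {poly R}, \prod_(u | u != v) (1 - ('X_u)%:P ^+ a.+1 * 'X^(a.+1)) =
    1 + q * 'X^(a.+1).
    apply: (big_ind (fun z => exists q, z = 1 + q * 'X^(a.+1))).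
    - by exists 0; rewrite mul0r addr0.
    - move=> _ _ [q1 ->] [q2 ->]; exists (q1 + q2 + q1 * q2 * 'X^(a.+1)).
      by rewrite mulrDl mul1r mulrDr mulr1 !mulrDl -!addrA; congr (_ + _); rewrite addrCA;
        congr (_ + _); congr (_ + _); rewrite -!mulrA; congr (_ * _); rewrite mulrCA.
    - by move=> u _; exists (- ('X_u)%:P ^+ a.+1); rewrite mulNr.
  by rewrite mulrDr mulr1 mulrA coefD Zb // coefMXn ltnSn addr0.
have sQ : (size Q <= N)%N.
  case: N v @Q {i a Z Zb hW tele WQ} => [[]//|N'] v Q.
  apply: (leq_trans (size_prod_leq _ _)).
  have -> : #|(fun u : 'I_N'.+1 => u != v)| = N'.
    by transitivity #|predC1 v|; [apply: eq_card | rewrite cardC1 card_ord].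
  rewrite leq_subLR; apply: leq_trans (_ : (\sum_(u < N'.+1 | u != v) 2).+1 <= _)%N.
    rewrite ltnS; apply: leq_sum => u _.
    rewrite (leq_trans (size_polyD _ _)) // size_poly1 size_polyN geq_max /=.
    by rewrite (leq_trans (size_polyMleq _ _)) // size_polyX addn2 /= ltnS size_polyC leq_b1.
  rewrite sum_nat_const.
  have -> : #|(fun u : 'I_N'.+1 => u != v)| = N'.
    by transitivity #|predC1 v|; [apply: eq_card | rewrite cardC1 card_ord].
  by rewrite muln2 -addnn addnS.
rewrite -WQ coefMr.
have Ni : (0 < N)%N by case: N i {Q a Z Zb hW tele WQ sQ} => [[]|].
rewrite (reindex_inj rev_ord_inj) /=.
have term (j : 'I_N) : Hz (hS p1) ((mu i)%:Z - (i : nat)%:Z + (N - j.+1)%N%:Z) =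
   if (j <= a)%N then (\prod_u Z u)`_(a - j) else 0.
  have -> : (mu i)%:Z - (i : nat)%:Z + (N - j.+1)%N%:Z = a%:Z - (j : nat)%:Z.
    by have := ltn_ord i; have := ltn_ord j; rewrite /a; lia.
  case: leqP => ja; first by rewrite subzn //= hW // leq_subr.
  rewrite -opprB subzn ?(ltnW ja) //.
  by have : (0 < j - a)%N by [rewrite subn_gt0]; case: (j - a)%N => // d _; rewrite -NegzE.
have sub_sub (j : 'I_N) : (N.-1 - (N - j.+1) = j)%N.
  by have := ltn_ord j; lia.
under eq_bigr => j _ do rewrite !mxE /= term sub_sub -/Q.
(* The matrix product sums over b < N, the product of series over b <= a. Both ranges extend to a
   common one, since [Q] has degree below [N] and [F] vanishes beyond [a]. *)
pose F b := (if (b <= a)%N then (\prod_u Z u)`_(a - b) else 0) * Q`_b.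
rewrite -(big_mkord xpredT F) -(big_mkord xpredT (fun b => (\prod_u Z u)`_(a - b) * Q`_b)).
have tailN K : (N <= K)%N -> \sum_(0 <= b < N) F b = \sum_(0 <= b < K) F b.
  move=> NK; rewrite [RHS](big_cat_nat (n := N)) //= [X in _ + X]big_nat [X in _ + X]big1
    ?addr0 //.
  by move=> b /andP [Nb _]; rewrite /F [Q`_b]nth_default ?mulr0 // (leq_trans sQ).
have taila K : (a.+1 <= K)%N -> \sum_(0 <= b < a.+1) F b = \sum_(0 <= b < K) F b.
  move=> aK; rewrite [RHS](big_cat_nat (n := a.+1)) //= [X in _ + X]big_nat [X in _ + X]big1
    ?addr0 //.
  by move=> b /andP [ab _]; rewrite /F leqNgt ab mul0r.
rewrite (tailN (maxn N a.+1)) ?leq_maxl // -(taila (maxn N a.+1)) ?leq_maxr //.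
by rewrite !big_nat; apply: eq_bigr => b /andP [_ ba]; rewrite /F -ltnS ba.
Qed.

(* At mu = 0 the Jacobi-Trudi determinant is 1, which evaluates the determinant of
   del_mx without computing it. *)
Lemma jt_det_bialternant (mu : nat -> nat) :
  jt_det (hS p1) mu N * \det (alt_mx (fun i => N.-1 - i)%N) =
  \det (alt_mx (fun i => mu i + (N.-1 - i))%N).
Proof.
have -> : \det (alt_mx (fun i => N.-1 - i)%N) = \det del_mx.
  have := congr1 determinant (jt_mx_alt (fun _ => 0%N)); rewrite det_mulmx.
  rewrite -/(jt_det (hS p1) (fun=> 0%N) N) (@jt_det_pads _ _ _ 0 N) ?hS0 //.
  by rewrite /jt_det det_mx00 mul1r => ->.
by rewrite -det_mulmx jt_mx_alt.
Qed.

(** The term of the identity leads: for any other [w], the inverse of [w] first moves some [i] up,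
    and there the strictly decreasing exponents drop. *)
Lemma mlead_alt (al : 'I_N -> nat) : (forall i j : 'I_N, (i < j)%N -> (al j < al i)%N) ->
  let m := [multinom al i | i < N] in
  [/\ \det (alt_mx al) != 0, mlead (\det (alt_mx al)) = m & (\det (alt_mx al))@_m = 1].
Proof.
move=> al_lt m.
pose mw (w : 'S_N) := [multinom al ((w^-1)%g i) | i < N].
have detE : \det (alt_mx al) = \sum_(w : 'S_N) (-1) ^+ w *: 'X_[mw w].
  apply: eq_bigr => w _; rewrite mpolyXE_id [X in _ = _ *: X](reindex_inj (@perm_inj _ w)) /=.
  rewrite (eq_bigr (fun i => 'X_(w i) ^+ al i)) => [|i _]; last by rewrite mxE.
  rewrite [X in _ = _ *: X](eq_bigr (fun i => 'X_(w i) ^+ al i)) => [|i _];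
    last by rewrite mnmE permK.
  by case: (odd_perm w); rewrite ?expr0 ?expr1 ?mul1r ?scale1r ?mulN1r ?scaleN1r.
have mw_lt w : w != 1%g -> (mw w < m)%O.
  move=> w1; have [|i fixd lti] := @perm_first_moved _ (w^-1)%g; first by rewrite eq_invg1.
  have dE : mdeg (mw w) = mdeg m.
    rewrite !mdegE [RHS](reindex_inj (@perm_inj _ (w^-1)%g)).
    by apply: eq_bigr => j _; rewrite !mnmE.
  apply/(ltmcP dE); exists i => [j ji|]; rewrite !mnmE; [by rewrite fixd | exact: al_lt].
have cE m' : (\det (alt_mx al))@_m' = \sum_(w : 'S_N) (-1) ^+ w * (mw w == m')%:R.
  by rewrite detE raddf_sum /=; apply: eq_bigr => w _; rewrite mcoeffZ mcoeffX.
have mw1 : mw 1%g = m by apply/mnmP => i; rewrite !mnmE invg1 perm1.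
have c1 : (\det (alt_mx al))@_m = 1.
  rewrite cE (bigD1 1%g) //= mw1 eqxx odd_perm1 mulr1 big1 ?addr0 // => w /mw_lt.
  by move=> /lt_eqF ->; rewrite mulr0.
have nz : \det (alt_mx al) != 0.
  by apply/eqP => E; move: c1; rewrite E mcoeff0 => /esym/eqP; rewrite oner_eq0.
split=> //; apply/eqP; rewrite eq_le; apply/andP; split; last first.
  rewrite leNgt; apply/negP => /mcoeff_gt_mlead; rewrite c1 => /eqP.
  by rewrite oner_eq0.
have := mlead_supp nz; rewrite mcoeff_msupp cE => h.
have [w] : exists w, mw w == mlead (\det (alt_mx al)).
  apply/existsP; rewrite -[X in is_true X]negbK negb_exists; apply: contra h => /forallP h.
  by rewrite big1 // => w _; rewrite (negbTE (h w)) mulr0.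
move=> /eqP <-; have [->|/mw_lt/ltW //] := eqVneq w 1%g; by rewrite mw1.
Qed.

(** Leading monomials and coefficients are multiplicative, so those of the determinant are quotients
    of those of the two alternants. *)
Lemma mcoeff_jt_det (mu : nat -> nat) : (forall i j, (i <= j)%N -> (mu j <= mu i)%N) ->
  let m := [multinom mu (i : 'I_N) | i < N] in
  (jt_det (hS p1) mu N)@_m = 1 /\
  forall m', (m < m')%O -> (jt_det (hS p1) mu N)@_m' = 0.
Proof.
move=> mu_dec m.
have d_lt (i j : 'I_N) : (i < j)%N -> (N.-1 - j < N.-1 - i)%N.
  move=> ij; apply: ltn_sub2l => //; apply: (leq_trans ij).
  by rewrite -ltnS prednK // (leq_ltn_trans _ (ltn_ord i)).
have [nz0 l0 c0] := mlead_alt d_lt.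
have [|nz1 l1 c1] := @mlead_alt (fun i => mu i + (N.-1 - i))%N.
  by move=> i j ij; rewrite -addnS leq_add ?d_lt // mu_dec // ltnW.
set D := jt_det _ _ _.
have E := jt_det_bialternant mu; rewrite -/D in E.
have nzD : D != 0 by apply: contraNneq nz1 => D0; rewrite -E D0 mul0r.
have lD : mlead D = m.
  have := mleadM nzD nz0; rewrite E l1 l0 => /mnmP h.
  by apply/mnmP => i; have := h i; rewrite !mnmE => /addIn ->.
split=> [|m']; last by rewrite -lD => /mcoeff_gt_mlead.
have := mleadcM D (\det (alt_mx (fun i => N.-1 - i)%N)).
rewrite l0 lD c0 mulr1 E => <-; rewrite -[RHS]c1; congr (_@__).
by apply/mnmP => i; rewrite !mnmE.
Qed.

End OrdinaryPowerSums.

Section StabSumJT.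
Variables (C : numFieldType) (N k : nat) (mu : nat -> nat).
Hypothesis mu_dec : forall i j, (i <= j)%N -> (mu j <= mu i)%N.
Hypothesis smu : (\sum_(i < N) mu i = k)%N.
Let m : 'X_{1..N} := [multinom mu (i : 'I_N) | i < N].

(** Colourings of equal content have conjugate Young subgroups, so all of them contribute the same
    sum to the coefficient of their monomial. *)
Let stab_sum_coef (t : {ffun 'I_k -> 'I_N}) :
  (\sum_(u | stab t u) jt_fun C N mu u) *+ #|[set t' :
    {ffun 'I_k -> 'I_N} | content_mnm t' == content_mnm t]| =
  k`!%:R * (jt_det (hS (psum (fun _ : 'I_N => 1 : C) (fun _ => 1))) mu N)@_(content_mnm t).
Proof.
rewrite -mcoeffZ -(chs_jt_fun _ smu) chs_psum1 raddf_sum /=.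
rewrite (bigID (fun t' => content_mnm t' == content_mnm t)) /= [X in _ + X]big1 =>
  [|t' /negbTE tt]; last first.
  by rewrite mcoeffZ mcoeffX tt mulr0.
rewrite addr0 -sumr_const; apply: eq_big => [t'|t']; first by rewrite inE.
rewrite inE => /eqP tt; rewrite mcoeffZ mcoeffX tt eqxx mulr1.
apply: sum_stab_content; first exact: jt_fun_class.
by move=> v; have /mnmP /(_ v) := tt; rewrite !mnmE.
Qed.

Lemma stab_sum_jt_gt (t : {ffun 'I_k -> 'I_N}) : (m < content_mnm t)%O ->
  \sum_(u | stab t u) jt_fun C N mu u = 0.
Proof.
move=> mt; have := stab_sum_coef t.
have [_ ->//] := mcoeff_jt_det C N mu_dec; rewrite mulr0 => /eqP.
rewrite Num.Theory.mulrn_eq0 => /orP [|/eqP //].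
by rewrite cards_eq0 => /eqP /setP /(_ t); rewrite !inE eqxx.
Qed.

Lemma stab_sum_jt_eq (t : {ffun 'I_k -> 'I_N}) : content_mnm t = m ->
  \sum_(u | stab t u) jt_fun C N mu u = (\prod_(i < N) (mu i)`!)%:R.
Proof.
move=> mt; have := stab_sum_coef t; rewrite mt.
have [-> _] := mcoeff_jt_det C N mu_dec; rewrite mulr1.
have := card_content (T := 'I_k) (al := fun i : 'I_N => mu i); rewrite card_ord => /(_ smu) <-.
have -> : [set t | has_content (fun i : 'I_N => mu i) t] =
   [set t' : {ffun 'I_k -> 'I_N} | content_mnm t' == m].
  apply/setP => t'; rewrite !inE; apply/forallP/eqP => [h|/mnmP h v].
    by apply/mnmP => v; rewrite !mnmE (eqP (h v)).
  by have := h v; rewrite !mnmE => ->.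
rewrite natrM -[X in X = _ -> _]mulr_natl => E; apply: mulfI E;
  rewrite Num.Theory.pnatr_eq0 cards_eq0.
by apply/eqP => /setP /(_ t); rewrite !inE mt eqxx.
Qed.

End StabSumJT.

(** * Young symmetrizers *)

(** For a predicate true on an initial segment the count is the threshold; [rowof] is defined by
    such a count. *)
Lemma count_initial (P : pred nat) l r :
  (forall a b, (a <= b)%N -> P b -> P a) -> (r < l)%N -> P r = (r < count P (iota 0 l))%N.
Proof.
move=> Pd; elim: l => // l IH; rewrite -[l.+1]addn1 iotaD count_cat /= add0n addn0 addn1 ltnS.
move=> rl; case Pl: (P l).
  have -> : count P (iota 0 l) = l.
    rewrite -[RHS](size_iota 0) -[RHS]count_predT; apply: eq_in_count => b.
    by rewrite mem_iota add0n => /andP[_ bl] /=; apply: Pd (ltnW bl) Pl.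
  by rewrite addn1 ltnS rl (Pd _ _ rl).
rewrite addn0; move: rl; rewrite leq_eqVlt => /orP [/eqP ->|]; last exact: IH.
rewrite Pl; apply/esym/negbTE; rewrite -leqNgt.
by rewrite -[X in (_ <= X)%N](size_iota 0) count_size.
Qed.

Section Tableau.
Variables (k : nat) (mu : seq nat).
Hypotheses (smu : sumn mu = k) (pmu : is_partition mu).
Local Notation row := (@rowof k mu).
Local Notation col := (@colof k mu).
Local Notation psumn r := (sumn (take r mu)).
Implicit Types t a b : 'I_k.

Lemma part_nth_le i j : (i <= j)%N -> (nth 0 mu j <= nth 0 mu i)%N.
Proof.
move=> ij; have /andP [smu' _] := pmu.
have [jl|jl] := ltnP j (size mu); last by rewrite nth_default.
have := sorted_leq_nth (leT := geq) _ _ 0%N smu'; apply => //.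
- by move=> a b c ba cb; apply: leq_trans cb ba.
- by move=> a; apply: leqnn.
- by rewrite inE (leq_ltn_trans ij).
Qed.

Lemma psumnS r : psumn r.+1 = (psumn r + nth 0 mu r)%N.
Proof.
have [rl|rl] := ltnP r (size mu); first by rewrite (take_nth 0%N) // sumn_rcons.
by rewrite !take_oversize ?(leq_trans rl) // nth_default // addn0.
Qed.

Lemma psumn_le r r' : (r <= r')%N -> (psumn r <= psumn r')%N.
Proof.
move=> /subnKC <-; elim: (r' - r)%N => [|d IH]; first by rewrite addn0.
by rewrite addnS psumnS (leq_trans IH) // leq_addr.
Qed.

Lemma row_bounds t : (psumn (row t) <= t < psumn (row t).+1)%N.
Proof.
pose P r := (psumn r.+1 <= t)%N.
have Pd (a b : nat) : (a <= b)%N -> P b -> P a.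
  by move=> ab; apply: leq_trans; apply: psumn_le.
have E r : (r < size mu)%N -> P r = (r < row t)%N by move=> rl;
  rewrite (count_initial (P := P) Pd rl).
have rt : (row t <= size mu)%N.
  by rewrite -[X in (_ <= X)%N](size_iota 0) count_size.
have rt' : (row t < size mu)%N.
  rewrite ltn_neqAle rt andbT; apply/eqP => rE.
  have [m0|m0] := posnP (size mu).
    by have := ltn_ord t; rewrite -[X in (_ < X)%N]smu (size0nil m0).
  have := E (size mu).-1; rewrite rE prednK // leqnn => /(_ isT).
  by rewrite /P prednK // take_size smu leqNgt ltn_ord.
apply/andP; split; last by have := E _ rt'; rewrite ltnn ltnNge => /negbT.
case rE: (row t) => [|r]; first by rewrite take0.
by have := E r; rewrite rE ltnSn /P => ->//; rewrite -rE.
Qed.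

Lemma rowE t r : (psumn r <= t < psumn r.+1)%N -> row t = r.
Proof.
move=> /andP [h1 h2]; have /andP [h3 h4] := row_bounds t.
apply/eqP; rewrite eqn_leq; apply/andP; split; rewrite leqNgt; apply/negP => /psumn_le h.
  by have := leq_trans h2 (leq_trans h h3); rewrite ltnn.
by have := leq_trans h4 (leq_trans h h1); rewrite ltnn.
Qed.

Lemma col_lt t : (col t < nth 0 mu (row t))%N.
Proof. by rewrite /colof; have := row_bounds t; rewrite psumnS; lia. Qed.

Lemma row_col_inj t t' : row t = row t' -> col t = col t' -> t = t'.
Proof.
move=> rE; rewrite /colof -rE => cE; apply: ord_inj.
have /andP [h1 _] := row_bounds t; have /andP [h2 _] := row_bounds t'.
by rewrite -rE in h2; lia.
Qed.

Lemma cell_exists r c : (c < nth 0 mu r)%N -> exists t, row t = r /\ col t = c.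
Proof.
move=> cr; have tk : (psumn r + c < k)%N.
  have := psumn_le (leq_maxl r.+1 (size mu)).
  rewrite (take_oversize (leq_maxr _ _)) smu psumnS; lia.
have rE : row (Ordinal tk) = r by apply: rowE; rewrite psumnS /=; lia.
by exists (Ordinal tk); split => //; rewrite /colof rE /= addKn.
Qed.

Lemma card_row r : #|[set t | row t == r]| = nth 0 mu r.
Proof.
have cellP (c : 'I_(nth 0 mu r)) : exists t, (row t == r) && (col t == c).
  by have [t [tr tc]] := cell_exists (ltn_ord c); exists t; rewrite tr tc !eqxx.
pose cell c := xchoose (cellP c).
have cE c : row (cell c) = r /\ col (cell c) = c.
  by have /andP [/eqP -> /eqP ->] := xchooseP (cellP c).
rewrite -[RHS]card_ord -(card_imset (f := cell)) => [|c c' cc].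
  apply: eq_card => t; rewrite inE; apply/eqP/imsetP => [tr|[c _ ->]]; last by have [] := cE c.
  have tc := col_lt t; rewrite tr in tc; exists (Ordinal tc) => //.
  by have [cr cc] := cE (Ordinal tc); apply: row_col_inj; rewrite ?cr ?cc.
by apply: ord_inj; have [_ <-] := cE c; rewrite cc; have [_ ->] := cE c'.
Qed.

Lemma col_ltk t : (col t < k)%N.
Proof. by rewrite /colof (leq_ltn_trans (leq_subr _ _)). Qed.

Section Pigeonhole.
Variables (T : 'I_k -> nat) (x : 'S_k).
Hypothesis Tx : forall a b, T a = T b -> col (x a) = col (x b) -> a = b.

(* Either all cells (r, j) with r < i exist, and T injects the left-hand side into
   them, or column j lies entirely in the first i rows. *)
Lemma card_cells_le i j :
  (#|[set a | (T a < i) && (col (x a) == j)]| <=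
   #|[set t | (row t < i) && (col t == j)]|)%N.
Proof.
case: (boolP [forall r : 'I_i, j < nth 0 mu r]%N) => [/forallP h|].
  have cellP a : exists t, (T a < i)%N ==> (row t == T a) && (col t == j).
    case: (ltnP (T a) i) => Ti; last by exists a.
    have [t [tr tc]] := cell_exists (h (Ordinal Ti)).
    by exists t; rewrite tr tc !eqxx.
  pose cell a := xchoose (cellP a).
  have cE a : (T a < i)%N -> row (cell a) = T a /\ col (cell a) = j.
    by move=> Ti; move: (xchooseP (cellP a));
      rewrite -/(cell a) => /implyP /(_ Ti) /andP [/eqP -> /eqP ->].
  rewrite -(card_in_imset (f := cell)).
    apply/subset_leq_card/subsetP => _ /imsetP [a + ->]; rewrite !inE => /andP [Ti _].
    by have [-> ->] := cE a Ti; rewrite Ti eqxx.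
  move=> a b; rewrite !inE => /andP [Ta /eqP xa] /andP [Tb /eqP xb] ab.
  apply: Tx; last by rewrite xa xb.
  by have [<- _] := cE a Ta; have [<- _] := cE b Tb; rewrite ab.
rewrite negb_forall => /existsP [r]; rewrite -leqNgt => rj.
apply: (@leq_trans #|[set a | col (x a) == j]|).
  by apply/subset_leq_card/subsetP => a; rewrite !inE => /andP[].
rewrite -(card_imset _ (@perm_inj _ x)).
apply/subset_leq_card/subsetP => _ /imsetP [a + ->]; rewrite !inE => /eqP xa.
rewrite xa eqxx andbT (leq_trans _ (ltn_ord r)) // ltnS leqNgt; apply/negP => rr.
have := col_lt (x a); rewrite xa ltnNge; apply/negP; rewrite negbK.
by apply: leq_trans rj; apply: part_nth_le; apply: ltnW.
Qed.

Lemma card_sum_col (P : pred 'I_k) (y : 'I_k -> 'I_k) :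
  #|[set a | P a]| = (\sum_(j < k) #|[set a | P a && (col (y a) == j)]|)%N.
Proof.
rewrite -sum1_card (partition_big (fun a => Ordinal (col_ltk (y a))) xpredT) //=.
apply: eq_bigr => j _; rewrite -sum1_card; apply: eq_bigl => a.
by rewrite !inE -val_eqE.
Qed.

(** Sum of the bounds for the single columns. This is the dominance inequality between the content
    of [T] and [mu]. *)
Lemma card_rows_le i : (#|[set a | T a < i]| <= #|[set t | row t < i]|)%N.
Proof.
rewrite (card_sum_col _ x) (card_sum_col _ id); apply: leq_sum => j _.
exact: card_cells_le.
Qed.

End Pigeonhole.

(* Summing card_cells_le over j gives equality, since both sides count the same rows;
   hence x sends each row onto the columns that the row meets. *)
Lemma row_col_factor (x : 'S_k) :
  (forall a b, row a = row b -> col (x a) = col (x b) -> a = b) ->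
  exists p q, [/\ p \in row_grp k mu, q \in col_grp k mu & x = (p * q)%g].
Proof.
move=> xinj.
have eq_cells i (j : 'I_k) :
    #|[set a | (row a < i)%N && (col (x a) == j)]| = #|[set t | (row t < i)%N && (col t == j)]|.
  apply/eqP; rewrite eqn_leq card_cells_le //= leqNgt; apply/negP => lt.
  have := card_sum_col (fun a => row a < i)%N x.
  rewrite [LHS](card_sum_col _ id) (bigD1 j) //= [RHS](bigD1 j) //=.
  have : (\sum_(j' < k | j' != j) #|[set a | (row a < i)%N && (col (x a) == j')]| <=
    \sum_(j' < k | j' != j) #|[set a | (row a < i)%N && (col a == j')]|)%N.
    by apply: leq_sum => j' _; apply: card_cells_le.
  by move=> le E; have := leq_add lt le; rewrite addSn E ltnn.
have cellP a : exists t, (row t == row a) && (col t == col (x a)).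
  have cnt (y : 'I_k -> 'I_k) (j : 'I_k) :
    #|[set a0 | (row a0 < (row a).+1)%N && (col (y a0) == j)]| =
     (#|[set a0 | (row a0 < row a)%N && (col (y a0) == j)]| + #|[set a0 | (row a0 == row a) &&
       (col (y a0) == j)]|)%N.
    rewrite -cardsUI [X in (_ + X)%N](_ : _ = 0%N) ?addn0.
      by apply: eq_card => b; rewrite !inE ltnS leq_eqVlt orbC andb_orl.
    apply/eqP; rewrite cards_eq0; apply/eqP/setP => b; rewrite !inE.
    by apply/negbTE/negP => /andP [/andP [h1 _] /andP [/eqP h2 _]]; rewrite h2 ltnn in h1.
  pose j := Ordinal (col_ltk (x a)).
  have := eq_cells (row a).+1 j; rewrite (cnt x) (cnt id) eq_cells => /addnI.
  have : (0 < #|[set a0 | (row a0 == row a) && (col (x a0) == j)]|)%N.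
    by rewrite card_gt0; apply/set0Pn; exists a; rewrite inE !eqxx.
  by move=> + E; rewrite E card_gt0 => /set0Pn [t]; rewrite inE => tP; exists t.
pose f a := xchoose (cellP a).
have fr a : row (f a) = row a by have /andP [/eqP] := xchooseP (cellP a).
have fc a : col (f a) = col (x a) by have /andP [_ /eqP] := xchooseP (cellP a).
have fI : injective f.
  by move=> a b ab; apply: xinj; [rewrite -(fr a) -(fr b) ab | rewrite -(fc a) -(fc b) ab].
exists (perm fI), ((perm fI)^-1 * x)%g; split.
- by rewrite inE; apply/forallP => a; rewrite permE fr.
- rewrite inE; apply/forallP => a; rewrite permM.
  by rewrite -fc -(permE fI) permKV.
- by rewrite mulKVg.
Qed.

End Tableau.

(** For nonzero [n], [X *m B] divided by [n] is a projection onto the row space of [B] that commutes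
    with [L]; the trace on the row space is then a trace on the whole space. *)
Lemma mxtrace_base (F : fieldType) r d (B : 'M[F]_(r, d)) (X : 'M_(d, r)) (L : 'M_d)
    (P : 'M_(d, r)) (n : F) :
  B *m X = n%:M -> B *m P = 1%:M -> (X *m B) *m L = L *m (X *m B) ->
  n * \tr (B *m L *m P) = \tr (L *m (X *m B)).
Proof.
move=> BX BP XBL; rewrite -mxtraceZ -mul_scalar_mx -BX.
have -> : B *m X *m (B *m L *m P) = B *m (X *m B *m L) *m P by rewrite !mulmxA.
rewrite XBL.
have -> : B *m (L *m (X *m B)) *m P = B *m (L *m X) *m (B *m P) by rewrite !mulmxA.
by rewrite BP mulmx1 mxtrace_mulC mulmxA.
Qed.

(** * Specht characters and their sums over Young subgroups *)

Section SpechtCharacter.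
Variables (C : numClosedFieldType) (k : nat) (mu : seq nat).
Hypotheses (smu : sumn mu = k) (pmu : is_partition mu).
Local Notation row := (@rowof k mu).
Local Notation col := (@colof k mu).
Local Notation c := (@young_sym C k mu).
Local Notation Rg := (row_grp k mu).
Local Notation Qg := (col_grp k mu).

Implicit Types p q g : 'S_k.

Lemma row_grpP p : reflect (forall t, row (p t) = row t) (p \in Rg).
Proof. by rewrite inE; apply: (iffP forallP) => h t; apply/eqP. Qed.

Lemma col_grpP p : reflect (forall t, col (p t) = col t) (p \in Qg).
Proof. by rewrite inE; apply: (iffP forallP) => h t; apply/eqP. Qed.

Lemma row_grpM p p' : p \in Rg -> (p * p' \in Rg)%g = (p' \in Rg).
Proof.
move=> /row_grpP h; apply/row_grpP/row_grpP => h' t; last by rewrite permM h' h.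
by have := h' (p^-1 t)%g; rewrite permM permKV => ->; rewrite -h permKV.
Qed.

Lemma col_grpM q q' : q \in Qg -> (q' * q \in Qg)%g = (q' \in Qg).
Proof.
move=> /col_grpP h; apply/col_grpP/col_grpP => h' t; last by rewrite permM h h'.
by rewrite -h -permM h'.
Qed.

Lemma row_grpV p : (p^-1 \in Rg)%g = (p \in Rg).
Proof.
by apply/row_grpP/row_grpP => h t; [rewrite -h permK | rewrite -{2}(permKV p t) h].
Qed.

Lemma young_sym_row p g : p \in Rg -> c (p * g)%g = c g.
Proof.
move=> pR; rewrite /young_sym (reindex_inj (mulgI p)) /=.
apply: eq_big => [p'|p' _]; first by rewrite row_grpM.
by apply: eq_bigl => q; rewrite -mulgA (inj_eq (mulgI p)).
Qed.

Lemma young_sym_col q g : q \in Qg -> c (g * q)%g = (-1) ^+ q * c g.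
Proof.
move=> qQ; rewrite /young_sym mulr_sumr; apply: eq_bigr => p _.
rewrite mulr_sumr (reindex_inj (mulIg q)) /=.
apply: eq_big => [q'|q' _]; first by rewrite col_grpM // mulgA (inj_eq (mulIg q)).
by rewrite odd_permM signr_addb mulrC.
Qed.

Lemma one_row : 1%g \in Rg. Proof. by apply/row_grpP => t; rewrite perm1. Qed.
Lemma one_col : 1%g \in Qg. Proof. by apply/col_grpP => t; rewrite perm1. Qed.

(** A row permutation that is the inverse of a column permutation fixes every cell, so 1 = p q
    forces p = q = 1. *)
Lemma young_sym1 : c 1%g = 1.
Proof.
rewrite /young_sym (bigD1 1%g) ?one_row //= [X in _ + X]big1 ?addr0 => [|p /andP [pR p1]].
  rewrite (bigD1 1%g) ?one_col ?mulg1 ?eqxx //= odd_perm1 big1 ?addr0 // => q.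
  by rewrite mul1g => /andP [/andP [_ /eqP ->]]; rewrite eqxx.
rewrite big_pred0 // => q; apply/negbTE/negP => /andP [qQ /eqP pq].
case/negP: p1; apply/eqP/permP => t; rewrite perm1; apply: (row_col_inj smu pmu).
  exact: (row_grpP _ pR).
have qE : q = (p^-1)%g by apply: (mulgI p); rewrite pq mulgV.
by rewrite -[t in RHS](permK p) -qE (col_grpP _ qQ).
Qed.

Lemma tperm_row a b : row a = row b -> tperm a b \in Rg.
Proof. by move=> ab; apply/row_grpP => t; case: tpermP => // ->. Qed.

Lemma tperm_col a b : col a = col b -> tperm a b \in Qg.
Proof. by move=> ab; apply/col_grpP => t; case: tpermP => // ->. Qed.

Lemma eq_opp0 (z : C) : z = - z -> z = 0.
Proof.
move=> /eqP; rewrite -subr_eq0 opprK -mulr2n -mulr_natl mulf_eq0.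
by rewrite Num.Theory.pnatr_eq0 /= => /eqP.
Qed.

(* Von Neumann's lemma. *)
Lemma young_sym_unique (f : 'S_k -> C) :
  (forall p g, p \in Rg -> f (p * g)%g = f g) ->
  (forall q g, q \in Qg -> f (g * q)%g = (-1) ^+ q * f g) ->
  forall g, f g = f 1%g * c g.
Proof.
move=> fR fQ g.
(* Two cells of one row that [g] sends to one column give a transposition acting by +1 on the left
   and by -1 on the right, so [f] and [c] both vanish at [g]. Otherwise [g] is a row permutation
   times a column permutation. *)
have [/existsP [a /existsP [b /and3P [ab /eqP rab /eqP cab]]]|] :=
  boolP [exists a, exists b, [&& a != b, row a == row b & col (g a) == col (g b)]].
  have vanish (h : 'S_k -> C) :
      (forall p g, p \in Rg -> h (p * g)%g = h g) ->
      (forall q g, q \in Qg -> h (g * q)%g = (-1) ^+ q * h g) -> h g = 0.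
    move=> hR hQ; apply: eq_opp0.
    rewrite -{1}(hR (tperm a b)) ?tperm_row //.
    have -> : (tperm a b * g = g * tperm (g a) (g b))%g by rewrite -tpermJ conjgE mulKVg.
    rewrite hQ ?tperm_col // odd_tperm (inj_eq perm_inj) ab expr1 mulN1r //.
  by rewrite !vanish ?mulr0 // => *; [apply: young_sym_row | apply: young_sym_col].
move=> /existsPn h; have [|p [q [pR qQ ->]]] := row_col_factor smu pmu (x := g).
  move=> a b rab cab; apply/eqP; apply/negPn/negP => ab.
  by have /existsPn /(_ b) := h a; rewrite ab rab cab !eqxx.
rewrite fR // young_sym_row // -[q]mul1g fQ // young_sym_col // young_sym1.
by rewrite mulr1 mulrC.
Qed.

(** Value at 1 of the convolution square of [c]; by von Neumann's lemma that square is this multiple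
    of [c]. *)
Definition young_norm : C := \sum_h c h * c (h^-1)%g.
Local Notation n := young_norm.

Lemma young_sym_conv g : \sum_h c h * c (h^-1 * g)%g = n * c g.
Proof.
rewrite (young_sym_unique (f := fun g => \sum_h c h * c (h^-1 * g)%g)).
- by congr (_ * _); apply: eq_bigr => h _; rewrite mulg1.
- move=> p g' pR; rewrite (reindex_inj (mulgI p)) /=; apply: eq_bigr => h _.
  by rewrite young_sym_row // invMg -mulgA mulKg.
- move=> q g' qQ; rewrite mulr_sumr; apply: eq_bigr => h _.
  by rewrite mulgA young_sym_col // mulrCA.
Qed.

Local Notation M := (specht_mx C k mu).

Lemma specht_mx_sqr : M *m M = n *: M.
Proof.
apply/matrixP => i j; rewrite !mxE -young_sym_conv.
rewrite (reindex_inj (mulgI (enum_val i)^-1%g)) /= [RHS](reindex (enum_val (A := {perm 'I_k})))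
  /=; last first.
  by apply: onW_bij; apply: enum_val_bij.
apply: eq_bigr => l _; rewrite !mxE; congr (_ * _).
by rewrite invMg invgK -mulgA mulKVg.
Qed.

Lemma specht_lmulC s : M *m lmul_mx C s = lmul_mx C s *m M.
Proof.
apply/matrixP => i j; rewrite !mxE.
rewrite (bigD1 (enum_rank (s^-1 * enum_val j)%g)) //= big1 ?addr0 => [|l lj]; last first.
  rewrite !mxE; case: eqP => [E|]; last by rewrite mulr0.
  by rewrite -E mulKg enum_valK eqxx in lj.
rewrite [RHS](bigD1 (enum_rank (s * enum_val i)%g)) //= [X in _ = _ + X]big1 ?addr0 => [|l lj];
  last first.
  rewrite !mxE; case: eqP => [E|]; last by rewrite mul0r.
  by rewrite E enum_valK eqxx in lj.
by rewrite !mxE !enum_rankK mulKVg !eqxx mulr1 mul1r invMg mulgA.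
Qed.

(** [M] is [col_base M *m row_base M], and both outer factors can be cancelled in M M = n M by full
    rank. *)
Lemma base_mul : row_base M *m col_base M = n%:M.
Proof.
apply: (row_free_inj (row_base_free M)); apply: (row_full_inj (col_base_full M)).
rewrite mulmxA mulmxA mulmx_base -mulmxA mulmx_base specht_mx_sqr.
by rewrite mul_scalar_mx -scalemxAr mulmx_base.
Qed.

Lemma tr_specht_lmul s : \tr (lmul_mx C s *m M) = \sum_g c (g^-1 * s^-1 * g)%g.
Proof.
rewrite [RHS](reindex (enum_val (A := {perm 'I_k}))) /=; last first.
  by apply: onW_bij; apply: enum_val_bij.
apply: eq_bigr => i _; rewrite mxE.
rewrite (bigD1 (enum_rank (s * enum_val i)%g)) //= big1 ?addr0 => [|l lj]; last first.
  rewrite !mxE; case: eqP => [E|]; last by rewrite mul0r.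
  by rewrite E enum_valK eqxx in lj.
by rewrite !mxE !enum_rankK eqxx mul1r invMg.
Qed.

(** If [n] were 0, then [M] would have trace 0; but its diagonal entries are c(1) = 1 and the
    characteristic is 0. *)
Lemma young_norm_neq0 : n != 0.
Proof.
apply/eqP => n0; have : \tr M = 0.
  by rewrite -(mulmx_base M) mxtrace_mulC base_mul n0 raddf0 mxtrace0.
rewrite /mxtrace (eq_bigr (fun=> 1)) => [|i _]; last by rewrite mxE mulVg young_sym1.
rewrite sumr_const => /eqP; rewrite Num.Theory.pnatr_eq0 card_ord => /eqP /card0_eq /(_ 1%g).
by rewrite inE.
Qed.

Lemma irr_charE s : irr_char C mu s = n^-1 * \sum_g c (g^-1 * s^-1 * g)%g.
Proof.
apply: (mulfI young_norm_neq0); rewrite mulVKf ?young_norm_neq0 //.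
rewrite -tr_specht_lmul /irr_char -[in RHS](mulmx_base M); apply: mxtrace_base.
- exact: base_mul.
- by rewrite mulmxVp // row_base_free.
- by rewrite mulmx_base specht_lmulC.
Qed.

Lemma irr_char_class : class_fun (@irr_char C k mu).
Proof.
move=> u g; rewrite !irr_charE [in RHS](reindex_inj (mulgI g)) /=; congr (_ * _).
apply: eq_bigr => h _; congr c.
by rewrite conjgE !invMg invgK !mulgA.
Qed.

Lemma psumn_sum r : sumn (take r mu) = (\sum_(i < r) nth 0 mu i)%N.
Proof.
elim: r => [|r IH]; first by rewrite take0 big_ord0.
by rewrite psumnS big_ord_recr /= IH.
Qed.

Lemma size_part : (size mu <= k)%N.
Proof.
have /andP [_] := pmu; rewrite -smu; elim: (mu) => //= a l IH /andP [a0 /IH].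
by lia.
Qed.

(** Padding to [k] parts makes partitions comparable with contents of colourings in the monomial
    order that governs all triangularity arguments. *)
Definition part_mnm : 'X_{1..k} := [multinom nth 0%N mu i | i < k].

Lemma sum_part : (\sum_(i < k) nth 0 mu i = k)%N.
Proof. by rewrite -psumn_sum take_oversize ?size_part. Qed.

Lemma mdeg_part_mnm : mdeg part_mnm = k.
Proof. by rewrite mdegE -[RHS]sum_part; apply: eq_bigr => i _; rewrite mnmE. Qed.

Lemma mdeg_content_mnm N (t : {ffun 'I_k -> 'I_N}) : mdeg (content_mnm t) = k.
Proof.
rewrite mdegE -[RHS]card_ord -(sum_fibers t).
by apply: eq_bigr => i _; rewrite mnmE.
Qed.

Lemma card_lt_color (t : {ffun 'I_k -> 'I_k}) (j : 'I_k) :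
  #|[set a | t a < j.+1]%N| = (#|[set a | t a < j]%N| + content_mnm t j)%N.
Proof.
rewrite mnmE size_fiber -cardsUI [X in (_ + X)%N](_ : _ = 0%N) ?addn0.
  by apply: eq_card => b; rewrite !inE ltnS leq_eqVlt orbC -val_eqE.
apply/eqP; rewrite cards_eq0; apply/eqP/setP => b; rewrite !inE.
by apply/negbTE/negP => /andP [h /eqP E]; rewrite E ltnn in h.
Qed.

Lemma card_rows i : (#|[set t | row t < i]| = sumn (take i mu))%N.
Proof.
elim: i => [|i IH].
  by rewrite take0; apply/eqP; rewrite cards_eq0; apply/eqP/setP => t; rewrite !inE.
rewrite psumnS -IH -(card_row smu pmu) -cardsUI [X in (_ + X)%N](_ : _ = 0%N) ?addn0.
  by apply: eq_card => b; rewrite !inE ltnS leq_eqVlt orbC.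
apply/eqP; rewrite cards_eq0; apply/eqP/setP => b; rewrite !inE.
by apply/negbTE/negP => /andP [h /eqP E]; rewrite E ltnn in h.
Qed.

(** Without a clash, dominance bounds the number of cells with one of the first i + 1 colours by the
    sum of the first i + 1 parts. This fails at the first index [i] where the content differs from
    [mu]. *)
Lemma content_gt_clash (t : {ffun 'I_k -> 'I_k}) (x : 'S_k) : (part_mnm < content_mnm t)%O ->
  exists a b, [/\ a != b, t a = t b & col (x a) = col (x b)].
Proof.
have dE : mdeg part_mnm = mdeg (content_mnm t) by rewrite mdeg_part_mnm mdeg_content_mnm.
move=> /(ltmcP dE) [i eqj lti].
have [/existsP [a /existsP [b /and3P [ab /eqP tab /eqP cab]]]|h] :=
  boolP [exists a, exists b, [&& a != b, t a == t b & col (x a) == col (x b)]].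
  by exists a, b.
have inj a b : t a = t b :> nat -> col (x a) = col (x b) -> a = b.
  move=> tab cab; apply/eqP/negPn/negP => ab; case/negP: h.
  by apply/existsP; exists a; apply/existsP; exists b; rewrite ab cab (ord_inj tab) !eqxx.
have eq_upto j : (j <= i)%N -> #|[set a | t a < j]%N| = sumn (take j mu).
  elim: j => [|j IH] ji.
    by rewrite take0; apply/eqP; rewrite cards_eq0; apply/eqP/setP => a; rewrite !inE.
  have jk : (j < k)%N by apply: ltn_trans ji (ltn_ord i).
  rewrite (card_lt_color t (Ordinal jk)) IH ?(ltnW ji) // psumnS.
  by rewrite -eqj // mnmE.
have := card_rows_le smu pmu inj i.+1.
by rewrite card_rows card_lt_color eq_upto // psumnS leq_add2l leqNgt -[X in (X < _)%N](mnmE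
  (fun i : 'I_k => nth 0%N mu i)) lti.
Qed.

Lemma stab_tperm (V : finType) (t : {ffun 'I_k -> V}) a b : t a = t b -> stab t (tperm a b).
Proof. by move=> tab; apply/stabP => y; case: tpermP => // ->. Qed.

(* By pigeonhole two cells with the same color lie in the same column; their
   transposition fixes f and changes the sign of the Young symmetrizer. *)
Lemma sum_irr_char_gt (f : 'S_k -> C) (t : {ffun 'I_k -> 'I_k}) :
  (forall u v, stab t u -> f (u * v)%g = f v) -> (part_mnm < content_mnm t)%O ->
  \sum_v f v * irr_char C mu v = 0.
Proof.
move=> ft mt; transitivity (n^-1 * \sum_g \sum_v f v * c (g^-1 * v^-1 * g)%g).
  rewrite exchange_big mulr_sumr; apply: eq_bigr => v _.
  by rewrite irr_charE mulrCA mulr_sumr.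
rewrite big1 ?mulr0 // => g _.
have [a [b [ab tab cab]]] := content_gt_clash g mt.
apply: eq_opp0; rewrite {1}(reindex_inj (mulgI (tperm a b))) /= -sumrN.
apply: eq_bigr => v _; rewrite ft ?stab_tperm // -mulrN; congr (_ * _).
have -> : (g^-1 * (tperm a b * v)^-1 * g = g^-1 * v^-1 * g * tperm (g a) (g b))%g.
  by rewrite invMg tpermV -tpermJ conjgE !mulgA mulgK.
by rewrite young_sym_col ?tperm_col // odd_tperm (inj_eq perm_inj) ab expr1 mulN1r.
Qed.

Lemma stabM (V : finType) (t : {ffun 'I_k -> V}) u v : stab t u -> stab t (u * v)%g = stab t v.
Proof.
move=> /stabP h; apply/stabP/stabP => h' x; last by rewrite permM h' h.
by have := h' (u^-1 x)%g; rewrite permM permKV => ->; rewrite -h permKV.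
Qed.

Lemma stab_sum_irr_gt (t : {ffun 'I_k -> 'I_k}) : (part_mnm < content_mnm t)%O ->
  \sum_(u | stab t u) irr_char C mu u = 0.
Proof.
move=> mt; rewrite big_mkcond -[RHS](sum_irr_char_gt (f := fun u => (stab t u)%:R) _ mt).
  by apply: eq_bigr => u _; case: ifP; rewrite ?mul1r ?mul0r.
by move=> u v tu; rewrite stabM.
Qed.

Lemma row_ltk (t : 'I_k) : (row t < k)%N.
Proof.
apply: leq_trans size_part; rewrite ltnNge; apply/negP => h.
by have := col_lt smu pmu t; rewrite nth_default.
Qed.

Definition row_coloring : {ffun 'I_k -> 'I_k} := [ffun t => Ordinal (row_ltk t)].

Lemma content_row_coloring : content_mnm row_coloring = part_mnm.
Proof.
apply/mnmP => i; rewrite !mnmE size_fiber -(card_row smu pmu); apply: eq_card => t.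
by rewrite !inE ffunE -val_eqE.
Qed.

Lemma stab_row_coloring u : stab row_coloring u = (u \in Rg).
Proof.
rewrite inE; apply: eq_forallb => t; by rewrite !ffunE -val_eqE.
Qed.

(** By conjugacy the subgroup is the row group, whose order is the right-hand side. As a function of
    y, the sum of c(g^-1 p y) over row permutations p falls under von Neumann's lemma, which splits
    off c(y); at y = g, summing over g leaves the convolution n c(p) = n for each p. *)
Lemma stab_sum_irr_eq (t : {ffun 'I_k -> 'I_k}) : content_mnm t = part_mnm ->
  \sum_(u | stab t u) irr_char C mu u = (\prod_(i < k) (nth 0 mu i)`!)%N%:R.
Proof.
move=> mt; rewrite (sum_stab_content (t' := row_coloring) irr_char_class); last first.
  by move=> v; have /mnmP /(_ v) := mt; rewrite -content_row_coloring !mnmE.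
have -> : (\prod_(i < k) (nth 0 mu i)`!)%N = #|[set u | stab row_coloring u]|.
  by rewrite card_stab; apply: eq_bigr => i _; have /mnmP /(_ i) := content_row_coloring;
    rewrite !mnmE => ->.
rewrite cardsE (eq_bigl (mem Rg)); last by move=> u; rewrite stab_row_coloring.
rewrite (eq_card (B := mem Rg)); last by move=> u; rewrite -stab_row_coloring.
transitivity (n^-1 * \sum_g \sum_(p in Rg) c (g^-1 * p * g)%g).
  under eq_bigr => p _ do rewrite irr_charE.
  rewrite -mulr_sumr exchange_big /=; congr (_ * _); apply: eq_bigr => g _.
  rewrite (reindex_inj invg_inj) /=; apply: eq_big => [p|p _]; first by rewrite row_grpV.
  by rewrite invgK.
have step g : \sum_(p in Rg) c (g^-1 * p * g)%g = (\sum_(p in Rg) c (g^-1 * p)%g) * c g.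
  rewrite (young_sym_unique (f := fun y => \sum_(p in Rg) c (g^-1 * p * y)%g)).
  - by congr (_ * _); apply: eq_bigr => p _; rewrite mulg1.
  - move=> p y pR.
    have pV : (p^-1 \in Rg)%g by rewrite row_grpV.
    rewrite (reindex_inj invg_inj) [RHS](reindex_inj invg_inj) /=.
    rewrite [RHS](reindex_inj (mulgI p^-1%g)) /=; apply: eq_big => [p'|p' _].
      by rewrite !row_grpV row_grpM.
    by rewrite invMg invgK !mulgA.
  - move=> q y qQ; rewrite mulr_sumr; apply: eq_bigr => p _.
    by rewrite mulgA young_sym_col.
under eq_bigr => g _ do rewrite step mulr_suml.
rewrite exchange_big /= (eq_bigr (fun=> n)) => [|p pR].
  by rewrite sumr_const -[X in _ * X]mulr_natr mulrA mulVf ?young_norm_neq0 // mul1r.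
transitivity (\sum_g c g * c (g^-1 * p)%g); first by apply: eq_bigr => g _; rewrite mulrC.
by rewrite young_sym_conv -[p]mulg1 young_sym_row // young_sym1 mulr1.
Qed.

End SpechtCharacter.

(** * Frobenius' formula for Specht characters *)

(** Gaussian elimination with the functionals given by summation over [A i]. An earlier functional
    kills every later [e j], so the coefficient of the head is fixed first and not disturbed by the
    rest. *)
Lemma triangular_elimination (F : fieldType) (X : finType) (I : eqType) (A : I -> pred X)
    (e : I -> X -> F) (s : seq I) : uniq s ->
  pairwise (fun i j => \sum_(u | A i u) e j u == 0) s ->
  (forall i, i \in s -> \sum_(u | A i u) e i u != 0) ->
  forall f : X -> F, exists b : I -> F, forall i, i \in s ->
    \sum_(u | A i u) (f u - \sum_(j <- s) b j * e j u) = 0.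
Proof.
elim: s => [|i0 s IH] //=; first by move=> _ _ _ f; exists (fun=> 0).
move=> /andP [i0s us] /andP [/allP z0 pw] nz f.
pose b0 := (\sum_(u | A i0 u) f u) / (\sum_(u | A i0 u) e i0 u).
have [|b bP] := IH us pw _ (fun u => f u - b0 * e i0 u).
  by move=> i h; apply: nz; rewrite inE h orbT.
exists (fun j => if j == i0 then b0 else b j) => i.
have E u : f u - \sum_(j <- i0 :: s) (if j == i0 then b0 else b j) * e j u =
           f u - b0 * e i0 u - \sum_(j <- s) b j * e j u.
  rewrite big_cons eqxx opprD addrA; congr (_ - _); apply: eq_big_seq => j js.
  by case: eqP => // ji; rewrite -ji js in i0s.
under eq_bigr => u _ do rewrite E.
rewrite inE => /orP [/eqP ->|/bP //].
rewrite !sumrB -mulr_sumr mulfVK ?nz ?mem_head // subrr sub0r exchange_big /=.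
rewrite big_seq big1 ?oppr0 // => j js; rewrite -mulr_sumr.
by rewrite (eqP (z0 j js)) mulr0.
Qed.

Lemma nth_filter_pos s i : sorted geq s -> nth 0%N [seq x <- s | (0 < x)%N] i = nth 0%N s i.
Proof.
elim: s i => //= x s IH i xs; have sl := path_sorted xs.
have [x0|x0] := posnP x; last by case: i => //= i; rewrite IH.
have s0 y : y \in s -> y = 0%N.
  have tr : transitive geq by move=> a b c ba cb; apply: leq_trans cb ba.
  have /allP h := order_path_min tr xs; move=> /h /=.
  by rewrite x0 leqn0 => /eqP.
have -> : [seq x <- s | (0 < x)%N] = [::].
  by apply/eqP; rewrite -(negbK (_ == _)) -has_filter -all_predC; apply/allP => y /s0 /= ->.
rewrite nth_nil; case: i => [|i] //=.
by have [il|il] := ltnP i (size s); [rewrite (s0 (nth 0%N s i)) ?mem_nth | rewrite nth_default].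
Qed.

Section Frobenius.
Variables (C : numClosedFieldType) (k : nat).
Implicit Types (la mu nu : seq nat) (m : 'X_{1..k}).

Definition part_of_mnm m := [seq x <- tval (multinom_val m) | (0 < x)%N].

Lemma part_of_mnmP m : sorted geq m -> mdeg m = k ->
  [/\ is_partition (part_of_mnm m), sumn (part_of_mnm m) = k & part_mnm k (part_of_mnm m) = m].
Proof.
move=> sm dm; split.
- apply/andP; split; last exact: filter_all.
  by apply: sorted_filter sm => a b c ba cb; apply: leq_trans cb ba.
- rewrite -[RHS]dm /mdeg sumnE big_filter [RHS](bigID (fun x => 0 < x)%N) /=.
  by rewrite [X in (_ + X)%N]big1 ?addn0 // => x; rewrite -eqn0Ngt => /eqP.
- by apply/mnmP => i; rewrite mnmE nth_filter_pos // -mnm_nth.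
Qed.

(** Renaming colours does not change the Young subgroup, so contents may be taken to be
    partitions. *)
Lemma sort_coloring (t : {ffun 'I_k -> 'I_k}) :
  exists2 t' : {ffun 'I_k -> 'I_k}, stab t' =1 stab t & sorted geq (content_mnm t').
Proof.
pose c := [tuple size (fiber t i) | i < k].
have /tuple_permP [p pE] : perm_eq (sort geq c) c by rewrite perm_sort.
exists [ffun x => (p^-1)%g (t x)].
  move=> u; apply/stabP/stabP => h x; last by rewrite !ffunE h.
  by have := h x; rewrite !ffunE => /perm_inj.
have -> : content_mnm [ffun x => (p^-1)%g (t x)] = sort geq c :> seq nat.
  rewrite pE; congr tval; apply: eq_from_tnth => i; rewrite -mnm_tnth mnmE !tnth_mktuple.
  rewrite !size_fiber; apply: eq_card => x; rewrite !inE ffunE.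
  by rewrite (canF_eq (permKV p)).
by apply: sort_sorted => a b; apply: leq_total.
Qed.

Local Notation irr mu := (@irr_char C k mu).
Local Notation jt mu := (@jt_fun C k (nth 0%N mu) k).

Lemma jt_sign_content mu (t : {ffun 'I_k -> 'I_k}) : is_partition mu -> sumn mu = k ->
  content_mnm t = part_mnm k mu -> jt_sign C (nth 0%N mu) (fun i : 'I_k => size (fiber t i)) = 1.
Proof.
move=> pmu smu tm; rewrite /jt_sign (bigD1 1%g) //= big1 ?addr0 => [|w w1].
  rewrite odd_perm1 mul1r (_ : [forall _, _] = true) //.
  by apply/forallP => i; have /mnmP /(_ i) := tm; rewrite !mnmE perm1 => ->.
have [i _ lti] := perm_first_moved w1.
rewrite (_ : [forall _, _] = false) ?mulr0 //; apply/negbTE/forallPn; exists i.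
have /mnmP /(_ i) := tm; rewrite !mnmE => ->.
by rewrite eqn_add2l neq_ltn lti.
Qed.

(** A term [w] occurs only at content mu_i + w(i) - i. The identity gives [mu] itself, and any other
    [w] first moves a point up, which makes the content larger. *)
Lemma jt_sign_lt mu (t : {ffun 'I_k -> 'I_k}) : is_partition mu -> sumn mu = k ->
  (content_mnm t < part_mnm k mu)%O -> jt_sign C (nth 0%N mu) (fun i : 'I_k =>
    size (fiber t i)) = 0.
Proof.
move=> pmu smu tm; rewrite /jt_sign big1 // => w _.
case: forallP => [h|]; last by rewrite mulr0.
have cE i : (content_mnm t i + i = part_mnm k mu i + w i)%N by rewrite !mnmE; apply/eqP.
have [w1|/perm_first_moved [i fixd lti]] := eqVneq w 1%g.
  have : content_mnm t = part_mnm k mu by apply/mnmP => i; have := cE i;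
    rewrite w1 perm1 => /addIn.
  by move=> E; rewrite E ltxx in tm.
have : (part_mnm k mu < content_mnm t)%O.
  have dE : mdeg (part_mnm k mu) = mdeg (content_mnm t) by rewrite mdeg_part_mnm //
    mdeg_content_mnm.
  apply/(ltmcP dE); exists i => [j ji|].
    by have := cE j; rewrite fixd // => /addIn.
  by have := cE i; lia.
by move/(lt_trans tm); rewrite ltxx.
Qed.

Lemma sum_irr_jt mu nu :
  \sum_u irr nu u * jt mu u = \sum_(t : {ffun 'I_k -> 'I_k})
    jt_sign C (nth 0%N mu) (fun i : 'I_k => size (fiber t i)) *
    \sum_(u | stab t u) irr nu u.
Proof.
under [RHS]eq_bigr => t _ do rewrite mulr_sumr.
rewrite [RHS](exchange_big_dep xpredT) //=; apply: eq_bigr => u _.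
by rewrite mulr_sumr; apply: eq_bigr => t _; rewrite mulrC.
Qed.

(** For each colouring one factor vanishes: [jt_sign] if the content is below [mu], and the Young
    subgroup sum of [irr nu] if it is at least [mu], hence above [nu]. *)
Lemma pair_irr_jt_lt mu nu : is_partition mu -> sumn mu = k ->
  is_partition nu -> sumn nu = k -> (part_mnm k nu < part_mnm k mu)%O ->
  \sum_u irr nu u * jt mu u = 0.
Proof.
move=> pmu smu pnu snu lt; rewrite sum_irr_jt big1 // => t _.
have [h|h] := ltP (content_mnm t) (part_mnm k mu); first by rewrite jt_sign_lt // mul0r.
by rewrite stab_sum_irr_gt ?mulr0 // (lt_le_trans lt).
Qed.

(** Only colourings of content exactly [mu] survive, each contributing the order of its Young
    subgroup. *)
Lemma pair_irr_jt_eq mu : is_partition mu -> sumn mu = k ->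
  \sum_u irr mu u * jt mu u = k`!%:R.
Proof.
move=> pmu smu; rewrite sum_irr_jt (bigID (fun t => content_mnm t == part_mnm k mu)) /=.
rewrite [X in _ + X]big1 ?addr0 => [|t tm]; last first.
  have [h|h] := ltP (content_mnm t) (part_mnm k mu); first by rewrite jt_sign_lt // mul0r.
  by rewrite stab_sum_irr_gt ?mulr0 // lt_neqAle eq_sym tm.
rewrite (eq_bigr (fun=> (\prod_(i < k) (nth 0 mu i)`!)%N%:R)) => [|t /eqP tm]; last first.
  by rewrite jt_sign_content // mul1r stab_sum_irr_eq.
have := card_content (T := 'I_k) (al := fun i : 'I_k => nth 0%N mu i).
rewrite card_ord => /(_ (sum_part smu pmu)) <-.
rewrite sumr_const -[LHS]mulr_natr -natrM mulnC; congr (_ * _)%N%:R.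
rewrite cardsE; apply: eq_card => t; rewrite -[LHS]/(content_mnm t == part_mnm k mu).
rewrite -[RHS]/(has_content (fun i : 'I_k => nth 0%N mu i) t).
apply/eqP/forallP => [/mnmP h i|h]; first by have := h i; rewrite !mnmE => ->.
by apply/mnmP => i; rewrite !mnmE (eqP (h i)).
Qed.

(** The symmetrizer of [mu] is left invariant under its row group, the Young subgroup of a colouring
    whose content [mu] exceeds [nu], so it pairs to 0 with [irr nu]. *)
Lemma irr_orthogonal mu nu : is_partition mu -> sumn mu = k ->
  is_partition nu -> sumn nu = k -> (part_mnm k nu < part_mnm k mu)%O ->
  \sum_u irr mu u * irr nu u = 0.
Proof.
move=> pmu smu pnu snu lt.
transitivity ((young_norm C k mu)^-1 * \sum_g \sum_u
    young_sym C mu (g^-1 * u^-1 * g)%g * irr nu u).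
  rewrite exchange_big mulr_sumr; apply: eq_bigr => u _.
  by rewrite (irr_charE _ smu pmu) -mulrA mulr_suml.
rewrite big1 ?mulr0 // => g _.
rewrite (reindex_inj invg_inj) (reindex_inj (conjg_inj g^-1%g)) /=.
rewrite -[RHS](sum_irr_char_gt (C := C) (mu := nu) snu pnu (f := young_sym C mu)
   (t := row_coloring smu pmu)).
- apply: eq_bigr => u _; congr (_ * _).
    by congr young_sym; rewrite invgK conjgE invgK !mulgA mulVg mul1g mulgKV.
  rewrite class_funV; last exact: irr_char_class.
  by rewrite irr_char_class.
- by move=> u v; rewrite stab_row_coloring => uR; rewrite young_sym_row.
- by rewrite content_row_coloring.
Qed.

(* By triangularity irr mu - jt mu is a combination of the jt nu with nu < mu, which are
   irr nu by induction; pairing with these shows that all coefficients vanish. *)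
Theorem irr_char_jt mu : is_partition mu -> sumn mu = k -> irr mu =1 jt mu.
Proof.
have [m mE] : exists m, m = part_mnm k mu by exists (part_mnm k mu).
elim/(@ltmwf k): m mu mE => m IH mu mE pmu smu.
have IHmu nu : is_partition nu -> sumn nu =
  k -> (part_mnm k nu < part_mnm k mu)%O -> irr nu =1 jt nu.
  by move=> pnu snu lt; apply: (IH (part_mnm k nu)) => //; rewrite mE.
pose ms0 := undup [seq content_mnm t | t :
  {ffun 'I_k -> 'I_k} <- enum {: {ffun 'I_k -> 'I_k}} & sorted geq (content_mnm t)].
(* The partitions below [mu], obtained as contents of colourings. Decreasing order gives the
   triangular shape, as [e j] has sum 0 at every content above [j]. *)
pose ms := sort (>=%O) [seq m' <- ms0 | (m' < part_mnm k mu)%O].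
have ms_part m' : m' \in ms ->
    [/\ is_partition (part_of_mnm m'), sumn (part_of_mnm m') = k, part_mnm k (part_of_mnm m') =
      m',
      (m' < part_mnm k mu)%O & exists t : {ffun 'I_k -> 'I_k}, content_mnm t = m'].
  rewrite mem_sort mem_filter mem_undup => /andP [lt /mapP [t]].
  rewrite mem_filter => /andP [st _] tE.
  have [||p1 p2 p3] := @part_of_mnmP m'; rewrite ?tE ?mdeg_content_mnm //.
  by rewrite -tE; split => //; exists t.
pose A m' : pred 'S_k := fun u =>
  if [pick t : {ffun 'I_k -> 'I_k} | content_mnm t == m'] is Some t then stab t u else false.
have AE (f : 'S_k -> C) (t : {ffun 'I_k -> 'I_k}) : class_fun f ->
    \sum_(u | A (content_mnm t) u) f u = \sum_(u | stab t u) f u.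
  move=> fcl; rewrite /A; case: pickP => [t' /eqP tt|/(_ t)]; last by rewrite eqxx.
  by apply: sum_stab_content => // v; have /mnmP /(_ v) := tt; rewrite !mnmE.
pose e m' : 'S_k -> C := jt (part_of_mnm m').
have e_gt m' (t : {ffun 'I_k -> 'I_k}) : m' \in ms -> (m' < content_mnm t)%O -> \sum_(u | stab
  t u) e m' u = 0.
  move=> /ms_part [p1 p2 p3 _ _] lt; apply: stab_sum_jt_gt.
  - exact: part_nth_le.
  - exact: sum_part.
  - by rewrite -/(part_mnm k (part_of_mnm m')) p3.
have ums : uniq ms by rewrite sort_uniq filter_uniq ?undup_uniq.
have [|m'|b bP] := triangular_elimination (A := A) (e := e) ums _ _ (fun u => irr mu u - jt mu u).
- have : pairwise [rel x y : 'X_{1..k} | (y <= x)%O && (x != y)] ms.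
    rewrite pairwise_relI -uniq_pairwise ums andbT -sorted_pairwise.
      by apply: sort_sorted => x y; apply: le_total.
    by move=> x y z yx zy; apply: le_trans zy yx.
  apply: (sub_in_pairwise (P := mem ms)); last exact/allP.
  move=> i j /ms_part [_ _ _ _ [t <-]] jm /andP [le ne]; rewrite AE; last exact: jt_fun_class.
  by apply/eqP; apply: e_gt => //; rewrite lt_neqAle eq_sym ne.
- move=> mm'; have [p1 p2 p3 _ [t tE]] := ms_part _ mm'.
  rewrite -[X in A X]tE AE; last exact: jt_fun_class.
  rewrite (stab_sum_jt_eq C (mu := nth 0%N (part_of_mnm m'))).
  + by rewrite Num.Theory.pnatr_eq0 -lt0n prodn_gt0 // => i; apply: fact_gt0.
  + exact: part_nth_le.
  + exact: sum_part.
  + by rewrite tE -/(part_mnm k (part_of_mnm m')) p3.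
pose G u := irr mu u - jt mu u - \sum_(j <- ms) b j * e j u.
have Gcl : class_fun G.
  move=> u g; rewrite /G (irr_char_class _ smu pmu) jt_fun_class; congr (_ - _).
  by apply: eq_bigr => j _; rewrite /e jt_fun_class.
(* Contents below [mu] are settled by the elimination; above [mu] every term has sum 0; at [mu] the
   sums of [irr mu] and [jt mu] agree and the other terms vanish. *)
have Gt (t : {ffun 'I_k -> 'I_k}) : \sum_(u | stab t u) G u = 0.
  have [t' st sorted_t'] := sort_coloring t.
  rewrite -(eq_bigl _ _ st); case: (ltgtP (content_mnm t') (part_mnm k mu)) => h.
  - rewrite -AE //; apply: bP; rewrite mem_sort mem_filter h mem_undup.
    by apply: map_f; rewrite mem_filter sorted_t' mem_enum.
  - rewrite /G !sumrB stab_sum_irr_gt // stab_sum_jt_gt //; first last.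
    + exact: sum_part.
    + exact: part_nth_le.
    rewrite exchange_big big_seq big1 ?subrr // => j jm; rewrite -mulr_sumr e_gt ?mulr0 //.
    by have [_ _ _ lt _] := ms_part _ jm; apply: lt_trans h.
  - rewrite /G !sumrB stab_sum_irr_eq // (stab_sum_jt_eq C (mu := nth 0%N mu)) //; first last.
    + exact: sum_part.
    + exact: part_nth_le.
    rewrite subrr exchange_big big_seq big1 ?subrr // => j jm; rewrite -mulr_sumr e_gt ?mulr0 //.
    by have [_ _ _ lt _] := ms_part _ jm; rewrite h.
have G0 : forall u, G u = 0.
  apply: (@class_fun_eq0 C k (fun=> 1) (fun=> 1)).
  - by move=> _; apply: oner_neq0.
  - by move=> _; apply: oner_neq0.
  - exact: class_fun_cyc_count.
  - by rewrite chs_psum1 big1 // => t _; rewrite Gt scale0r.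
have irrE u : irr mu u = jt mu u + \sum_(j <- ms) b j * e j u.
  by have /eqP := G0 u; rewrite /G -addrA -opprD subr_eq0 => /eqP.
(* In the pairing with the character of the partition [i], both [irr mu] and [jt mu] give 0, the
   terms j other than i give 0 because [e j] is a Specht character by induction, and the term of [i]
   gives [b i] times k!. *)
have b0 i : i \in ms -> b i = 0.
  move=> im; have [p1 p2 p3 lti _] := ms_part _ im.
  have := irr_orthogonal pmu smu p1 p2; rewrite p3 => /(_ lti).
  under eq_bigr => u _ do rewrite irrE mulrDl.
  rewrite big_split /= [X in X + _](_ : _ = 0) ?add0r; last first.
    under eq_bigr => u _ do rewrite mulrC.
    by apply: pair_irr_jt_lt => //; rewrite p3.
  under eq_bigr => u _ do rewrite mulr_suml.
  rewrite exchange_big /= (bigD1_seq i) //= [X in _ + X]big_seq_cond [X in _ + X]big1 ?addr0 =>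
    [|j /andP [jm ji]].
    under eq_bigr => u _ do rewrite -mulrA.
    rewrite -mulr_sumr => /eqP; rewrite mulf_eq0 => /orP [/eqP //|].
    under eq_bigr => u _ do rewrite mulrC.
    by rewrite pair_irr_jt_eq // (negPf (fact_neq0 C k)).
  have [q1 q2 q3 ltj _] := ms_part _ jm.
  under eq_bigr => u _ do rewrite -mulrA.
  rewrite -mulr_sumr; apply/eqP; rewrite mulf_eq0; apply/orP; right; apply/eqP.
  rewrite (eq_bigr (fun u => irr (part_of_mnm j) u * irr (part_of_mnm i) u)); last first.
    by move=> u _; rewrite (IHmu (part_of_mnm j)) ?q3.
  have [ij|ij|ij] := ltgtP i j; last by rewrite ij eqxx in ji.
    by apply: irr_orthogonal => //; rewrite p3 q3.
  under eq_bigr => u _ do rewrite mulrC.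
  by apply: irr_orthogonal => //; rewrite p3 q3.
move=> u; rewrite irrE big_seq big1 ?addr0 // => j jm.
by rewrite b0 // mul0r.
Qed.

End Frobenius.

(** * Super power sums and supersymmetric Schur polynomials *)

Section SuperPowerSums.
Variables (C : numClosedFieldType) (m n : nat).

Definition super_sgn (v : 'I_(m + n)) : C := if (m <= v)%N then -1 else 1.

Lemma super_sgn_neq0 v : super_sgn v != 0.
Proof. by rewrite /super_sgn; case: ifP; rewrite ?oppr_eq0 oner_eq0. Qed.

Definition spsum : nat -> {mpoly C[m + n]} := psum super_sgn super_sgn.

(** Each variable contributes its own factor of the generating function: power sums x^r give the
    geometric series, and -(-y)^r gives 1 + y t. *)
Lemma superS_hS k : superS C m n k = hS spsum k.
Proof.
rewrite /superS /schur_genfun.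
pose Z (v : 'I_(m + n)) : {poly {mpoly C[m + n]}} :=
  if (m <= v)%N then 1 + ('X_v)%:P * 'X else \sum_(a < k.+1) ('X_v)%:P ^+ a * 'X^a.
pose q (v : 'I_(m + n)) r : {mpoly C[m + n]} := if (m <= v)%N then - (- 'X_v) ^+ r else 'X_v ^+ r.
rewrite (hS_sum (q := q) (Z := Z)).
- rewrite [\prod_v Z v]big_split_ord /=; congr (nth _ (polyseq (_ * _)) _); apply: eq_bigr => v _.
    by rewrite /Z /= leqNgt ltn_ord.
  by rewrite /Z /= leq_addr.
- move=> r; apply: eq_bigr => v _; rewrite /q /super_sgn.
  by case: ifP => _; rewrite ?scale1r ?scaleN1r.
- move=> v a ak; rewrite /Z /q; case: ifP => _; first by rewrite hS_signed_pow.
  rewrite hS_pow coef_sum (bigD1 (Ordinal (n := k.+1) (m := a) ak)) //= big1 => [|c ca].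
    by rewrite -rmorphXn coefCM coefXn eqxx mulr1 addr0.
  rewrite -rmorphXn coefCM coefXn (_ : (a == c) = false) ?mulr0 //.
  by apply/negbTE; rewrite eq_sym -val_eqE in ca *.
Qed.

Lemma chs_irr_char la : is_partition la ->
  chs spsum (@irr_char C (sumn la) la) = ((sumn la)`!%:R : C) *: superSchur C m n la.
Proof.
move=> pla; have -> : superSchur C m n la = jt_det (hS spsum) (nth 0%N la) (sumn la).
  rewrite (@jt_det_pads _ _ _ (size la)) ?hS0 ?size_part //.
    congr (\det _); apply/matrixP => i j; rewrite !mxE /superSz /Hz.
    by case: (_ + _) => // k; rewrite superS_hS.
  by move=> i; apply: nth_default.
rewrite -chs_jt_fun; last exact: sum_part.
by apply: eq_bigr => u _; rewrite irr_char_jt.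
Qed.

End SuperPowerSums.

(** * Signs in super-immanants *)

Lemma odd_sum (I : Type) (r : seq I) (P : pred I) (F : I -> nat) :
  odd (\sum_(i <- r | P i) F i) = \big[addb/false]_(i <- r | P i) odd (F i).
Proof. exact: (big_morph odd oddD). Qed.

Lemma eq_sign (R : pzRingType) a b : odd a = odd b -> (-1) ^+ a = (-1) ^+ b :> R.
Proof. by move=> ab; rewrite -signr_odd ab signr_odd. Qed.

Lemma big_addb_andl (I : Type) (r : seq I) (P : pred I) b (F : I -> bool) :
  \big[addb/false]_(i <- r | P i) (b && F i) = b && \big[addb/false]_(i <- r | P i) F i.
Proof. by case: b; rewrite //= big1. Qed.

Lemma big_addb_andr (I : Type) (r : seq I) (P : pred I) b (F : I -> bool) :
  \big[addb/false]_(i <- r | P i) (F i && b) = (\big[addb/false]_(i <- r | P i) F i) && b.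
Proof. by rewrite andbC -big_addb_andl; apply: eq_bigr => i _; rewrite andbC. Qed.

Section Evaluation.
Variables (C : numClosedFieldType) (m n : nat).
Local Notation gen := (gen m n).
Local Notation Aelt := (Aelt C m n).
Implicit Types (a b : Aelt) (phi : seq gen -> C).

(** A linear functional on words; [Acoeff] is the case of [word_coeff]. An arbitrary [phi] lets
    products be evaluated factor by factor before any supercommutation sign is applied. *)
Definition ev a phi : C := \sum_(t <- a) t.1 * phi t.2.

Lemma ev_bigcat (I : Type) (r : seq I) (P : pred I) (F : I -> Aelt) phi :
  ev (\big[cat/[::]]_(i <- r | P i) F i) phi = \sum_(i <- r | P i) ev (F i) phi.
Proof.
apply: (big_morph (ev^~ phi)); first by move=> x y; rewrite /ev big_cat.
by rewrite /ev big_nil.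
Qed.

Lemma ev_scale c a phi : ev (Ascale c a) phi = c * ev a phi.
Proof. by rewrite /ev big_map mulr_sumr; apply: eq_bigr => t _; rewrite mulrA. Qed.

Lemma ev_mul a b phi : ev (Amul a b) phi = ev a (fun u => ev b (fun v => phi (u ++ v))).
Proof.
rewrite /ev /Amul big_allpairs_dep; apply: eq_bigr => t _.
by rewrite mulr_sumr; apply: eq_bigr => t' _; rewrite mulrA.
Qed.

Lemma ev_one phi : ev (Aone C m n) phi = phi [::].
Proof. by rewrite /ev big_seq1 mul1r. Qed.

Lemma ev_gen g phi : ev (Agen C g) phi = phi [:: g].
Proof. by rewrite /ev big_seq1 mul1r. Qed.

End Evaluation.

Section Tensors.
Variables (C : numClosedFieldType) (m n k : nat).
Local Notation tup := (k.-tuple 'I_(m + n)).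
Local Notation pe := (@pe m n).
Implicit Types I J K L : tup.

Definition oddi (i : 'I_(m + n)) : bool := (m <= i)%N.

Lemma parE i : par i = oddi i. Proof. by []. Qed.

Lemma odd_pe i j : odd (pe i j) = oddi i (+) oddi j.
Proof. by rewrite /Defs.pe oddD !parE !oddb. Qed.

Definition tsign I K L : nat :=
  (tpar I K * tpar K L + \sum_(p < k) \sum_(q < k | (q < p)%N)
     pe (tnth I p) (tnth K p) * pe (tnth K q) (tnth L q))%N.

Lemma ev_tmul (T U : tens C m n k) I L phi :
  ev (tmul T U I L) phi =
  \sum_(K : tup) (-1) ^+ tsign I K L *
     ev (T I K) (fun u => ev (U K L) (fun v => phi (u ++ v))).
Proof. by rewrite ev_bigcat; apply: eq_bigr => K _; rewrite ev_scale ev_mul. Qed.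

Lemma odd_tsign I K L : odd (tsign I K L) =
  ((\big[addb/false]_(p < k) (oddi (tnth I p) (+) oddi (tnth K p))) &&
   (\big[addb/false]_(p < k) (oddi (tnth K p) (+) oddi (tnth L p)))) (+)
  \big[addb/false]_(p < k) \big[addb/false]_(q < k | (q < p)%N)
    ((oddi (tnth I p) (+) oddi (tnth K p)) && (oddi (tnth K q) (+) oddi (tnth L q))).
Proof.
rewrite oddD oddM !odd_sum; congr ((_ && _) (+) _).
- by apply: eq_bigr => p _; rewrite odd_pe.
- by apply: eq_bigr => p _; rewrite odd_pe.
- by apply: eq_bigr => p _; rewrite odd_sum; apply: eq_bigr => q _; rewrite oddM !odd_pe.
Qed.

Definition Xsign r I J : bool :=
  \big[addb/false]_(b < k | (b < r)%N) \big[addb/false]_(a < k | (a < b)%N)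
    ((oddi (tnth I a) (+) oddi (tnth J a)) && (oddi (tnth I b) (+) oddi (tnth J b))).

(** Each new variable passes the matrix units of the earlier factors, which gives [Xsign]; the
    matrix units already stand in the order of their tensor slots and give no further sign. *)
Lemma ev_Xpre r I J phi : (r <= k)%N ->
  ev (foldl (fun T a => tmul T (Xa C a)) (@tone C m n k) (take r (enum 'I_k)) I J) phi =
  if [forall b : 'I_k, (r <= b)%N ==> (tnth I b == tnth J b)]
  then (-1) ^+ Xsign r I J * phi [seq (tnth I a, tnth J a) | a <- take r (enum 'I_k)]
  else 0.
Proof.
elim: r I J phi => [|r IH] I L phi rk.
  rewrite take0 /= /tone; have -> : [forall b : 'I_k, (0 <= b)%N ==> (tnth I b == tnth L b)] =
    (I == L).
    by apply/forallP/eqP => [h|-> b]; [apply: eq_from_tnth => b; apply/eqP;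
      exact: (h b) | rewrite eqxx].
  case: eqP => _; last by rewrite /ev big_nil.
  by rewrite ev_one /Xsign big_pred0 // expr0 mul1r.
pose a : 'I_k := Ordinal rk.
have tk : take r.+1 (enum 'I_k) = rcons (take r (enum 'I_k)) a.
  rewrite (take_nth a) ?size_enum_ord //; congr rcons; apply: ord_inj.
  by rewrite nth_enum_ord.
rewrite tk foldl_rcons ev_tmul.
(* The only intermediate tuple: the first [r] factors change only positions before [r], and the next
   factor changes only position [r]. *)
pose K0 : tup := [tuple if (b < r)%N then tnth L b else tnth I b | b < k].
have K0E b : tnth K0 b = if (b < r)%N then tnth L b else tnth I b by rewrite tnth_mktuple.
have zero K : K != K0 \/ ~~ [forall b : 'I_k, (r < b)%N ==> (tnth I b == tnth L b)] ->
  (-1) ^+ tsign I K L * ev (foldl (fun T a =>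
    tmul T (Xa C a)) (@tone C m n k) (take r (enum 'I_k)) I K)
    (fun u => ev (Xa C a K L) (fun v => phi (u ++ v))) = 0.
  move=> h; rewrite IH ?(ltnW rk) //; case: forallP => [IK|_]; last by rewrite mulr0.
  rewrite /Xa; case: forallP => [KL|_]; last by rewrite /ev big_nil !mulr0.
  have {}IK (b : 'I_k) : (r <= b)%N -> tnth I b = tnth K b by move=> rb; apply/eqP;
    exact: (implyP (IK b)).
  have {}KL (b : 'I_k) : b != a -> tnth K b = tnth L b by move=> ba; apply/eqP;
    exact: (implyP (KL b)).
  case: h => [/eqP[]|/forallPn [b]].
    apply: eq_from_tnth => b; rewrite K0E; case: ltnP => br; last by rewrite IK.
    by rewrite KL // -val_eqE /= neq_ltn br.
  rewrite negb_imply => /andP [rb /eqP[]].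
  by rewrite IK ?(ltnW rb) // KL // -val_eqE /= neq_ltn rb orbT.
case: (boolP [forall b : 'I_k, (r < b)%N ==> (tnth I b == tnth L b)]) => h; last first.
  by rewrite big1 // => K _; apply: zero; right.
rewrite (bigD1 K0) //= big1 ?addr0 => [|K KK]; last by apply: zero; left.
rewrite IH ?(ltnW rk) // ifT; last first.
  by apply/forallP => b; apply/implyP => rb; rewrite K0E ltnNge rb.
rewrite /Xa ifT; last first.
  apply/forallP => b; apply/implyP => ba; rewrite K0E; case: ltnP => // rb.
  have := forallP h b; rewrite ltn_neqAle rb andbT => /implyP -> //.
  by rewrite eq_sym; move: ba; rewrite -val_eqE.
have K0a : tnth K0 a = tnth I a by rewrite K0E ltnn.
have word_eq : [seq (tnth I b, tnth K0 b) | b <- take r (enum 'I_k)] =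
               [seq (tnth I b, tnth L b) | b <- take r (enum 'I_k)].
  apply/eq_in_map => b; rewrite K0E; move/(map_f val); rewrite map_take val_enum_ord.
  by rewrite take_iota mem_iota add0n => /andP [_]; rewrite leq_min => /andP [-> _].
rewrite ev_gen word_eq K0a cats1 map_rcons mulrA -exprD; congr (_ * _).
rewrite -signr_odd oddD oddb odd_tsign.
pose eps b := oddi (tnth I b) (+) oddi (tnth L b).
have e1 b : oddi (tnth I b) (+) oddi (tnth K0 b) = (b < r)%N && eps b.
  by rewrite K0E; case: ltnP => //; rewrite addbb.
have e2 b : oddi (tnth K0 b) (+) oddi (tnth L b) = (b == a) && eps b.
  rewrite K0E -val_eqE /= eqn_leq; case: ltnP => br; first by rewrite addbb andbF.
  rewrite andbT; case: leqP => // rb.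
  by have /implyP /(_ rb) /eqP -> := forallP h b; rewrite addbb.
have XsignS : Xsign r.+1 I L = Xsign r I L (+) (\big[addb/false]_(p < k | (p < r)%N) eps p) &&
  eps a.
  rewrite /Xsign (bigID (fun b : 'I_k => (b < r)%N)) /=; congr (_ (+) _).
    by apply: eq_bigl => b; rewrite ltnS andbC; case: ltngtP.
  rewrite (big_pred1 a) => [|b]; last first.
    by rewrite /= -val_eqE /= ltnS -leqNgt eqn_leq.
  by rewrite /= -big_addb_andr.
congr (_ ^+ _); rewrite XsignS addbC; congr (nat_of_bool (_ (+) _)).
  rewrite /Xsign; apply: eq_bigr => b br; apply: eq_bigr => c cb.
  by rewrite !e1 br (ltn_trans cb br).
rewrite [X in _ (+) X]big1 ?addbF => [|p _]; last first.
  rewrite big1 // => q qp; rewrite e1 e2;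
    apply/negbTE/negP => /andP [/andP [pr _] /andP [/eqP qa _]].
  by rewrite qa /= in qp; have := ltn_trans qp pr; rewrite ltnn.
congr (_ && _).
  rewrite [RHS]big_mkcond; apply: eq_bigr => p _; rewrite e1; by case: ifP.
rewrite (bigD1 a) //= e2 eqxx /= big1 ?addbF // => p pa; by rewrite e2 (negbTE pa).
Qed.

Lemma ev_Xprod I J phi :
  ev (Xprod C I J) phi = (-1) ^+ Xsign k I J * phi [seq (tnth I a, tnth J a) | a <- enum 'I_k].
Proof.
rewrite /Xprod -[X in foldl _ _ X](take_size (enum 'I_k)) size_enum_ord ev_Xpre //.
rewrite take_oversize ?size_enum_ord // ifT //.
by apply/forallP => b; rewrite leqNgt ltn_ord.
Qed.

Definition imm_sign (s : 'S_k) I : bool :=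
  (\big[addb/false]_(p < k) oddi (tnth I p)) (+)
  \big[addb/false]_(p < k) \big[addb/false]_(q < k | (p < q)%N)
    (((oddi (tnth I q) (+) oddi (tnth I (s q))) && oddi (tnth I (s p))) (+)
     ((s q < s p)%N && (oddi (tnth I (s p)) && oddi (tnth I (s q))))).

(** [gamma] is even on the diagonal, the product of total parities in [tsign] vanishes because [s]
    permutes the entries of [I], and the rest of [tsign] cancels [Xsign]. What remains in [imm_sign]
    is the prefactor, the Koszul sign and the sign of the action of [s]. *)
Lemma ev_immk (chi : 'S_k -> C) I phi :
  ev (immk chi I) phi = \sum_(s : 'S_k) chi s *
    ((-1) ^+ imm_sign s I * phi [seq (tnth I (s p), tnth I p) | p <- enum 'I_k]).
Proof.
rewrite /immk /bra !ev_scale ev_bigcat mulrA mulr_sumr; apply: eq_bigr => s _.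
rewrite ev_scale mulrCA; congr (_ * _).
rewrite ev_tmul.
pose K : tup := [tuple tnth I (s p) | p < k].
have KE p : tnth K p = tnth I (s p) by rewrite tnth_mktuple.
have IK : I = perm_tup s K.
  by apply: eq_from_tnth => p; rewrite tnth_mktuple KE permKV.
rewrite (bigD1 K) //= [X in _ * (_ + X)]big1 ?addr0 => [|K' KK]; last first.
  rewrite /perm_tens; case: eqP => [E|_]; last by rewrite /ev big_nil mulr0.
  case/eqP: KK; apply: eq_from_tnth => p; rewrite KE {1}E tnth_mktuple permK //.
rewrite /perm_tens -IK eqxx {1}/ev big_seq1 /= ev_Xprod.
rewrite !mulrA -!exprD; congr (_ * _); last by congr phi; apply: eq_map => p; rewrite KE.
have oddE a b c d e f : odd (a + b + c + (d + e) + f) =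
  odd a (+) odd b (+) odd c (+) (odd d (+) odd e) (+) odd f by rewrite !oddD.
apply: eq_sign; rewrite oddE !oddb odd_tsign.
set tp := \big[addb/false]_(p < k) _.
have -> : odd (gamma I I) = false.
  rewrite /gamma oddD !odd_sum !big1 // => p _.
    rewrite odd_sum big1 // => q _; by rewrite oddM oddD addbb andbF.
  by rewrite oddM /=; case: odd.
have -> : tp = false.
  rewrite /tp big_split /= [X in X (+) _](reindex_inj (@perm_inj _ s)) /=.
  by rewrite [X in _ (+) X](eq_bigr (fun p => oddi (tnth I (s p)))) ?addbb // => p _; rewrite KE.
have -> : Xsign k K I = \big[addb/false]_(p < k) \big[addb/false]_(q < k | (q < p)%N)
  ((oddi (tnth I p) (+) oddi (tnth K p)) && (oddi (tnth K q) (+) oddi (tnth I q))).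
  rewrite /Xsign; apply: eq_big => [p|p _]; first by rewrite ltn_ord.
  by apply: eq_bigr => q _; rewrite andbC addbC [X in _ && X]addbC addbC.
rewrite andFb addFb addbF.
set XX := \big[addb/false]_(p < k) \big[addb/false]_(q < k | (q < p)%N) _.
have cancel2 (x y z : bool) : x (+) y (+) z (+) y = x (+) z by case: x; case: y; case: z.
rewrite cancel2 /imm_sign.
congr (_ (+) _).
  by rewrite odd_sum; apply: eq_bigr => p _; rewrite parE oddb.
under [RHS]eq_bigr => p _ do rewrite big_split /=.
rewrite big_split /= addbC; congr (_ (+) _).
  rewrite /koszul odd_sum; under eq_bigr => q _ do rewrite odd_sum.
  rewrite (exchange_big_dep xpredT) //=; apply: eq_bigr => p _; apply: eq_bigr => q _.
  by rewrite oddM odd_pe parE oddb !KE.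
rewrite /perm_sign odd_sum; apply: eq_bigr => p _; rewrite odd_sum.
rewrite big_mkcond [RHS]big_mkcond; apply: eq_bigr => q _.
by case: (p < q)%N; case: (s q < s p)%N; rewrite //= oddM !parE !oddb !KE.
Qed.

End Tensors.

(** * Independence of the sign from the order of the letters *)

Section PairSums.
Variable T : eqType.
Implicit Types (e : seq T) (f : T -> T -> bool).

(** Pairs are ordered by position in [e], because the words of several blocks will be
    concatenated. *)
Definition pair_xor f e : bool := \big[addb/false]_(i <- e)
  \big[addb/false]_(j <- e | (index i e < index j e)%N) f i j.

Lemma pair_xor_cons f a e : uniq (a :: e) ->
  pair_xor f (a :: e) = (\big[addb/false]_(j <- e) f a j) (+) pair_xor f e.
Proof.
move=> /= /andP [ae ue]; rewrite /pair_xor big_cons; congr (_ (+) _).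
  rewrite big_cons /= eqxx /= big_seq_cond [RHS]big_seq_cond; apply: eq_bigl => j.
  by case: (boolP (j \in e)) => //= je; case: eqP => // ja; rewrite ja je in ae.
apply: eq_big_seq => i ie.
have ai : (a == i) = false by apply: contraNF ae => /eqP ->.
rewrite big_cons /= eqxx ai ltn0 big_seq_cond [RHS]big_seq_cond; apply: eq_bigl => j.
case: (boolP (j \in e)) => //= je.
by have -> : (a == j) = false by apply: contraNF ae => /eqP ->.
Qed.

Lemma pair_xor_cat f e1 e2 : uniq (e1 ++ e2) ->
  pair_xor f (e1 ++ e2) = pair_xor f e1 (+) pair_xor f e2 (+)
    \big[addb/false]_(i <- e1) \big[addb/false]_(j <- e2) f i j.
Proof.
elim: e1 => [|a e1 IH] ue; first by rewrite /pair_xor !big_nil addbF addFb.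
have ue1 : uniq (a :: e1) by move: ue; rewrite cat_uniq => /and3P [].
rewrite cat_cons pair_xor_cons // pair_xor_cons // IH; last by move: ue => /= /andP[].
rewrite big_cat big_cons /= -!addbA; congr (_ (+) _).
by rewrite addbC -!addbA; congr (_ (+) _); rewrite addbCA addbC -!addbA [_ (+) _]addbC.
Qed.

Lemma eq_pair_xor f g e : {in e &, forall i j, f i j = g i j} ->
  pair_xor f e = pair_xor g e.
Proof.
move=> fg; apply: eq_big_seq => i ie; rewrite big_seq_cond [RHS]big_seq_cond.
by apply: eq_bigr => j /andP [je _]; apply: fg.
Qed.

Lemma pair_xor_tnth f e : uniq e ->
  pair_xor f e = \big[addb/false]_(p < size e) \big[addb/false]_(q < size e | (p < q)%N)
    f (tnth (in_tuple e) p) (tnth (in_tuple e) q).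
Proof.
move=> ue; have ix (p : 'I_(size e)) : index (tnth (in_tuple e) p) e = p.
  by rewrite (tnth_nth (tnth (in_tuple e) p)) index_uniq.
rewrite /pair_xor big_tnth; apply: eq_bigr => p _.
by rewrite big_tnth; apply: eq_bigl => q; rewrite !ix.
Qed.

End PairSums.

Section OrderedPairs.
Variable d : nat.
Implicit Types (u : {perm 'I_d}).

(** [u] permutes the unordered pairs, on which a symmetric [F] is defined. Over the naturals,
    doubling the sum makes it run over ordered pairs of distinct indices, where reindexing is
    direct. *)
Lemma xor_lt_perm (F : 'I_d -> 'I_d -> bool) u : (forall i j, F i j = F j i) ->
  \big[addb/false]_(i < d) \big[addb/false]_(j < d | (i < j)%N) F (u i) (u j) =
  \big[addb/false]_(i < d) \big[addb/false]_(j < d | (i < j)%N) F i j.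
Proof.
pose S (G : 'I_d -> 'I_d -> bool) := (\sum_(i < d) \sum_(j < d | (i < j)%N) G i j)%N.
have xorS G : \big[addb/false]_(i < d) \big[addb/false]_(j < d | (i < j)%N) G i j = odd (S G).
  rewrite odd_sum; apply: eq_bigr => i _; rewrite odd_sum.
  by apply: eq_bigr => j _; rewrite oddb.
have SS G : (forall i j, G i j = G j i) ->
    (S G + S G = \sum_i \sum_(j | j != i) G i j)%N.
  move=> Gs; rewrite {2}/S (exchange_big_dep xpredT) //= -big_split /=.
  apply: eq_bigr => i _; rewrite [RHS](bigID (fun j : 'I_d => (i < j)%N)) /=; congr (_ + _)%N.
    by apply: eq_bigl => j; rewrite -val_eqE /=; case: ltngtP.
  apply: eq_big => [j|j _]; last by rewrite Gs.
  by rewrite -val_eqE /=; case: ltngtP.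
move=> Fs; rewrite !xorS; congr odd.
have := SS _ Fs; have := SS (fun i j => F (u i) (u j)) (fun i j => Fs (u i) (u j)).
have -> : (\sum_i \sum_(j | j != i) F (u i) (u j) = \sum_i \sum_(j | j != i) F i j)%N.
  rewrite [RHS](reindex_inj (@perm_inj _ u)) /=; apply: eq_bigr => i _.
  rewrite [RHS](reindex_inj (@perm_inj _ u)) /=; apply: eq_bigl => j.
  by rewrite (inj_eq perm_inj).
by move=> <-; lia.
Qed.

Lemma pair_xor_full (f : 'I_d -> 'I_d -> bool) e : perm_eq e (enum 'I_d) ->
  pair_xor f e = \big[addb/false]_(i < d) \big[addb/false]_(j < d | (i < j)%N)
    (if (index i e < index j e)%N then f i j else f j i).
Proof.
move=> pe; have mem_e i : i \in e by rewrite (perm_mem pe) mem_enum.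
have ix_inj i j : index i e = index j e -> i = j by apply: index_inj.
rewrite /pair_xor (perm_big _ pe) big_enum /=.
under eq_bigr => i _ do rewrite (perm_big _ pe) big_enum_cond /=.
transitivity ((\big[addb/false]_(i < d) \big[addb/false]_(j < d | (i < j)%N) ((index i e <
  index j e)%N && f i j)) (+)
   (\big[addb/false]_(i < d) \big[addb/false]_(j < d | (i < j)%N) ((index j e < index i e)%N &&
     f j i))).
  rewrite [X in _ = _ (+) X](exchange_big_dep xpredT) //= -big_split /=; apply: eq_bigr => i _.
  rewrite big_mkcond (bigID (fun j : 'I_d => (i < j)%N)) /=; congr (_ (+) _).
  rewrite [RHS]big_mkcond [LHS]big_mkcond; apply: eq_bigr => j _.
  by case: (ltngtP i j) => //= /ord_inj ->; rewrite ltnn.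
rewrite -big_split /=; apply: eq_bigr => i _; rewrite -big_split /=; apply: eq_bigr => j ij.
case: ltngtP => //=; rewrite ?addbF ?addFb //.
by move/ix_inj => E; rewrite E ltnn in ij.
Qed.
End OrderedPairs.

Section PermutationWords.
Variables (C : numClosedFieldType) (m n : nat).
Local Notation d := (m + n)%N.
Local Notation gen := (gen m n).
Local Notation oddi := (@oddi m n).
Implicit Types (u : {perm 'I_d}) (e : seq 'I_d).

Definition perm_word e u : seq gen := [seq (u i, i) | i <- e].

(** [imm_sign] in terms of the letters of [e] instead of positions; it still depends on their
    order. *)
Definition perm_eps e u : bool :=
  (\big[addb/false]_(i <- e) oddi i) (+)
  pair_xor (fun i j => ((oddi j (+) oddi (u j)) && oddi (u i)) (+)
    ((index (u j) e < index (u i) e)%N && (oddi (u i) && oddi (u j)))) e.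

Lemma ev_imm e (chi : 'S_(size e) -> C) (phi : seq gen -> C) : uniq e ->
  ev (immk chi (in_tuple e)) phi =
  \sum_(u | perm_on [set x in e] u) chi (sub_perm e u) *
    ((-1) ^+ perm_eps e u * phi (perm_word e u)).
Proof.
move=> ue; rewrite ev_immk (reindex_sub_perm ue); apply: eq_bigr => u uon.
have sE := sub_permE ue (perm_on_stable uon).
congr (_ * (_ ^+ nat_of_bool _ * phi _)); last first.
  transitivity (perm_word [seq tnth (in_tuple e) p | p <- enum 'I_(size e)] u).
    by rewrite /perm_word -[RHS]map_comp; apply: eq_map => p /=; rewrite sE.
  by rewrite map_tnth_enum.
rewrite /imm_sign /perm_eps pair_xor_tnth // big_tnth; congr (_ (+) _).
apply: eq_bigr => p _; apply: eq_bigr => q _; rewrite !sE.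
by rewrite -!sE !index_tnth_seq.
Qed.

Lemma perm_stable_seq e u : uniq e -> (forall x, x \in e -> u x \in e) ->
  perm_eq (map u e) e.
Proof.
move=> ue us; have um : uniq (map u e) by rewrite map_inj_uniq //; apply: perm_inj.
apply: uniq_perm => //; have [] := uniq_min_size um (s2 := e) _ _ => //.
  by move=> _ /mapP [x xe ->]; apply: us.
by rewrite size_map.
Qed.

(** The cross terms cancel: there are no inversions between the blocks, and what is left adds the
    parities of j and u(j) over the second block, which [u] permutes. *)
Lemma perm_eps_cat e1 e2 u : uniq (e1 ++ e2) ->
  (forall x, x \in e1 -> u x \in e1) -> (forall x, x \in e2 -> u x \in e2) ->
  perm_eps (e1 ++ e2) u = perm_eps e1 u (+) perm_eps e2 u.
Proof.
move=> ue s1 s2; have := ue; rewrite cat_uniq => /and3P [u1 /hasPn e12 u2].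
have ix1 x : x \in e1 -> index x (e1 ++ e2) = index x e1 by move=> xe; rewrite index_cat xe.
have ix2 x : x \in e2 -> index x (e1 ++ e2) = (size e1 + index x e2)%N.
  by move=> /e12 /= /negbTE xe; rewrite index_cat xe.
rewrite /perm_eps pair_xor_cat // big_cat /=.
set f := (fun i j : 'I_d => _ (+) ((index (u j) (e1 ++ e2) < _)%N && _)).
have -> : \big[addb/false]_(i <- e1) \big[addb/false]_(j <- e2) f i j = false.
  transitivity (\big[addb/false]_(i <- e1) \big[addb/false]_(j <- e2) ((oddi j (+) oddi (u j))
    && oddi (u i))).
    apply: eq_big_seq => i ie; apply: eq_big_seq => j je; rewrite /f.
    rewrite ix2 ?s2 // ix1 ?s1 // ltnNge ltnW ?addbF //.
    by rewrite (leq_trans _ (leq_addr _ _)) // index_mem s1.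
  rewrite big1 // => i _; rewrite big_addb_andr big_split /=.
  have -> : \big[addb/false]_(j <- e2) oddi (u j) = \big[addb/false]_(j <- e2) oddi j.
    by rewrite -(big_map u xpredT oddi) (perm_big _ (perm_stable_seq u2 s2)).
  by rewrite addbb.
rewrite addbF.
have -> : pair_xor f e1 = pair_xor (fun i j => ((oddi j (+) oddi (u j)) && oddi (u i)) (+)
    ((index (u j) e1 < index (u i) e1)%N && (oddi (u i) && oddi (u j)))) e1.
  by apply: eq_pair_xor => i j ie je; rewrite /f !ix1 ?s1.
have -> : pair_xor f e2 = pair_xor (fun i j => ((oddi j (+) oddi (u j)) && oddi (u i)) (+)
    ((index (u j) e2 < index (u i) e2)%N && (oddi (u i) && oddi (u j)))) e2.
  by apply: eq_pair_xor => i j ie je; rewrite /f !ix2 ?s2 // ltn_add2l.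
by rewrite addbACA.
Qed.

Lemma odd_inv_odd e u : uniq e -> odd (inv_odd (perm_word e u)) =
  pair_xor (fun i j => (oddi i (+) oddi (u i)) && ((oddi j (+) oddi (u j)) &&
     (grank (u j, j) < grank (u i, i))%N)) e.
Proof.
elim: e => [|a e IH] ue; first by rewrite /pair_xor big_nil.
rewrite pair_xor_cons // -IH; last by move: ue => /andP[].
rewrite /= oddD oddM oddb; congr (_ (+) _).
have gp i : gpar (u i, i) = oddi i (+) oddi (u i) by rewrite /gpar odd_pe addbC.
rewrite gp big_addb_andl; congr (_ && _).
rewrite count_map -sum1_count odd_sum big_mkcond; apply: eq_bigr => j _ /=.
by rewrite gp; case: ifP.
Qed.

Lemma gle_total : total (@gle m n). Proof. by move=> g h; apply: leq_total. Qed.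
Lemma gle_trans : transitive (@gle m n). Proof. by move=> g h k; apply: leq_trans. Qed.
Lemma gle_anti : antisymmetric (@gle m n).
Proof. by move=> g h; rewrite /gle -eqn_leq => /eqP /ord_inj /enum_rank_inj. Qed.

Lemma grank_inj : injective (@grank m n).
Proof. by move=> g h /ord_inj /enum_rank_inj. Qed.

(* Exchanging i and j in e changes perm_eps by p_j p'_i + p_i p'_j + p'_i p'_j + p_i p_j,
   where p' i = p (u i) and the last term arises after reindexing the pairs by u; this is
   the product of the parities of the letters x_(u i, i) and x_(u j, j). *)
Lemma perm_eps_word e e0 u : perm_eq e (enum 'I_d) -> perm_eq e0 (enum 'I_d) ->
  perm_eps e u (+) odd (inv_odd (perm_word e u)) =
  perm_eps e0 u (+) odd (inv_odd (perm_word e0 u)).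
Proof.
pose o i := oddi i (+) oddi (u i).
pose rk i := grank (u i, i).
suff main e' : perm_eq e' (enum 'I_d) ->
   perm_eps e' u (+) odd (inv_odd (perm_word e' u)) =
   (\big[addb/false]_(i <- enum 'I_d) oddi i) (+)
   \big[addb/false]_(i < m + n) \big[addb/false]_(j < m + n | (i < j)%N)
     (((oddi j (+) oddi (u j)) && oddi (u i)) (+) (o i && (o j && (rk j < rk i)%N)) (+)
      ((u j < u i)%N && (oddi (u i) && oddi (u j)))).
  by move=> pe pe0; rewrite !main.
move=> pe'; have ue' : uniq e' by rewrite (perm_uniq pe') enum_uniq.
have mem_e i : i \in e' by rewrite (perm_mem pe') mem_enum.
have ix_inj i j : index i e' = index j e' -> i = j by apply: index_inj.
rewrite odd_inv_odd // /perm_eps -addbA; congr (_ (+) _); first exact: perm_big.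
rewrite !pair_xor_full //.
(* The relative order of i and j in e' differs from the natural one. *)
pose c (i j : 'I_d) := (i != j) && ((index i e' < index j e')%N (+) (i < j)%N).
have cC i j : c i j = c j i.
  rewrite /c eq_sym; case: eqVneq => //= ij.
  have : index i e' != index j e' by apply: contraNneq ij => /ix_inj ->.
  have : (i != j :> nat) by rewrite eq_sym.
  by move=> h1 h2; case: (ltngtP (i : nat) j) h1 => // _ _;
    case: (ltngtP (index i e') (index j e')) h2.
have step := xor_lt_perm (F := fun i j => c i j && (oddi i && oddi j)) u
  (fun i j => f_equal2 andb (cC i j) (andbC _ _)).
have add_eq (a r x y : bool) : x = y -> a = r (+) (x (+) y) -> a = r.
  by move=> ->; rewrite addbb addbF.
apply: (add_eq _ _ _ _ step); rewrite -!big_split /=; apply: eq_bigr => i _.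
rewrite -!big_split /=; apply: eq_bigr => j ij.
have uij : u i != u j by rewrite (inj_eq perm_inj) -val_eqE /= neq_ltn ij.
have ij' : i != j by rewrite -val_eqE /= neq_ltn ij.
rewrite /c uij ij' ij /=.
have ixu : index (u i) e' != index (u j) e' by apply: contraNneq uij => /ix_inj ->.
have ixi : index i e' != index j e' by apply: contraNneq ij' => /ix_inj ->.
have uij_nat : (u i != u j :> nat) by [].
have rkij : rk i != rk j.
  by apply: contraNneq ij' => /grank_inj [_ ->].
rewrite -/(o i) -/(o j).
have oi : o i = oddi i (+) oddi (u i) by []. have oj : o j = oddi j (+) oddi (u j) by [].
case: (ltngtP (index i e') (index j e')) ixi => // _ _;
case: (ltngtP (index (u i) e') (index (u j) e')) ixu => // _ _;
case: (ltngtP (u i) (u j)) uij_nat => // _ _;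
case: (ltngtP (rk i) (rk j)) rkij => // _ _;
rewrite oi oj; move: (oddi i) (oddi j) (oddi (u i)) (oddi (u j)); by do 4!case.
Qed.

Definition theta u (w : seq gen) : C :=
  (-1) ^+ perm_eps (enum 'I_d) u * word_coeff C (perm_word (enum 'I_d) u) w.

Lemma thetaE e u w : perm_eq e (enum 'I_d) ->
  (-1) ^+ perm_eps e u * word_coeff C (perm_word e u) w = theta u w.
Proof.
move=> pe; rewrite /theta /word_coeff.
(* The letters x_(u i, i) have distinct second indices, so no odd generator is repeated. *)
have uw e' : perm_eq e' (enum 'I_d) -> uniq [seq g <- perm_word e' u | gpar g].
  move=> pe'; apply: filter_uniq; rewrite map_inj_uniq ?(perm_uniq pe') ?enum_uniq //.
  by move=> i j [].
rewrite !uw // !andbT.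
have -> : sort (@gle m n) (perm_word e u) = sort (@gle m n) (perm_word (enum 'I_d) u).
  by apply/(perm_sortP gle_total gle_trans gle_anti); apply: perm_map.
case: ifP => _; rewrite ?mulr0 //.
rewrite -!exprD; apply: eq_sign; rewrite !oddD !oddb.
exact: perm_eps_word.
Qed.

Lemma flatten_fibers (V : finType) (t : {ffun 'I_d -> V}) (vs : seq V) x :
  (x \in flatten [seq fiber t v | v <- vs]) = (t x \in vs).
Proof.
apply/flatten_mapP/idP => [[v vvs]|tx]; first by rewrite mem_fiber => /eqP ->.
by exists (t x); rewrite // mem_fiber.
Qed.

Lemma uniq_flatten_fibers (V : finType) (t : {ffun 'I_d -> V}) (vs : seq V) : uniq vs ->
  uniq (flatten [seq fiber t v | v <- vs]).
Proof.
elim: vs => //= v vs IH /andP [vvs uvs]; rewrite cat_uniq fiber_uniq IH // andbT /=.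
apply/hasPn => x; rewrite flatten_fibers => tx; rewrite /= mem_fiber.
by apply: contraNneq vvs => <-.
Qed.

Lemma perm_eps_fibers (V : finType) (t : {ffun 'I_d -> V}) (vs : seq V) u : uniq vs ->
  stab t u ->
  perm_eps (flatten [seq fiber t v | v <- vs]) u =
  \big[addb/false]_(v <- vs) perm_eps (fiber t v) u.
Proof.
move=> + su; elim: vs => [|v vs IH] uvs.
  by rewrite big_nil /perm_eps /pair_xor !big_nil.
rewrite /= perm_eps_cat; first 1 last.
- exact: (uniq_flatten_fibers t uvs).
- exact: stab_fiber.
- by move=> x; rewrite !flatten_fibers (stabP _ _ su).
by rewrite big_cons IH //; move: uvs => /andP[].
Qed.

Lemma theta_fibers (V : finType) (t : {ffun 'I_d -> V}) u w : stab t u ->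
  (-1) ^+ (\big[addb/false]_(v <- enum V) perm_eps (fiber t v) u) *
  word_coeff C (flatten [seq perm_word (fiber t v) u | v <- enum V]) w = theta u w.
Proof.
move=> su; rewrite -perm_eps_fibers ?enum_uniq //.
have -> : flatten [seq perm_word (fiber t v) u | v <- enum V] =
          perm_word (flatten [seq fiber t v | v <- enum V]) u.
  by rewrite /perm_word map_flatten -[X in _ = flatten X]map_comp.
apply: thetaE; apply: uniq_perm; rewrite ?enum_uniq ?uniq_flatten_fibers ?enum_uniq //.
by move=> x; rewrite flatten_fibers !mem_enum.
Qed.

End PermutationWords.

(** * The induced class function *)

(** The sizes of two corresponding blocks are equal but not convertible, so conjugacy is stated
    through a bijection of positions instead of a cast. *)
Lemma class_fun_intertwine (X : Type) (f : forall k, 'S_k -> X) k k' (s : 'S_k) (s' : 'S_k')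
    (b : 'I_k' -> 'I_k) : class_fun (f k) -> k' = k -> injective b ->
  (forall p, b (s' p) = s (b p)) -> f k' s' = f k s.
Proof.
move=> fcl kk; subst k' => bI bs.
suff -> : s = (s' ^ perm bI)%g by rewrite fcl.
apply/permP => p; rewrite -[p](permKV (perm bI)) permJ !permE.
by rewrite -bs.
Qed.

Lemma sub_perm_conj (X : Type) (f : forall k, 'S_k -> X) (T : finType) (e e' : seq T)
    (u g : {perm T}) : uniq e -> uniq e' -> class_fun (f (size e)) ->
  (forall x, (g x \in e) = (x \in e')) -> (forall x, x \in e' -> u x \in e') ->
  f _ (sub_perm e' u) = f _ (sub_perm e (u ^ g)%g).
Proof.
move=> ue ue' fcl ge ust.
have bP p : exists q, tnth (in_tuple e) q == g (tnth (in_tuple e') p).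
  have /tnthP [q ->] : g (tnth (in_tuple e') p) \in in_tuple e by rewrite ge mem_tnth.
  by exists q.
pose b p := xchoose (bP p).
have bE p : tnth (in_tuple e) (b p) = g (tnth (in_tuple e') p) by apply/eqP/(xchooseP (bP p)).
apply: (class_fun_intertwine (b := b)) => //.
- rewrite -(size_map g e'); apply/perm_size/uniq_perm => //.
    by rewrite map_inj_uniq //; apply: perm_inj.
  move=> x; apply/mapP/idP => [[y ye ->]|xe]; first by rewrite ge.
  by exists (g^-1 x)%g; rewrite ?permKV // -ge permKV.
- move=> p q /(congr1 (tnth (in_tuple e))); rewrite !bE => /perm_inj.
  exact: (tnth_seq_inj ue').
- move=> p; apply: (tnth_seq_inj ue); rewrite bE !sub_permE //; last first.
    move=> x xe; rewrite -[x](permKV g) permJ ge; apply: ust.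
    by rewrite -ge permKV.
  by rewrite bE permJ.
Qed.

Section Products.
Variables (C : numClosedFieldType) (m n : nat).
Local Notation d := (m + n)%N.
Local Notation Aelt := (Aelt C m n).

(** Expands a product over blocks into choices of one term per block. Functions are pinned to [x0]
    outside [js] so that each choice is counted once. *)
Lemma ev_foldr (V X : finType) (x0 : X) (Q : V -> pred X) (a : V -> X -> C)
    (wd : V -> X -> seq (gen m n)) (F : V -> Aelt) (js : seq V) :
  (forall j phi, ev (F j) phi = \sum_(x | Q j x) a j x * phi (wd j x)) ->
  uniq js -> forall phi,
  ev (foldr (@Amul C m n) (Aone C m n) [seq F j | j <- js]) phi =
  \sum_(f : {ffun V -> X} | [forall j, if j \in js then Q j (f j) else f j == x0])
    (\prod_(j <- js) a j (f j)) * phi (flatten [seq wd j (f j) | j <- js]).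
Proof.
move=> FE; elim: js => [|j js IH] ujs phi.
  rewrite /= ev_one (big_pred1 [ffun=> x0]) => [|f]; first by rewrite big_nil mul1r.
  by apply/forallP/eqP => [h|-> i]; [apply/ffunP => i; rewrite ffunE (eqP (h i)) | rewrite ffunE].
move: ujs => /= /andP [jjs ujs].
rewrite ev_mul FE [RHS](partition_big (fun f : {ffun V -> X} => f j) (Q j)) /=; last first.
  by move=> f /forallP /(_ j); rewrite mem_head.
apply: eq_bigr => x Qx; rewrite IH // mulr_sumr.
pose up (f : {ffun V -> X}) := [ffun i => if i == j then x else f i].
pose down (f : {ffun V -> X}) := [ffun i => if i == j then x0 else f i].
have upj f i : i \in js -> up f i = f i.
  by move=> ijs; rewrite ffunE; case: eqP => // ij; rewrite -ij ijs in jjs.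
rewrite [RHS](reindex_onto up down) /=; last first.
  move=> f /andP [_ /eqP fj]; apply/ffunP => i; rewrite !ffunE.
  by case: eqP => // ->.
apply: eq_big => [f|f _]; last first.
  rewrite big_cons ffunE eqxx -mulrA; congr (_ * (_ * phi (_ ++ flatten _))).
    by apply: eq_big_seq => i ijs; rewrite upj.
  by apply/eq_in_map => i ijs; rewrite upj.
apply/forallP/andP => [h|[/andP [/forallP h _] /eqP dn] i].
  split; first (apply/andP; split).
  - apply/forallP => i; rewrite inE ffunE; case: eqVneq => [->|ij] //=.
  - by rewrite ffunE eqxx.
  - apply/eqP/ffunP => i; rewrite !ffunE; case: eqVneq => // ->.
    by have := h j; rewrite (negbTE jjs) => /eqP.
have := h i; rewrite inE ffunE -{2 4}dn !ffunE; case: eqVneq => [->|] //=.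
by rewrite (negbTE jjs) eqxx.
Qed.

(** Disjoint blocks whose sizes add up to d cover all indices, hence are the fibers of a unique
    colouring. *)
Lemma admissible_colorings (R : nmodType) (mus : seq (seq nat))
    (G : {ffun 'I_(size mus) -> {set 'I_d}} -> R) :
  sumn (map sumn mus) = d ->
  \sum_(Is | admissible Is) G Is =
  \sum_(t : {ffun 'I_d -> 'I_(size mus)} |
     has_content (fun j : 'I_(size mus) => sumn (nth [::] mus j)) t)
    G [ffun j => [set x | t x == j]].
Proof.
move=> smus; set al := (fun j : 'I_(size mus) => sumn (nth [::] mus j)).
have sal : (\sum_j al j = d)%N.
  by rewrite -[RHS]smus sumnE big_map (big_nth [::]) big_mkord.
pose h (t : {ffun 'I_d -> 'I_(size mus)}) : {ffun 'I_(size mus) -> {set 'I_d}} :=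
  [ffun j => [set x | t x == j]].
have hI : injective h.
  move=> t t' /ffunP tt; apply/ffunP => x; apply/esym/eqP.
  by have /setP /(_ x) := tt (t x); rewrite !ffunE !inE eqxx => /esym.
transitivity (\sum_(Is in h @: [set t | has_content al t]) G Is); last first.
  rewrite big_imset /=; last by move=> t t' _ _; apply: hI.
  by apply: eq_bigl => t; rewrite inE.
apply: eq_bigl => Is; apply/andP/imsetP => [[/forallP cI dI]|[t]]; last first.
  rewrite inE => /forallP ct ->; split.
    by apply/forallP => j; rewrite ffunE -size_fiber; apply: ct.
  apply/forallP => i; apply/forallP => j; apply/implyP => ij.
  rewrite -setI_eq0; apply/eqP/setP => x; rewrite !ffunE !inE.
  by apply/negbTE/negP => /andP [/eqP ->]; rewrite (negbTE ij).
have le1 x : (\sum_j (x \in Is j) <= 1)%N.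
  have [/existsP [j xj]|/existsPn xN] := boolP [exists j, x \in Is j]; last first.
    by rewrite big1 // => j _; rewrite (negbTE (xN j)).
  rewrite (bigD1 j) //= xj big1 // => i ij.
  have := forallP (forallP dI i) j; rewrite ij /= => /pred0P /(_ x) /=.
  by rewrite xj andbT => ->.
(* If [x] were missed, the other d - 1 indices, each in at most one block, would have to make up a
   total of d. *)
have cov x : exists j, x \in Is j.
  apply/existsP; apply: contraT => /existsPn xN.
  have : (\sum_x \sum_j (x \in Is j) = d)%N.
    rewrite exchange_big -[RHS]sal; apply: eq_bigr => j _.
    by rewrite -big_mkcond sum1_card (eqP (cI j)).
  rewrite (bigD1 x) //= big1 ?add0n => [|j _]; last by rewrite (negbTE (xN j)).
  have : (\sum_(y | y != x) \sum_j (y \in Is j) <= d.-1)%N.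
    apply: leq_trans (_ : \sum_(y : 'I_d | y != x) 1 <= _)%N; first exact: leq_sum.
    by rewrite sum1_card -[d in X in (_ <= X)%N](card_ord d) -(cardC1 x).
  by move=> le E; move: le; rewrite E; have := ltn_ord x; lia.
pose t := [ffun x => xchoose (cov x)].
have tE x j : (t x == j) = (x \in Is j).
  rewrite ffunE; apply/eqP/idP => [<-|xj]; first exact: (xchooseP (cov x)).
  apply/eqP/negPn/negP => ne.
  have := forallP (forallP dI (xchoose (cov x))) j; rewrite ne /= => /pred0P /(_ x) /=.
  by rewrite xj (xchooseP (cov x)).
have IsE : Is = h t by apply/ffunP => j; rewrite ffunE; apply/setP => x; rewrite inE tE.
exists t => //; rewrite inE; apply/forallP => j; rewrite size_fiber.
by have := cI j; rewrite {1}IsE ffunE.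
Qed.

Lemma eq_perm_eps (e : seq 'I_d) (u v : 'S_d) : {in e, u =1 v} -> perm_eps e u = perm_eps e v.
Proof.
by move=> uv; congr (_ (+) _); apply: eq_pair_xor => i j ie je; rewrite !uv.
Qed.

(** The character induced from a Young subgroup with block sizes [sumn (nth [::] mus j)]: colourings
    of this content stand for its cosets, and those stable under [u] are the fixed ones. *)
Definition ind_char (mus : seq (seq nat)) (u : 'S_d) : C :=
  \sum_(t : {ffun 'I_d -> 'I_(size mus)} |
     has_content (fun j : 'I_(size mus) => sumn (nth [::] mus j)) t && stab t u)
    \prod_(j < size mus) @irr_char C _ (nth [::] mus j) (sub_perm (fiber t j) u).

Lemma ind_char_class (mus : seq (seq nat)) : all is_partition mus -> class_fun (ind_char mus).
Proof.
move=> /all_nthP pmus u g; rewrite /ind_char.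
pose h (t : {ffun 'I_d -> 'I_(size mus)}) : {ffun 'I_d -> 'I_(size mus)} := [ffun x => t (g x)].
have hI : injective h.
  move=> t t' /ffunP tt; apply/ffunP => x; have := tt (g^-1 x)%g.
  by rewrite !ffunE permKV.
rewrite [RHS](reindex_inj hI) /=; apply: eq_big => [t|t /andP [/forallP ct st]].
  by rewrite stab_comp; congr (_ && _); apply: eq_forallb => j; rewrite size_fiber_comp.
apply: eq_bigr => j _; apply/esym.
apply: (sub_perm_conj (f := fun k => @irr_char C k (nth [::] mus j))); rewrite ?fiber_uniq //.
- apply: irr_char_class; first by rewrite (eqP (ct j)).
  exact: (pmus [::]).
- by move=> x; rewrite !mem_fiber ffunE.
- by apply: stab_fiber; rewrite stab_comp.
Qed.

Lemma chs_ind_char (mus : seq (seq nat)) : all is_partition mus ->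
  sumn (map sumn mus) = d ->
  chs (@spsum C m n) (ind_char mus) = (d`!%:R : C) *: \prod_(la <- mus) superSchur C m n la.
Proof.
move=> /all_nthP pmus smus.
have sal : (\sum_(j < size mus) sumn (nth [::] mus j) = d)%N.
  by rewrite -[RHS]smus sumnE big_map (big_nth [::]) big_mkord.
rewrite /chs /ind_char (chs_ind _ (fun (j : 'I_(size mus)) k =>
  @irr_char C k (nth [::] mus j)) sal).
congr (_ *: _); rewrite [RHS](big_nth [::]) big_mkord; apply: eq_bigr => j _.
by rewrite chs_irr_char ?(pmus [::]) // scalerA mulVf ?fact_neq0 // scale1r.
Qed.

(** A choice of one permutation per block of [t] is one [u] in [stab t], and its signs and word
    combine to [theta C u w] whatever [t] is; exchanging the sums collects the characters into
    [ind_char]. *)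
Lemma ev_imm_products (mus : seq (seq nat)) w : sumn (map sumn mus) = d ->
  \sum_(Is : {ffun 'I_(size mus) -> {set 'I_d}} | admissible Is)
     ev (foldr (@Amul C m n) (Aone C m n)
       [seq Imm C (nth [::] mus j) (enum (Is j)) | j : 'I_(size mus) <- enum 'I_(size mus)])
       (fun v => word_coeff C v w) =
  \sum_u ind_char mus u * theta C u w.
Proof.
move=> smus; rewrite admissible_colorings //.
under [RHS]eq_bigr => u _ do rewrite mulr_suml.
rewrite [RHS](exchange_big_dep (has_content (fun j : 'I_(size mus) =>
  sumn (nth [::] mus j)))) /=; last first.
  by move=> u t _ /andP[].
apply: eq_bigr => t ct; rewrite [RHS](eq_bigl (stab t)) => [|u]; last by rewrite ct.
pose a (j : 'I_(size mus)) (u : 'S_d) : C := @irr_char C _ (nth [::] mus j) (sub_perm (fiber t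
  j) u) *
  (-1) ^+ perm_eps (fiber t j) u.
rewrite (ev_foldr 1%g (Q := fun j => [pred u | perm_on [set x in fiber t j] u]) (a := a)
  (wd := fun j u => perm_word (fiber t j) u)); last exact: enum_uniq.
- transitivity (\sum_(f in family (fun j => [pred u : 'S_d | perm_on [set x in fiber t j] u]))
    (\prod_j a j (f j)) * word_coeff C (flatten [seq perm_word (fiber t j) (f j) | j <- enum
      'I_(size mus)]) w).
    apply: eq_big => [f|f _]; last by rewrite big_enum.
    by apply/forallP/familyP => h j; have := h j; rewrite mem_enum.
  rewrite (reindex_stab (F := fun f => (\prod_j a j (f j)) *
     word_coeff C (flatten [seq perm_word (fiber t j) (f j) | j <- enum 'I_(size mus)]) w));
       last first.
    move=> f g fg; congr (_ * word_coeff C (flatten _) w).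
      apply: eq_bigr => j _; by rewrite /a (eq_sub_perm (fg j)) (eq_perm_eps (fg j)).
    apply: eq_map => j; apply/eq_in_map => x xj; rewrite fg //.
  apply: eq_bigr => u su; rewrite /a big_split /= -mulrA; congr (_ * _).
  rewrite -(theta_fibers C w su); congr (_ * _).
  rewrite big_enum /=; apply/esym.
  by apply: (big_morph (fun b : bool => (-1) ^+ b : C)) => // x y; apply: signr_addb.
- move=> j phi; rewrite ffunE /Imm ev_imm; last exact: enum_uniq.
  by apply: eq_bigr => u _; rewrite mulrA.
Qed.

End Products.

Theorem theorem3p1 (C : numClosedFieldType) (m n N : nat) (c : 'I_N -> C)
    (mu : 'I_N -> seq (seq nat)) :
  (forall s, all is_partition (mu s)) ->
  (forall s, sumn (map sumn (mu s)) = (m + n)%N) ->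
  \sum_(s < N) c s *: \prod_(la <- mu s) superSchur C m n la = 0 ->
  Azero
    (\big[cat/[::]]_(s < N)
       Ascale (c s)
         (\big[cat/[::]]_(Is : {ffun 'I_(size (mu s)) -> {set 'I_(m + n)}}
                          | admissible Is)
            foldr (@Amul C m n) (Aone C m n)
              [seq Imm C (nth [::] (mu s) j) (enum (Is j))
                 | j : 'I_(size (mu s)) <- enum 'I_(size (mu s))])).
Proof.
move=> pmu smu rel w.
pose F (u : 'S_(m + n)) := \sum_(s < N) c s * ind_char C (mu s) u.
have F0 : forall u, F u = 0.
  (* The degree and the number of variables are both m + n here, as the independence argument
     requires. *)
  apply: (class_fun_eq0 (super_sgn_neq0 C (m := m) (n := n)) (super_sgn_neq0 C (m := m) (n :=
    n))).
    apply: class_fun_cyc_count => u g; apply: eq_bigr => s _.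
    by rewrite ind_char_class.
  rewrite /chs; under eq_bigr => u _ do rewrite scaler_suml.
  rewrite exchange_big /=.
  rewrite (eq_bigr (fun s => ((m + n)`!%:R :
    C) *: (c s *: \prod_(la <- mu s) superSchur C m n la))).
    by rewrite -scaler_sumr rel scaler0.
  move=> s _; rewrite scalerA mulrC -scalerA -chs_ind_char // scaler_sumr.
  by apply: eq_bigr => u _; rewrite scalerA.
rewrite -[LHS]/(ev _ (fun v => word_coeff C v w)) ev_bigcat.
transitivity (\sum_u F u * theta C u w); last by rewrite big1 // => u _; rewrite F0 mul0r.
under [RHS]eq_bigr => u _ do rewrite mulr_suml.
rewrite [RHS]exchange_big /=; apply: eq_bigr => s _.
rewrite ev_scale ev_bigcat ev_imm_products // mulr_sumr.
by apply: eq_bigr => u _; rewrite mulrA.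
Qed.
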